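(* Let $X\subseteq\mathbb{A}^n$ be an $\mathbb{F}_q$-variety of dimension $r$ and degree $d<q$, with decomposition $X=X_1\cup\dots\cup X_m$ and integers $0\le\sigma\le\rho\le m$ as described in the context, and let $U\subseteq\mathbb{F}_q^n$ be nonempty. Then: (i) $$\Delta\le \#U\cdot\Big(\sum_{0\neq u\in U-U}\ \sum_{1\le i,j\le\sigma}\#\big(X_i(\mathbb{F}_q)\cap X_j^{(u)}(\mathbb{F}_q)\big)+2\big(\#(U-U)-1\big)\sum_{\sigma<i\le m}\#X_i(\mathbb{F}_q)\Big).$$ (ii) If moreover $X$ is essentially $(U-U)$-shift-free, then $$\Delta\le \#U\,\big(\#(U-U)-1\big)\, d^2 q^{r-1}.$$
   Context: Let $p$ be a prime, $q$ a power of $p$, $\overline{\mathbb{F}_q}$ an algebraic closure of $\mathbb{F}_q$ and $\mathbb{A}^n=\overline{\mathbb{F}_q}^{\,n}$. An $\mathbb{F}_q$-variety is the common zero set in $\mathbb{A}^n$ of a set of polynomials in $\mathbb{F}_q[x_1,\dots,x_n]$; $X(\mathbb{F}_q)=X\cap\mathbb{F}_q^n$. The degree of an $\mathbb{F}_q$-irreducible variety $X$ is the maximum number of points in $X\cap L$ over affine linear subspaces $L$ of codimension $\dim X$ with $X\cap L$ finite; the degree of an arbitrary $\mathbb{F}_q$-variety is the sum of the degrees of its $\mathbb{F}_q$-irreducible components. Decomposition: write $X=X_1\cup\dots\cup X_m$ as the non-redundant union of its $\mathbb{F}_q$-irreducible components, numbered so that $X_1,\dots,X_\sigma$ are absolutely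 irreducible of dimension $r=\dim X$, $X_{\sigma+1},\dots,X_\rho$ are absolutely irreducible of dimension less than $r$, and $X_{\rho+1},\dots,X_m$ are not absolutely irreducible ($0\le\sigma\le\rho\le m$). For $u\in\mathbb{A}^n$, $X^{(u)}=\{a+u:a\in X\}$. For $U\subseteq\mathbb{F}_q^n$, $X$ is essentially $U$-shift-free if $X_i\neq X_j^{(u)}$ for all nonzero $u\in U$ and all $1\le i,j\le\sigma$ (vacuous if $\sigma=0$). For nonempty $U\subseteq\mathbb{F}_q^n$, $X(\mathbb{F}_q)+U=\{a+u: a\in X(\mathbb{F}_q),u\in U\}$, $U-U=\{v-w:v,w\in U\}$, and $\Delta=\#X(\mathbb{F}_q)\cdot\#U-\#(X(\mathbb{F}_q)+U)$. *)

(* Defs.v *)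
From HB Require Import structures.
From mathcomp Require Import all_boot all_order all_algebra all_field.
From mathcomp Require Import mpoly.
From Stdlib Require Import ClassicalEpsilon.
Set Implicit Arguments. Unset Strict Implicit. Unset Printing Implicit Defensive.
Import GRing.Theory.
Local Open Scope ring_scope.

Definition asb (P : Prop) : bool :=
  if excluded_middle_informative P then true else false.

Section Geometry.
Variables (K : fieldType) (n : nat).

Definition vset := 'rV[K]_n -> Prop.
Definition coords (x : 'rV[K]_n) : 'I_n -> K := fun i => x ord0 i.

Definition set_eq (A B : vset) := forall x, A x <-> B x.
Definition subs (A B : vset) := forall x, A x -> B x.
Definition setUv (A B : vset) : vset := fun x => A x \/ B x.
Definition setIv (A B : vset) : vset := fun x => A x /\ B x.

Definition zero_set (S : {mpoly K[n]} -> Prop) : vset :=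
  fun x => forall P, S P -> P.@[coords x] = 0.

Definition closedK (A : vset) := exists S, set_eq A (zero_set S).

(* irreducible over K (K algebraically closed: absolutely irreducible) *)
Definition irreducibleK (A : vset) :=
  (exists x, A x) /\
  forall B C, closedK B -> closedK C -> set_eq A (setUv B C) ->
    set_eq A B \/ set_eq A C.

Definition irr_chain (Z : nat -> vset) (k : nat) :=
  (forall i, (i <= k)%N -> closedK (Z i) /\ irreducibleK (Z i)) /\
  (forall i, (i < k)%N -> subs (Z i) (Z i.+1) /\ ~ subs (Z i.+1) (Z i)).

Definition is_dim (A : vset) (r : nat) :=
  (exists Z, irr_chain Z r /\ subs (Z r) A) /\
  (forall Z k, irr_chain Z k -> subs (Z k) A -> (k <= r)%N).

Definition has_card (A : vset) (k : nat) :=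
  exists s : seq 'rV[K]_n, [/\ uniq s, forall x, A x <-> x \in s & size s = k].

Definition aff_sub k (a : 'rV[K]_n) (B : 'M[K]_(k, n)) : vset :=
  fun x => exists v : 'rV[K]_k, x = a + v *m B.

(* degree (as defined for irreducible varieties): max #(A cap L) over affine
   linear subspaces L of codimension dim A with A cap L finite *)
Definition is_degree (A : vset) (d : nat) :=
  exists r, is_dim A r /\
   (exists (a : 'rV[K]_n) (B : 'M[K]_(n - r, n)),
       row_free B /\ has_card (setIv A (aff_sub a B)) d) /\
   (forall (a : 'rV[K]_n) (B : 'M[K]_(n - r, n)) k,
       row_free B -> has_card (setIv A (aff_sub a B)) k -> (k <= d)%N).

Definition shift (A : vset) (u : 'rV[K]_n) : vset := fun x => A (x - u).

End Geometry.

Section OverFq.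
Variables (F : finFieldType) (K : fieldType) (iota : {rmorphism F -> K}) (n : nat).

Definition Fq_variety (X : vset K n) :=
  exists S : {mpoly F[n]} -> Prop,
    set_eq X (zero_set (fun P => exists Q, S Q /\ P = map_mpoly iota Q)).

Definition Fq_irreducible (X : vset K n) :=
  Fq_variety X /\ (exists x, X x) /\
  forall B C, Fq_variety B -> Fq_variety C -> set_eq X (setUv B C) ->
    set_eq X B \/ set_eq X C.

Definition Fq_points (X : vset K n) : {set 'rV[F]_n} :=
  [set a | asb (X (map_mx iota a))].

End OverFq.

(* Main.v *)
Require Import Defs.
From HB Require Import structures.
From mathcomp Require Import all_boot all_order all_algebra all_field.
From mathcomp Require Import mpoly.
From Stdlib Require Import ClassicalEpsilon.
From mathcomp Require Import perm zify ring.
Set Implicit Arguments. Unset Strict Implicit. Unset Printing Implicit Defensive.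
Import GRing.Theory.
Local Open Scope ring_scope.

(* Writing c = a + u in two ways yields a rational point of X and X^(w) for some non-zero
   w in U - U, so Delta is at most #U times the sum of #(X(Fq) and X^(w)(Fq)) over such w; the
   decomposition of X bounds each term.  For (ii), since d < q, one finds successively
   Fq-rational directions such that the linear projection along them to A^r is finite on every
   component.  Distinct absolutely irreducible V1, V2 of dimension s, finite over A^s, project
   to distinct irreducible hypersurfaces P1, P2 in A^(s+1) if one adds a linear form, with
   coefficients in the algebraic closure, that separates the rational points.  The resultant of
   P1 and P2 has degree at most deg P1 deg P2, and its order at a rational c in A^s is at least
   the number of common rational points of V1 and V2 above c; the Schwartz-Zippel bound with
   multiplicities gives q #(common points) <= deg V1 deg V2 q^s.  This applies to X_i and
   X_j^(w), and to two Frobenius conjugate components of an X_i which is not absolutely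
   irreducible, all of whose rational points lie on every conjugate. *)

(** * Degree bounds *)

(** The obstacle is that degrees are only counts of points in finite linear sections, so Bezout is
    not at hand. A transversal line turns degrees of equations into points: its preimage under a
    linear projection is a section of the right codimension, so the equation of a hypersurface image
    has degree at most that of the variety. The resultant then plays Bezout's part. Only the base
    points of the last projection have to be rational; the extra linear form is injective on F^n,
    which is impossible over [F] for n > 1. The condition d < q is applied to a product of one
    equation per component: its degree is at most the sum of the component degrees, so its top form
    has a rational non-root, and one projection serves all components. In (ii), let D, E, G be the
    degree sums over the three kinds of components. The square d^2 = (D + E + G)^2 pays D^2 for the
    pairs, 2E for the smaller components, counted twice, and G^2 for the components that are not
    absolutely irreducible, each of which has at most e^2 q^(r-1) / 4 rational points if its degree
    is e. *)

Lemma rmorph_mpoly_ext (R : comNzRingType) n (S : nzRingType)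
    (f g : {rmorphism {mpoly R[n]} -> S}) :
  (forall c, f c%:MP = g c%:MP) -> (forall i, f 'X_i = g 'X_i) -> f =1 g.
Proof.
move=> hC hX p; rewrite (mpolyE p) !rmorph_sum; apply: eq_bigr => m _.
rewrite -mul_mpolyC !rmorphM hC; congr (_ * _).
rewrite mpolyXE_id !rmorph_prod; apply: eq_bigr => i _.
by rewrite !rmorphXn hX.
Qed.

Lemma rmorph_poly_ext (R S : nzRingType) (f g : {rmorphism {poly R} -> S}) :
  (forall c, f c%:P = g c%:P) -> f 'X = g 'X -> f =1 g.
Proof.
move=> hC hX; elim/poly_ind => [|p c IH]; first by rewrite !rmorph0.
by rewrite !rmorphD !rmorphM hC hX IH.
Qed.

Section DegreeBounds.
Variables (R : comNzRingType) (n : nat).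
Implicit Types f g : {mpoly R[n]}.

(** Writing [mdeg m + a <= b] avoids truncated subtraction, so that products and determinants add
    weights on both sides. For [b < a] it forces [f = 0], which is what the weighted bound below
    asks of coefficients of high index. *)
Definition mdeg_le f (a b : nat) := forall m, m \in msupp f -> (mdeg m + a <= b)%N.

Lemma mdeg_le0 a b : mdeg_le 0 a b.
Proof. by move=> m; rewrite msupp0. Qed.

Lemma mdeg_leC c a b : (a <= b)%N -> mdeg_le c%:MP a b.
Proof.
move=> ab m; rewrite msuppC; case: ifP => // _; rewrite inE => /eqP ->.
by rewrite mdeg0.
Qed.

Lemma mdeg_leX i : mdeg_le 'X_i 0 1.
Proof. by move=> m; rewrite msuppX inE => /eqP ->; rewrite mdeg1. Qed.

Lemma mdeg_leD f g a b : mdeg_le f a b -> mdeg_le g a b -> mdeg_le (f + g) a b.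
Proof. by move=> hf hg m /msuppD_le; rewrite mem_cat => /orP[/hf|/hg]. Qed.

Lemma mdeg_leM f g a b a' b' :
  mdeg_le f a b -> mdeg_le g a' b' -> mdeg_le (f * g) (a + a') (b + b').
Proof.
move=> hf hg m /msuppM_le /allpairsP [[m1 m2] /= [/hf h1 /hg h2 ->]].
by rewrite mdegD; lia.
Qed.

Lemma mdeg_leZ c f a b : mdeg_le f a b -> mdeg_le (c *: f) a b.
Proof. by move=> hf m /msuppZ_le/hf. Qed.

Lemma mdeg_leN f a b : mdeg_le f a b -> mdeg_le (- f) a b.
Proof. by move=> hf m; rewrite (perm_mem (msuppN f)); apply: hf. Qed.

Lemma mdeg_le_sum (I : Type) (r : seq I) (P : pred I) (F : I -> {mpoly R[n]}) a b :
  (forall i, P i -> mdeg_le (F i) a b) -> mdeg_le (\sum_(i <- r | P i) F i) a b.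
Proof.
move=> h; elim/big_ind: _ => //; first exact: mdeg_le0.
by move=> *; apply: mdeg_leD.
Qed.

Lemma mdeg_leW f a b a' b' :
  mdeg_le f a b -> (b + a' <= b' + a)%N -> mdeg_le f a' b'.
Proof. by move=> hf h m /hf; lia. Qed.

Lemma mdeg_le_msize f : mdeg_le f 0 (msize f).-1.
Proof. by move=> m /msize_mdeg_lt; lia. Qed.

Lemma msize_mdeg_le f b : mdeg_le f 0 b -> (msize f <= b.+1)%N.
Proof.
move=> h; rewrite msizeE; apply/bigmax_leqP_seq => m /h hm _; lia.
Qed.

Lemma mdeg_le_exp f e k : mdeg_le f 0 e -> mdeg_le (f ^+ k) 0 (e * k).
Proof.
move=> h; elim: k => [|k IH]; first by rewrite expr0; apply: mdeg_leC; lia.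
by rewrite exprS mulnS; apply: (mdeg_leM h IH).
Qed.

Lemma mdeg_le_prod (I : Type) (r : seq I) (P : pred I) (F : I -> {mpoly R[n]})
    (a b : I -> nat) :
  (forall i, P i -> mdeg_le (F i) (a i) (b i)) ->
  mdeg_le (\prod_(i <- r | P i) F i) (\sum_(i <- r | P i) a i) (\sum_(i <- r | P i) b i).
Proof.
move=> h; elim/big_rec3: _ => [|i x y z Pi IH]; first by apply: mdeg_leC.
exact: mdeg_leM (h _ Pi) IH.
Qed.

End DegreeBounds.

Section WeightedPoly.
Variables (R : comNzRingType) (k : nat).
Implicit Types p q : {poly {mpoly R[k]}}.

(* The variable of p has weight 1: p represents a polynomial in k + 1 variables
   of total degree at most e. *)
Definition wdeg_le p e := forall i, mdeg_le p`_i i e.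

Lemma wdeg_leW p e e' : (e <= e')%N -> wdeg_le p e -> wdeg_le p e'.
Proof. by move=> ee h i; apply: (mdeg_leW (h i)); lia. Qed.

Lemma wdeg_leD p q e : wdeg_le p e -> wdeg_le q e -> wdeg_le (p + q) e.
Proof. by move=> hp hq i; rewrite coefD; apply: mdeg_leD. Qed.

Lemma wdeg_leM p q e e' : wdeg_le p e -> wdeg_le q e' -> wdeg_le (p * q) (e + e').
Proof.
move=> hp hq i; rewrite coefM; apply: mdeg_le_sum => j _.
by apply: (mdeg_leW (mdeg_leM (hp j) (hq (i - j)%N))); have := ltn_ord j; lia.
Qed.

Lemma wdeg_leC (c : {mpoly R[k]}) e : mdeg_le c 0 e -> wdeg_le c%:P e.
Proof. by move=> hc i; rewrite coefC; case: eqP => [->|_] //; apply: mdeg_le0. Qed.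

Lemma wdeg_le_X : wdeg_le 'X 1.
Proof.
move=> i; rewrite coefX; case: eqP => [->|_] /=; last exact: mdeg_le0.
by apply: mdeg_leC.
Qed.

Lemma wdeg_le_prod (I : Type) (r : seq I) (F : I -> {poly {mpoly R[k]}}) (b : I -> nat) :
  (forall i, wdeg_le (F i) (b i)) -> wdeg_le (\prod_(i <- r) F i) (\sum_(i <- r) b i).
Proof.
move=> h; elim/big_rec2: _ => [|i x y _ IH]; last exact: wdeg_leM.
by apply: wdeg_leC; apply: mdeg_leC.
Qed.

Lemma wdeg_le_exp p e m : wdeg_le p e -> wdeg_le (p ^+ m) (e * m).
Proof.
move=> h; elim: m => [|m IH]; first by rewrite expr0; apply: wdeg_leC; apply: mdeg_leC.
by rewrite exprS mulnS; apply: wdeg_leM.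
Qed.

Lemma wdeg_le_size p e : wdeg_le p e -> (size p <= e.+1)%N.
Proof.
move=> h; apply/leq_sizeP => j ej; apply/eqP; rewrite -msupp_eq0.
by case E: (msupp _) => [//|m s]; have := h j m; rewrite E mem_head => /(_ isT); lia.
Qed.

End WeightedPoly.

(** * Linear changes of coordinates *)

Section Substitutions.
Variable K : fieldType.

(** The comorphism of the linear map [x *m M]; see [pull_ev]. *)
Definition pull n k (M : 'M[K]_(n, k)) (f : {mpoly K[k]}) : {mpoly K[n]} :=
  mmap (@mpolyC n K) (fun j => \sum_i M i j *: 'X_i) f.
HB.instance Definition _ n k (M : 'M[K]_(n, k)) :=
  GRing.RMorphism.copy (pull M) (mmap (@mpolyC n K) (fun j => \sum_i M i j *: 'X_i)).

Lemma pullC n k (M : 'M[K]_(n, k)) c : pull M c%:MP = c%:MP.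
Proof. exact: mmapC. Qed.

Lemma pullX n k (M : 'M[K]_(n, k)) j : pull M 'X_j = \sum_i M i j *: 'X_i.
Proof. by rewrite /pull mmapX mmap1U. Qed.

Lemma pull_lin n k (M : 'M[K]_(n, k)) (c : 'I_k -> K) :
  pull M (\sum_j c j *: 'X_j) = \sum_i (\sum_j M i j * c j) *: 'X_i.
Proof.
rewrite raddf_sum /=.
under eq_bigr => j _ do rewrite -mul_mpolyC rmorphM /= pullC pullX mul_mpolyC scaler_sumr.
rewrite exchange_big /=; apply: eq_bigr => i _; rewrite scaler_suml.
by apply: eq_bigr => j _; rewrite scalerA mulrC.
Qed.

Lemma pull_ev n k (M : 'M[K]_(n, k)) f (x : 'rV[K]_n) :
  (pull M f).@[coords x] = f.@[coords (x *m M)].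
Proof.
have: meval (coords x) \o pull M =1 meval (coords (x *m M)); last exact.
apply: rmorph_mpoly_ext => [c|j] /=; first by rewrite pullC !mevalC.
rewrite pullX mevalXU raddf_sum /= /coords mxE; apply: eq_bigr => i _.
by rewrite mevalZ mevalXU mulrC.
Qed.

Lemma mdeg_le_lin n (c : 'I_n -> K) : mdeg_le (\sum_i c i *: 'X_i) 0 1.
Proof. by apply: mdeg_le_sum => i _; apply: mdeg_leZ; apply: mdeg_leX. Qed.

Lemma mdeg_le_pull n k (M : 'M[K]_(n, k)) f e : mdeg_le f 0 e -> mdeg_le (pull M f) 0 e.
Proof.
move=> hf; rewrite {1}(mpolyE f) raddf_sum /= big_seq; apply: mdeg_le_sum => m /hf hm.
rewrite -mul_mpolyC rmorphM /= pullC mul_mpolyC; apply: mdeg_leZ.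
rewrite mpolyXE_id rmorph_prod /=.
have h : mdeg_le (\prod_(i < k) pull M ('X_i ^+ m i)) (\sum_(i < k) 0) (\sum_(i < k) m i).
  apply: mdeg_le_prod => i _; rewrite rmorphXn /= pullX -[X in mdeg_le _ _ X]mul1n.
  by apply: mdeg_le_exp; apply: mdeg_le_lin.
by apply: mdeg_leW h _; move: hm; rewrite -mdegE big1 //; lia.
Qed.

(* A direction v, a complement spanned by the rows of L, and the matching
   coordinates: x = (x *m tau) v + (x *m M) L. *)
Definition frame k (v : 'rV[K]_k.+1) (L : 'M[K]_(k, k.+1)) (tau : 'cV[K]_k.+1)
    (M : 'M[K]_(k.+1, k)) :=
  [/\ tau *m v + M *m L = 1%:M, v *m tau = 1%:M, v *m M = 0, L *m tau = 0 & L *m M = 1%:M].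

(* f (y *m L + t *: v) as a polynomial in t with coefficients in the coordinates of y. *)
Definition theta k (v : 'rV[K]_k.+1) (L : 'M[K]_(k, k.+1)) (f : {mpoly K[k.+1]}) :
    {poly {mpoly K[k]}} :=
  mmap (polyC \o @mpolyC k K)
    (fun i => (\sum_j L j i *: 'X_j)%:P + ((v 0 i)%:MP)%:P * 'X) f.
HB.instance Definition _ k (v : 'rV[K]_k.+1) (L : 'M[K]_(k, k.+1)) :=
  GRing.RMorphism.copy (theta v L) (mmap (polyC \o @mpolyC k K)
    (fun i => (\sum_j L j i *: 'X_j)%:P + ((v 0 i)%:MP)%:P * 'X)).

Lemma thetaC k (v : 'rV[K]_k.+1) L c : theta v L c%:MP = (c%:MP)%:P.
Proof. exact: mmapC. Qed.

Lemma thetaX k (v : 'rV[K]_k.+1) L i :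
  theta v L 'X_i = (\sum_j L j i *: 'X_j)%:P + ((v 0 i)%:MP)%:P * 'X.
Proof. by rewrite /theta mmapX mmap1U. Qed.

Definition ev2 k (p : {poly {mpoly K[k]}}) (y : 'rV[K]_k) (t : K) :=
  (map_poly (meval (coords y)) p).[t].

Lemma theta_ev k (v : 'rV[K]_k.+1) L f y t :
  ev2 (theta v L f) y t = f.@[coords (t *: v + y *m L)].
Proof.
have: horner_eval t \o (map_poly (meval (coords y)) \o theta v L)
   =1 meval (coords (t *: v + y *m L)); last exact.
apply: rmorph_mpoly_ext => [c|i] /=.
  by rewrite thetaC map_polyC /= /horner_eval hornerC !mevalC.
rewrite thetaX rmorphD rmorphM /= map_polyX !map_polyC /= /horner_eval !hornerE mevalC.
rewrite mevalXU raddf_sum /= /coords !mxE addrC mulrC; congr (_ + _).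
by apply: eq_bigr => j _; rewrite mevalZ mevalXU mulrC.
Qed.

(** The inverse of [theta v L] when all four belong to one frame; the pair transports primality and
    unique factorisation between [k.+1] variables and one variable over [k]. *)
Definition unsplit_var k (tau : 'cV[K]_k.+1) (M : 'M[K]_(k.+1, k)) (p : {poly {mpoly K[k]}}) :
    {mpoly K[k.+1]} :=
  (map_poly (pull M) p).[\sum_i tau i 0 *: 'X_i].
HB.instance Definition _ k (tau : 'cV[K]_k.+1) (M : 'M[K]_(k.+1, k)) :=
  GRing.RMorphism.copy (unsplit_var tau M)
    (horner_eval (\sum_i tau i 0 *: 'X_i) \o map_poly (pull M)).

Lemma unsplit_varC k (tau : 'cV[K]_k.+1) M c : unsplit_var tau M c%:P = pull M c.
Proof. by rewrite /unsplit_var map_polyC hornerC. Qed.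

Lemma unsplit_varX k (tau : 'cV[K]_k.+1) M : unsplit_var tau M 'X = \sum_i tau i 0 *: 'X_i.
Proof. by rewrite /unsplit_var map_polyX hornerX. Qed.

Lemma unsplit_var_ev k (tau : 'cV[K]_k.+1) M p x :
  (unsplit_var tau M p).@[coords x] = ev2 p (x *m M) ((x *m tau) 0 0).
Proof.
have: meval (coords x) \o unsplit_var tau M =1
   horner_eval ((x *m tau) 0 0) \o map_poly (meval (coords (x *m M))); last exact.
apply: rmorph_poly_ext => [c|] /=.
  by rewrite unsplit_varC map_polyC /= /horner_eval hornerC pull_ev.
rewrite unsplit_varX map_polyX /horner_eval hornerX raddf_sum /= mxE; apply: eq_bigr => i _.
by rewrite mevalZ mevalXU mulrC.
Qed.

Section Frame.
Variables (k : nat) (v : 'rV[K]_k.+1) (L : 'M[K]_(k, k.+1)) (tau : 'cV[K]_k.+1).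
Variable M : 'M[K]_(k.+1, k).
Hypothesis fr : frame v L tau M.

Lemma frame_dec x : x = (x *m tau) 0 0 *: v + x *m M *m L.
Proof.
have [h _ _ _ _] := fr; rewrite -{1}[x]mulmx1 -h mulmxDr !mulmxA; congr (_ + _).
by rewrite {1}[x *m tau]mx11_scalar mul_scalar_mx.
Qed.

Lemma frameM t y : (t *: v + y *m L) *m M = y.
Proof.
by have [_ _ h1 _ h2] := fr; rewrite mulmxDl -scalemxAl h1 scaler0 add0r -mulmxA h2 mulmx1.
Qed.

Lemma frametau t y : ((t *: v + y *m L) *m tau) 0 0 = t.
Proof.
have [_ h1 _ h2 _] := fr.
by rewrite mulmxDl -scalemxAl h1 -mulmxA h2 mulmx0 addr0 !mxE eqxx mulr1.
Qed.

Lemma thetaK : cancel (theta v L) (unsplit_var tau M).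
Proof.
have [h _ _ _ _] := fr.
move=> f; have: unsplit_var tau M \o theta v L =1 idfun; last exact.
apply: rmorph_mpoly_ext => [c|i] /=; first by rewrite thetaC unsplit_varC pullC.
rewrite thetaX rmorphD rmorphM /= !unsplit_varC unsplit_varX pullC mul_mpolyC pull_lin scaler_sumr.
rewrite -big_split /= (bigD1 i) //= [X in _ + X]big1 ?addr0 => [|j ji].
  rewrite scalerA -scalerDl -[RHS]scale1r. congr (_ *: _).
  have /matrixP/(_ i i) := h; rewrite !mxE eqxx big_ord1 => e.
  by rewrite addrC [v 0 i * _]mulrC; exact: e.
rewrite scalerA -scalerDl -[RHS](scale0r 'X_j); congr (_ *: _).
have /matrixP/(_ j i) := h; rewrite !mxE (negbTE ji) big_ord1 => e.
by rewrite addrC [v 0 i * _]mulrC; exact: e.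
Qed.

Lemma unsplit_varK : cancel (unsplit_var tau M) (theta v L).
Proof.
have [_ h1 h2 h3 h4] := fr.
have tl m (c : 'I_k.+1 -> K) : theta v L (\sum_(i < k.+1) c i *: 'X_i) =
   (\sum_j (\sum_i L j i * c i) *: 'X_j)%:P + ((\sum_i v m i * c i)%:MP)%:P * 'X.
  rewrite rmorph_sum /=.
  under eq_bigr => i _ do rewrite -mul_mpolyC rmorphM /= thetaC thetaX mulrDr mulrA -!rmorphM /=.
  rewrite big_split /= -mulr_suml -!rmorph_sum /=; congr (_%:P + _%:P * _).
    under eq_bigr => i _ do rewrite mul_mpolyC scaler_sumr.
    rewrite exchange_big; apply: eq_bigr => j _; rewrite scaler_suml.
    by apply: eq_bigr => i _; rewrite scalerA mulrC.
  by congr (_%:MP); apply: eq_bigr => i _; rewrite mulrC (ord1 m).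
move=> p; have: theta v L \o unsplit_var tau M =1 idfun; last exact.
apply: rmorph_poly_ext => [c|] /=; last first.
  rewrite unsplit_varX (tl 0) /= -[RHS]add0r; congr (_ + _).
    apply/eqP; rewrite polyC_eq0 big1 // => j _.
    by have /matrixP/(_ j 0) := h3; rewrite !mxE => ->; rewrite scale0r.
  have /matrixP/(_ 0 0) := h1; rewrite !mxE => ->.
  by rewrite mulr1n mpolyC1 polyC1 mul1r.
rewrite unsplit_varC.
have: theta v L \o pull M =1 polyC; last by move/(_ c).
apply: rmorph_mpoly_ext => [d|j] /=; first by rewrite pullC thetaC.
rewrite pullX (tl 0).
have /matrixP/(_ 0 j) := h2; rewrite !mxE => ->.
rewrite mpolyC0 polyC0 mul0r addr0 (bigD1 j) //= [X in _ + X]big1 ?addr0 => [|i ij].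
  by have /matrixP/(_ j j) := h4; rewrite !mxE eqxx => ->; rewrite scale1r.
by have /matrixP/(_ i j) := h4; rewrite !mxE (negbTE ij) => ->; rewrite scale0r.
Qed.

End Frame.

(** By the rank decomposition [v] is a non-zero multiple of the first row of [row_ebase v]. Putting
    [v] in place of that row keeps the matrix invertible, and the column blocks of the inverse are
    [tau] and [M]. *)
Lemma frame_exists k (v : 'rV[K]_k.+1) : v != 0 -> exists L tau M, frame v L tau M.
Proof.
move=> vn0; pose E : 'M[K]_(1 + k) := row_ebase v.
have rv : \rank v = 1%N by rewrite rank_rV vn0.
have [a an0 va] : exists2 a, a != 0 & v = a *: usubmx E.
  exists (col_ebase v 0 0).
    by rewrite -unitfE -det_mx11 -unitmxE col_ebase_unit.
  have := mulmx_ebase v; rewrite rv [col_ebase v]mx11_scalar mul_scalar_mx -scalemxAl => {1}<-.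
  rewrite mxE eqxx mulr1n; congr (_ *: _).
  have -> : pid_mx 1 = row_mx 1%:M 0 :> 'M[K]_(1, 1 + k) by exact: pid_mx_row.
  have -> : row_ebase v = col_mx (usubmx E) (dsubmx E) by rewrite vsubmxK.
  have := mul_row_col (1%:M : 'M[K]_1) (0 : 'M_(1, k)) (usubmx E) (dsubmx E).
  by rewrite mul1mx mul0mx addr0; exact.
pose g : 'M[K]_(1 + k) := col_mx v (dsubmx E).
have gE : g = block_mx a%:M 0 0 1%:M *m E.
  rewrite -[E in RHS]vsubmxK mul_block_col mul_scalar_mx !mul0mx mul1mx addr0 add0r.
  by rewrite /g va.
have gu : g \in unitmx.
  rewrite gE unitmx_mul row_ebase_unit andbT unitmxE det_lblock det_scalar1 det1 mulr1.
  by rewrite unitfE.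
pose h := invmx g.
exists (dsubmx E), (lsubmx h), (rsubmx h).
have h1 := mulVmx gu; have h2 := mulmxV gu.
rewrite -/h -[h]hsubmxK /g mul_row_col in h1.
rewrite -/h -[h]hsubmxK /g mul_col_row in h2.
rewrite (scalar_mx_block 1 k) in h2.
by have [? ? ? ?] := eq_block_mx h2; split.
Qed.
End Substitutions.
Global Opaque pull theta unsplit_var.

Lemma map_frame (F K : fieldType) (iota : {rmorphism F -> K}) k
    (v : 'rV[F]_k.+1) L tau M : frame v L tau M ->
  frame (map_mx iota v) (map_mx iota L) (map_mx iota tau) (map_mx iota M).
Proof.
by case=> h1 h2 h3 h4 h5; split; rewrite -!map_mxM -?map_mxD ?h1 ?h2 ?h3 ?h4 ?h5 ?map_mx1 ?map_mx0.
Qed.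

(** * Top-degree forms, the standard frame, and non-roots in finite grids *)

Section TopForm.
Variable K : fieldType.

Lemma coef_top_mul (R : comNzRingType) (p q : {poly R}) a b :
  (size p <= a.+1)%N -> (size q <= b.+1)%N -> (p * q)`_(a + b) = p`_a * q`_b.
Proof.
move=> sp sq; rewrite coefM.
have la : (a < (a + b).+1)%N by lia.
rewrite (bigD1 (Ordinal la)) //= addKn big1 ?addr0 // => i /eqP/val_eqP /= ia.
case: (ltngtP i a) => [lt|gt|e]; last by rewrite e eqxx in ia.
  by rewrite [q`_ _]nth_default ?mulr0 //; apply: leq_trans sq _; lia.
by rewrite nth_default ?mul0r //; apply: leq_trans sp _.
Qed.

Lemma size_mul_le (R : nzRingType) (p q : {poly R}) a b :
  (size p <= a.+1)%N -> (size q <= b.+1)%N -> (size (p * q)%R <= (a + b).+1)%N.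
Proof.
move=> sp sq; apply: leq_trans (size_polyMleq _ _) _.
by have := leq_sub2r 1 (leq_add sp sq); rewrite !subn1 addnS.
Qed.

Lemma wdeg_le_theta k (v : 'rV[K]_k.+1) L f e :
  mdeg_le f 0 e -> wdeg_le (theta v L f) e.
Proof.
move=> hf; rewrite {1}(mpolyE f) raddf_sum /= big_seq; apply big_ind => [||m /hf hm].
- by rewrite -polyC0; apply: wdeg_leC; apply: mdeg_le0.
- by move=> *; apply: wdeg_leD.
rewrite -mul_mpolyC rmorphM /= thetaC -[e]add0n; apply: wdeg_leM.
  by apply: wdeg_leC; apply: mdeg_leC.
rewrite mpolyXE_id rmorph_prod /=.
apply: (@wdeg_leW _ _ _ (\sum_(i < k.+1) m i)); first by rewrite -mdegE; move: hm; lia.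
apply: wdeg_le_prod => i; rewrite rmorphXn /= -[X in wdeg_le _ X]mul1n; apply: wdeg_le_exp.
rewrite thetaX; apply: wdeg_leD.
  by apply: wdeg_leC; apply: mdeg_le_lin.
apply: (wdeg_leM (e := 0) (e' := 1)); last exact: wdeg_le_X.
by apply: wdeg_leC; apply: mdeg_leC.
Qed.

(** The t^e term of f(y + t v) sees only the part of degree e, evaluated at [v]. So [theta v L f]
    has a constant leading coefficient once the top form does not vanish at [v]. *)
Lemma theta_top k (v : 'rV[K]_k.+1) L f e : mdeg_le f 0 e ->
  (theta v L f)`_e = ((pihomog mdeg e f).@[coords v])%:MP.
Proof.
move=> hf; rewrite pihomogE {1}(mpolyE f) raddf_sum /= coef_sum.
rewrite (raddf_sum (meval (coords v))) (raddf_sum (@mpolyC k K)) /=.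
have tX m : (size (theta v L 'X_[m]) <= (mdeg m).+1)%N /\
    (theta v L 'X_[m])`_(mdeg m) = (('X_[m]).@[coords v])%:MP.
  rewrite mpolyXE_id mdegE !rmorph_prod /=.
  elim/big_rec3: _ => [|i x p y _ [s1 s2]]; first by rewrite size_poly1 coefC eqxx.
  have [t1 t2] : (size (theta v L ('X_i ^+ m i)) <= (m i).+1)%N /\
      (theta v L ('X_i ^+ m i))`_(m i) = ((v 0 i) ^+ m i)%:MP.
    elim: (m i) => [|j [u1 u2]]; first by rewrite !expr0 rmorph1 size_poly1 coefC eqxx.
    rewrite !exprS rmorphM /=.
    have s3 : (size (theta v L 'X_i) <= 2)%N.
      by apply: wdeg_le_size; apply: wdeg_le_theta; apply: mdeg_leX.
    split; first exact: (@size_mul_le _ _ _ 1 j).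
    rewrite [LHS](coef_top_mul s3 u1).
    rewrite rmorphM /=; congr (_ * _); last exact: u2.
    by rewrite thetaX coefD coefC add0r coefMX coefC.
  split; first exact: size_mul_le.
  by rewrite coef_top_mul // s2 t2 !rmorphXn /= mevalXU.
rewrite [RHS](big_mkcond) /= !big_seq; apply: eq_bigr => m /hf hm.
have [h1 h2] := tX m; rewrite -mul_mpolyC rmorphM /= thetaC coefCM.
case: eqP => [<-|ne]; first by rewrite h2 -mpolyCM -mevalZ mul_mpolyC.
by rewrite nth_default ?mulr0 //; apply: leq_trans h1 _; lia.
Qed.

Lemma pihomog_top_neq0 n (f : {mpoly K[n]}) : f != 0 -> pihomog mdeg (msize f).-1 f != 0.
Proof.
move=> fn0; have hd := mlead_deg fn0.
apply: contraTneq (mlead_supp fn0) => h.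
have : (pihomog mdeg (msize f).-1 f)@_(mlead f) = f@_(mlead f).
  rewrite pihomogE (raddf_sum (mcoeff (mlead f))) /= big_mkcond /=.
  rewrite (bigD1_seq (mlead f)) ?mlead_supp ?msupp_uniq //= -hd eqxx mcoeffZ mcoeffX eqxx mulr1.
  rewrite big1 ?addr0 // => m ne; case: ifP => // _.
  by rewrite mcoeffZ mcoeffX (negbTE ne) mulr0.
by rewrite h mcoeff0 mcoeff_msupp => <-; rewrite eqxx.
Qed.

(** The standard frame, which splits off coordinate 0. The explicit block sizes rely on [k.+1] being
    convertible to [1 + k]. *)
Definition v0 k : 'rV[K]_k.+1 := @row_mx _ 1 1 k 1%:M 0.
Definition L0 k : 'M[K]_(k, k.+1) := @row_mx _ k 1 k 0 1%:M.
Definition t0 k : 'cV[K]_k.+1 := @col_mx _ 1 k 1 1%:M 0.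
Definition M0 k : 'M[K]_(k.+1, k) := @col_mx _ 1 k k 0 1%:M.

Lemma frame0 k : frame (v0 k) (L0 k) (t0 k) (M0 k).
Proof.
split.
- have := @mul_col_row K 1 k 1 1 k 1%:M 0 1%:M 0.
  have := @mul_col_row K 1 k k 1 k 0 1%:M 0 1%:M.
  rewrite /v0 /L0 /t0 /M0 !mulmx0 !mul0mx !mulmx1 => -> ->.
  by rewrite (@add_block_mx _ 1 k 1 k) !addr0 !add0r -scalar_mx_block.
- by rewrite [LHS](@mul_row_col _ 1 1 k 1) mulmx1 mulmx0 addr0.
- by rewrite [LHS](@mul_row_col _ 1 1 k k) mulmx0 mul0mx addr0.
- by rewrite [LHS](@mul_row_col _ k 1 k 1) mulmx0 mul0mx addr0.
- by rewrite [LHS](@mul_row_col _ k 1 k k) mulmx0 mulmx1 add0r.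
Qed.

Lemma frame0E k t y : t *: v0 k + y *m L0 k = @row_mx _ 1 1 k t%:M y.
Proof.
rewrite /v0 /L0 -[_ *: _](@mul_scalar_mx _ 1 k.+1).
rewrite (@mul_mx_row _ 1 1 1 k) (@mul_mx_row _ 1 k 1 k) [LHS](@add_row_mx _ 1 1 k).
by rewrite !mulmx1 !mulmx0 addr0 add0r.
Qed.

Definition row_cons k (t : K) (y : 'rV[K]_k) : 'rV[K]_k.+1 := @row_mx _ 1 1 k t%:M y.

Lemma row_cons0 k t y : @row_cons k t y 0 0 = t.
Proof.
rewrite /row_cons; transitivity (@row_mx K 1 1 k t%:M y 0 (lshift k 0)).
  by congr (row_mx _ _ _ _); apply: val_inj.
by rewrite row_mxEl mxE eqxx.
Qed.

Lemma row_consS k t y j : @row_cons k t y 0 (lift ord0 j) = y 0 j.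
Proof.
rewrite -(@row_mxEr K 1 1 k t%:M y 0 j) /row_cons.
by congr (row_mx _ _ _ _); apply: val_inj.
Qed.

Lemma frame0_ev2 k f t (y : 'rV_k) :
  ev2 (theta (v0 k) (L0 k) f) y t = f.@[coords (row_cons t y)].
Proof. by rewrite theta_ev frame0E. Qed.

Lemma theta_eq0 k (v : 'rV[K]_k.+1) L tau M f : frame v L tau M ->
  (theta v L f == 0) = (f == 0).
Proof.
move=> fr; apply/eqP/eqP => [e|->]; last exact: rmorph0.
by rewrite -(thetaK fr f) e; exact: rmorph0.
Qed.

(** The injection [h] lets one statement serve both rational points and finite subsets of an
    infinite field. The leading coefficient in coordinate 0 has no larger degree; where it is
    non-zero, the remaining polynomial in one variable has fewer than [#|I|] roots. *)
Lemma mpoly_nonroot_finite (I : finType) (h : I -> K) k (f : {mpoly K[k]}) :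
  injective h -> f != 0 -> (msize f <= #|I|)%N ->
  exists x : 'I_k -> I, f.@[coords (\row_i h (x i))] != 0.
Proof.
move=> hi; elim: k f => [|k IH] f fn0 hf.
  have /card_gt0P[i0 _] : (0 < #|I|)%N.
    by apply: leq_trans hf; rewrite lt0n msize_poly_eq0.
  exists (fun=> i0).
  by rewrite [f]nvar0_mpolyC mevalC -(mpolyC_eq0 0) -nvar0_mpolyC.
set p := theta (v0 k) (L0 k) f.
have pn0 : p != 0 by rewrite (theta_eq0 _ (frame0 k)).
have wp := wdeg_le_theta (v := v0 k) (L := L0 k) (@mdeg_le_msize _ _ f).
have sp := wdeg_le_size wp; rewrite -mpolySpred // in sp; have sp' := leq_trans sp hf.
have ln0 : lead_coef p != 0 by rewrite lead_coef_eq0.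
have /(IH _ ln0)[x' hx'] : (msize (lead_coef p) <= #|I|)%N.
  apply: leq_trans hf; rewrite [X in (_ <= X)%N]mpolySpred //; apply: msize_mdeg_le.
  by apply: (mdeg_leW (wp _)); rewrite addn0 leq_addr.
set y := (\row_i _) in hx'; set q := map_poly (meval (coords y)) p.
have qn0 : q != 0.
  by rewrite -lead_coef_eq0 /q lead_coef_map_eq.
have [i0 hi0] : exists i, q.[h i] != 0.
  apply/existsP/contraT; rewrite negb_exists => /forallP hr.
  have sq : (size q <= #|I|)%N := leq_trans (size_poly _ _) sp'.
  suff : (#|I| < size q)%N by rewrite ltnNge sq.
  rewrite cardE -(size_map h); apply: max_poly_roots => //.
    by apply/allP => _ /mapP[i _ ->]; rewrite rootE; have := hr i; rewrite negbK.
  by rewrite map_inj_uniq ?enum_uniq.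
exists (fun i => if unlift ord0 i is Some j then x' j else i0).
suff -> : (\row_i h (if unlift ord0 i is Some j then x' j else i0)) = row_cons (h i0) y.
  by rewrite -frame0_ev2.
apply/rowP => i; rewrite mxE; case: unliftP => [j ->|->]; first by rewrite row_consS mxE.
by rewrite row_cons0.
Qed.
End TopForm.

(** * Orders of vanishing *)

Section Nonroots.
Variable K : closedFieldType.

Lemma closed_field_infinite N : exists s : seq K, uniq s /\ size s = N.
Proof.
elim: N => [|N [s [us ss]]]; first by exists [::].
have /closed_nonrootP[x] : \prod_(a <- s) ('X - a%:P) != 0.
  by rewrite monic_neq0 // monic_prod_XsubC.
by rewrite root_prod_XsubC => xs; exists (x :: s); rewrite /= xs us ss.
Qed.

Lemma mpoly_nonroot k (f : {mpoly K[k]}) : f != 0 -> exists x, f.@[coords x] != 0.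
Proof.
have [s [us ss]] := closed_field_infinite (msize f) => fn0.
have /(@mpoly_nonroot_finite K 'I_(msize f) (fun i => s`_i))/(_ fn0)[] :
    injective (fun i : 'I_(msize f) => s`_i).
  by move=> i j /eqP; rewrite nth_uniq ?ss // => /eqP/val_inj.
  by rewrite card_ord.
by move=> x; exists (\row_i s`_(x i)).
Qed.

End Nonroots.

Section Multiplicity.
Variable K : closedFieldType.

Definition line k (c z : 'rV[K]_k) (g : {mpoly K[k]}) : {poly K} :=
  mmap (@polyC K) (fun i => (c 0 i)%:P + (z 0 i)%:P * 'X) g.
HB.instance Definition _ k (c z : 'rV[K]_k) :=
  GRing.RMorphism.copy (line c z)
    (mmap (@polyC K) (fun i => (c 0 i)%:P + (z 0 i)%:P * 'X)).

Lemma lineC k (c z : 'rV[K]_k) a : line c z a%:MP = a%:P.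
Proof. exact: mmapC. Qed.

Lemma lineX k (c z : 'rV[K]_k) i : line c z 'X_i = (c 0 i)%:P + (z 0 i)%:P * 'X.
Proof. by rewrite /line mmapX mmap1U. Qed.

Lemma line_ev k (c z : 'rV[K]_k) g t : (line c z g).[t] = g.@[coords (c + t *: z)].
Proof.
have: horner_eval t \o line c z =1 meval (coords (c + t *: z)); last exact.
apply: rmorph_mpoly_ext => [a|i] /=; rewrite /horner_eval.
  by rewrite lineC hornerC mevalC.
by rewrite lineX !hornerE mevalXU /coords !mxE mulrC.
Qed.

(** Multiplicity tested on all lines through [c]: over the infinite field [K] this is the usual
    order of vanishing, without derivatives, which lose information in characteristic p. *)
Definition order_ge k (g : {mpoly K[k]}) (c : 'rV[K]_k) mu := forall z, 'X^mu %| line c z g.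

(** Separates the direction of a line into its part [w] along the split variable and its part [z]
    below; the multiplicity argument fixes [z] and lets [w] vary. *)
Lemma line_theta k (v : 'rV[K]_k.+1) L g a w (c z : 'rV[K]_k) :
  line (a *: v + c *m L) (w *: v + z *m L) g =
  (map_poly (line c z) (theta v L g)).[a%:P + w%:P * 'X].
Proof.
have: line (a *: v + c *m L) (w *: v + z *m L) =1
  horner_eval (a%:P + w%:P * 'X) \o (map_poly (line c z) \o theta v L); last exact.
apply: rmorph_mpoly_ext => [b|i] /=; rewrite /horner_eval.
  by rewrite thetaC map_polyC /= !lineC hornerC.
rewrite thetaX rmorphD rmorphM /= map_polyX !map_polyC /= !hornerE lineC raddf_sum /= lineX.
rewrite !mxE !rmorphD !rmorphM !rmorph_sum /= mulrDr mulrDl addrACA -!addrA.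
have -> : \sum_(j < k) line c z (L j i *: 'X_j) =
   (\sum_(j < k) (c 0 j * L j i)%:P) + (\sum_(j < k) (z 0 j * L j i)%:P) * 'X.
  rewrite mulr_suml -big_split /=; apply: eq_bigr => j _.
  rewrite -mul_mpolyC rmorphM /= lineC lineX !rmorphM /=; ring.
rewrite ![(v 0 i)%:P * _]mulrC; ring.
Qed.

(** The line through [c] and a non-root of [g] has finite contact with [g], so the orders at [c] are
    bounded and a largest one exists. *)
Lemma order_ge_bound k (g : {mpoly K[k]}) c : g != 0 ->
  exists m, order_ge g c m /\ exists z, ~~ ('X^(m.+1) %| line c z g).
Proof.
move=> /mpoly_nonroot[x gx].
pose z := x - c.
have lz : line c z g != 0.
  apply: contraNneq gx => l0; have := line_ev c z g 1; rewrite l0 horner0 scale1r.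
  by rewrite /z addrC subrK => <-.
case: (excluded_middle_informative (exists m, order_ge g c m /\ ~ order_ge g c m.+1)) => [|h].
  case=> m [h1 h2]; exists m; split => //.
  apply: Classical_Prop.NNPP => h3; apply: h2 => w; apply/negPn/negP => h4; apply: h3.
  by exists w.
have /(_ (size (line c z g))) : forall m, order_ge g c m.
  elim=> [w|m IH]; first by rewrite expr0 dvd1p.
  by apply: Classical_Prop.NNPP => h3; apply: h; exists m.
by move/(_ z)/dvdp_leq => /(_ lz); rewrite size_polyXn ltnn.
Qed.

Lemma sum_root_mult (I : finType) (a : I -> K) (e : I -> nat) (h : {poly K}) :
  injective a -> h != 0 -> (forall i, ('X - (a i)%:P) ^+ e i %| h) ->
  (\sum_i e i <= (size h).-1)%N.
Proof.
move=> ai; rewrite -big_enum /= => + H.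
have {H} : forall i, i \in enum I -> ('X - (a i)%:P) ^+ e i %| h by [].
elim: (enum I) (enum_uniq I) h => [|i s IH] /=; first by rewrite big_nil.
move=> /andP[si us] h H hn0; rewrite big_cons.
have /dvdpP[h' hh] := H i (mem_head _ _).
have h'n0 : h' != 0 by apply: contraNneq hn0 => h0; rewrite hh h0 mul0r.
have xn0 : ('X - (a i)%:P) ^+ e i != 0 by rewrite expf_neq0 // polyXsubC_eq0.
have /IH/(_ h'n0) : forall j, j \in s -> ('X - (a j)%:P) ^+ e j %| h'.
  move=> j js; have := H j; rewrite inE js orbT => /(_ isT).
  rewrite hh Gauss_dvdpl // coprimep_expl // coprimep_expr // coprimep_XsubC root_XsubC.
  by apply: contraNneq si => /ai ->.
move=> /(_ us); rewrite hh size_mul // size_exp_XsubC.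
have sh' : (0 < size h')%N by rewrite size_poly_gt0.
have natl u b c : (0 < c -> b <= c.-1 -> u + b <= (c + u.+1).-1.-1)%N by lia.
exact: natl sh'.
Qed.

Lemma dvdp_Xn (p : {poly K}) n : (forall i, (i < n)%N -> p`_i = 0) -> 'X^n %| p.
Proof.
move=> h; rewrite -(poly_take_drop n p) (_ : take_poly n p = 0) ?add0r ?dvdp_mull //.
by apply/polyP => i; rewrite coef_take_poly coef0; case: ifP => // /h.
Qed.

Lemma coef_dvd_Xn (p : {poly K}) n i : 'X^n %| p -> (i < n)%N -> p`_i = 0.
Proof. by move=> /dvdpP[q ->] ni; rewrite coefMXn ni. Qed.

Lemma swapXY_comp_shift (p : {poly {poly K}}) (a : K) :
  swapXY (p \Po ('X + (a%:P)%:P)) = map_poly (comp_poly ('X + a%:P)) (swapXY p).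
Proof.
have: swapXY \o comp_poly ('X + (a%:P)%:P) =1
  map_poly (comp_poly ('X + a%:P)) \o swapXY; last exact.
apply: rmorph_poly_ext => [c|] /=.
  rewrite comp_polyC !swapXY_polyC; apply/polyP => i.
  by rewrite !coef_map /= comp_polyC.
rewrite comp_polyX rmorphD /= swapXY_X swapXY_polyC !map_polyC /=.
by rewrite comp_polyX rmorphD.
Qed.

(** View [p] as a polynomial in X (inner) and Y (outer). Order [mu] at (0, a) along all lines Y = a
    + w X excludes every monomial of total degree below [mu] in X and Y - a, so the coefficient of
    X^i vanishes to order [mu - i] at a. *)
Lemma order_slice (p : {poly {poly K}}) (a : K) mu i :
  (forall w, 'X^mu %| p.[a%:P + w%:P * 'X]) ->
  ('X - a%:P) ^+ (mu - i) %| (swapXY p)`_i.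
Proof.
move=> H; set p' := p \Po ('X + (a%:P)%:P).
have pc j : (i + j < mu)%N -> (p'`_j)`_i = 0.
  move=> ijm; pose N := (i + j)%N.
  (* [r] is the part of [p'] of total degree [N], read as a polynomial in the slope w. It vanishes
     at every w, hence is zero. The guard removes the terms where [N - l] would be truncated. *)
  pose r := \poly_(l < size p') (if (N < l)%N then 0 else (p'`_l)`_(N - l)).
  have : r = 0.
    apply/eqP/negPn/negP => /closed_nonrootP[w] /negP; apply; apply/eqP.
    have <- : (p'.[w%:P * 'X])`_N = r.[w].
      rewrite horner_coef coef_sum horner_poly; apply: eq_bigr => l _.
      rewrite exprMn -rmorphXn /= mulrCA coefCM coefMXn mulrC.
      by case: ifP; rewrite // mul0r.
    rewrite /p' horner_comp !hornerE addrC.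
    exact: coef_dvd_Xn (H w) ijm.
  move=> /(congr1 (fun q : {poly K} => q`_j));
    rewrite coef_poly coef0 [(N < j)%N]ltnNge leq_addl /= addnK.
  by case: ltnP => // /(nth_default 0) -> _; rewrite coef0.
have: 'X^(mu - i) %| (swapXY p)`_i \Po ('X + a%:P).
  apply: dvdp_Xn => j jm; rewrite -[_ \Po _](coef_map (comp_poly ('X + a%:P))) /=.
  by rewrite -swapXY_comp_shift coef_swapXY pc //; lia.
move=> /dvdpP[q hq].
have -> : (swapXY p)`_i = ((swapXY p)`_i \Po ('X + a%:P)) \Po ('X - a%:P).
  by rewrite -comp_polyA comp_polyD comp_polyX comp_polyC subrK comp_polyXr.
by rewrite hq comp_polyM rmorphXn /= comp_polyX dvdp_mull.
Qed.

(** Induction on [k], splitting off coordinate 0. If the leading coefficient, of degree at most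
    [D - J], has order [m c] at a rational [c], then the orders on the fibre over [c] sum to at most
    q [m c] + [J]; the induction hypothesis bounds the sum of the [m c]. *)
Lemma multiplicity_schwartz_zippel (F : finFieldType) (iota : {rmorphism F -> K}) k
    (g : {mpoly K[k]}) D (mu : 'rV[F]_k -> nat) :
  g != 0 -> mdeg_le g 0 D -> (forall c, order_ge g (map_mx iota c) (mu c)) ->
  (#|F| * \sum_c mu c <= D * #|F| ^ k)%N.
Proof.
elim: k g D mu => [|k IH] g D mu gn0 gD hmu.
  rewrite big1 ?muln0 // => c _.
  have := hmu c 0; have gE := nvar0_mpolyC g; rewrite gE lineC.
  have : (g@_0%MM)%:P != 0 by rewrite polyC_eq0 -(mpolyC_eq0 0) -gE.
  by move=> h /(dvdp_leq h); rewrite size_polyXn => /leq_trans/(_ (size_polyC_leq1 _)); lia.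
set p := theta (v0 K k) (L0 K k) g; set J := (size p).-1.
have pn0 : p != 0 by rewrite (theta_eq0 _ (frame0 K k)).
have ln0 : lead_coef p != 0 by rewrite lead_coef_eq0.
have lD : mdeg_le (lead_coef p) J D by apply: wdeg_le_theta.
have JD : (J <= D)%N.
  by have /= := wdeg_le_size (wdeg_le_theta (v := v0 K k) (L := L0 K k) gD);
    rewrite -/p /J -subn1 leq_subLR add1n.
have lD' : mdeg_le (lead_coef p) 0 (D - J) by apply: (mdeg_leW lD); lia.
have [m hm] := fin_all_exists (fun c => order_ge_bound (map_mx iota c) ln0).
have {IH} := IH _ _ _ ln0 lD' (fun c => (hm c).1) => IH.
have key c : (\sum_(a : F) mu (row_cons a c) <= #|F| * m c + J)%N.
  have [h1 [z hz]] := hm c.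
  pose G := map_poly (line (map_mx iota c) z) p.
  (* In the direction [z], chosen to realise the order of the leading coefficient, some X^i with
     [i <= m c] survives. The coefficient [h] of X^i in [G] is then a non-zero polynomial in the
     split variable, of degree [J], vanishing to order [mu - i] at each rational point of the
     fibre. *)
  have [i im ri] : exists2 i, (i <= m c)%N & (line (map_mx iota c) z (lead_coef p))`_i != 0.
    apply: Classical_Prop.NNPP => h; move/negP: hz; apply; apply: dvdp_Xn => i im.
    by apply/eqP/negPn/negP => ri; apply: h; exists i.
  pose h := (swapXY G)`_i.
  have sh : (size h <= J.+1)%N.
    apply/leq_sizeP => j Jj; rewrite coef_swapXY coef_map /= [p`_j]nth_default ?rmorph0 ?coef0 //.
    by apply: leq_trans Jj; rewrite /J prednK // size_poly_gt0.
  have hn0 : h != 0.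
    by apply: contraNneq ri => h0; rewrite lead_coefE -/J -(coef_map (line _ _)) /= -/G
      -coef_swapXY -/h h0 coef0.
  have H : (\sum_a (mu (row_cons a c) - i) <= (size h).-1)%N.
    apply: (@sum_root_mult F iota) => // [|a]; first exact: fmorph_inj.
    apply: order_slice => w; rewrite -line_theta.
    have <- : map_mx iota (row_cons a c) = iota a *: v0 K k + map_mx iota c *m L0 K k.
      by rewrite frame0E /row_cons (@map_row_mx _ _ iota 1 1 k) map_scalar_mx.
    exact: hmu.
  have HJ : (\sum_a (mu (row_cons a c) - i) <= J)%N.
    by apply: leq_trans H _; rewrite -subn1 leq_subLR add1n.
  apply: leq_trans (_ : \sum_(a : F) ((mu (row_cons a c) - i) + m c) <= _)%N.
    by apply: leq_sum => a _; lia.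
  by rewrite big_split /= sum_nat_const addnC leq_add2l.
have -> : (\sum_c mu c = \sum_c \sum_a mu (row_cons a c))%N.
  rewrite pair_bigA /= (reindex (fun u : 'rV[F]_k * F => row_cons u.2 u.1)) //.
  exists (fun x => (x *m M0 F k, (x *m t0 F k) 0 0)) => [[c a] _|x _] /=.
    by rewrite /row_cons -frame0E (frameM (frame0 F k)) (frametau (frame0 F k)).
  by rewrite /row_cons -frame0E -(frame_dec (frame0 F k)).
have : (#|F| * \sum_c \sum_a mu (row_cons a c) <= #|F| * \sum_(c : 'rV[F]_k) (#|F| * m c + J))%N.
  by rewrite leq_mul2l; apply/orP; right; apply: leq_sum.
move/leq_trans; apply.
rewrite big_split /= -big_distrr /= sum_nat_const card_mx mul1n expnS.
have natl u x y z w : (y <= z -> u * x <= (z - y) * w -> u * (u * x + w * y) <= z * (u * w))%N.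
  move=> yz; have [t ->] : exists t, z = (y + t)%N by exists (z - y)%N; lia.
  rewrite addKn => h; rewrite mulnDr; have := leq_mul (leqnn u) h.
  have -> : ((y + t) * (u * w) = u * (t * w) + u * (w * y))%N by ring.
  by rewrite leq_add2r.
exact: natl JD IH.
Qed.
End Multiplicity.

(** * Unique factorisation *)

Lemma asbP (P : Prop) : reflect P (asb P).
Proof. by rewrite /asb; case: excluded_middle_informative => h; constructor. Qed.

Lemma choose_fun (A B : Type) (R : A -> B -> Prop) :
  (forall x, exists y, R x y) -> exists f, forall x, R x (f x).
Proof.
move=> h; exists (fun x => proj1_sig (constructive_indefinite_description _ (h x))) => x.
by case: constructive_indefinite_description.
Qed.

Section Divides.
Variable R : idomainType.
Implicit Types a b p : R.

Definition divides a b := exists c, b = c * a.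
Definition prime_elt p :=
  [/\ p != 0, ~ divides p 1 & forall a b, divides p (a * b) -> divides p a \/ divides p b].
(** [divides u 1] says that [u] is a unit. Asking for prime rather than irreducible factors makes
    uniqueness automatic. *)
Definition ufd := forall a, a != 0 -> exists u s,
  [/\ divides u 1, forall p, p \in s -> prime_elt p & a = u * \prod_(p <- s) p].

Lemma divides_mull a b c : divides a b -> divides a (c * b).
Proof. by case=> d ->; exists (c * d); rewrite mulrA. Qed.

Lemma divides_mulr a b c : divides a b -> divides a (b * c).
Proof. by rewrite mulrC; apply: divides_mull. Qed.

Lemma divides_refl a : divides a a.
Proof. by exists 1; rewrite mul1r. Qed.

Lemma divides_trans a b c : divides a b -> divides b c -> divides a c.
Proof. by case=> d -> [e ->]; exists (e * d); rewrite mulrA. Qed.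

Lemma divides_add a b c : divides a b -> divides a c -> divides a (b + c).
Proof. by case=> d -> [e ->]; exists (d + e); rewrite mulrDl. Qed.

Lemma divides_sum (I : Type) (r : seq I) (P : pred I) (F : I -> R) a :
  (forall i, P i -> divides a (F i)) -> divides a (\sum_(i <- r | P i) F i).
Proof.
move=> h; apply big_ind => //; last exact: divides_add.
by exists 0; rewrite mul0r.
Qed.

Lemma divides_addl a b c : divides a (b + c) -> divides a c -> divides a b.
Proof. by case=> d h [e he]; exists (d - e); rewrite mulrBl -h he; ring. Qed.

Lemma prime_divides_prod p (s : seq R) : prime_elt p ->
  divides p (\prod_(q <- s) q) -> exists2 q, q \in s & divides p q.
Proof.
case=> _ p1 pp; elim: s => [|q s IH]; first by rewrite big_nil => /p1.
rewrite big_cons => /pp[h|/IH[r rs h]]; first by exists q; rewrite ?mem_head.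
by exists r; rewrite // inE rs orbT.
Qed.

Lemma prime_assoc p q : prime_elt p -> prime_elt q -> divides p q -> divides q p.
Proof.
move=> [pn0 p1 pp] [qn0 q1 qq] [c e]; have [|[d hd]|//] := qq c p.
  by rewrite -e; apply: divides_refl.
case: p1; exists d; apply: (mulIf qn0); rewrite mul1r [LHS]e hd; ring.
Qed.

Lemma prime_in_ideal (I : R -> Prop) f : ufd -> f != 0 -> I f -> ~ I 1 ->
  (forall a b, I b -> I (a * b)) -> (forall a b, I (a * b) -> I a \/ I b) ->
  exists2 p, prime_elt p & I p.
Proof.
move=> ufdR fn0 If I1 Im Ip; have [u [s [[v uv] sp e]]] := ufdR f fn0.
have {If} : I (\prod_(p <- s) p).
  by move: If; rewrite e => /Ip[] // Iu; case: I1; rewrite uv; apply: Im.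
elim: s sp {e} => [|p s IH] sp; first by rewrite big_nil => /I1.
rewrite big_cons => /Ip[Ipp|]; first by exists p => //; apply: sp; rewrite mem_head.
by apply: IH => q qs; apply: sp; rewrite inE qs orbT.
Qed.

End Divides.

(** * Gauss's lemma: unique factorisation passes to polynomials *)

Section Gauss.
Variable R : idomainType.
Implicit Types f g h : {poly R}.

Lemma divides_polyC (a : R) f : divides a%:P f <-> forall i, divides a f`_i.
Proof.
split=> [[c ->] i|h]; first by rewrite mulrC coefCM; apply: divides_mulr; apply: divides_refl.
have [c hc] := fin_all_exists (fun i : 'I_(size f) => h i).
exists (\poly_(i < size f) (if insub i is Some j then c j else 0)).
apply/polyP => i; rewrite mulrC coefCM coef_poly; case: ltnP => [lt|ge].
  by rewrite insubT mulrC -hc.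
by rewrite nth_default ?mulr0.
Qed.

(** If [p] divides neither factor, take in each the first coefficient that it does not divide; the
    coefficient of the product at the sum of the two indices is then not divisible by [p]. *)
Lemma prime_polyC (p : R) : prime_elt p -> prime_elt p%:P.
Proof.
move=> [pn0 p1 pp]; split; first by rewrite polyC_eq0.
  by move=> /divides_polyC/(_ 0%N); rewrite coef1 => /p1.
have first f : ~ divides p%:P f ->
    exists2 i, ~ divides p f`_i & forall j, (j < i)%N -> divides p f`_j.
  move=> nd; have [i hi] : exists i, ~~ asb (divides p f`_i).
    apply: Classical_Prop.NNPP => h; apply: nd; apply/divides_polyC => i.
    by apply: Classical_Prop.NNPP => hi; apply: h; exists i; apply/asbP.
  have := ex_minnP (ex_intro (fun i => ~~ asb (divides p f`_i)) i hi) => -[m /asbP hm mm].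
  exists m => // j jm; apply/asbP/negPn/negP => /mm; lia.
move=> f g fg; apply: Classical_Prop.NNPP =>
  /Classical_Prop.not_or_and[/first[i fi mi] /first[j gj mj]].
have /pp[] // : divides p (f`_i * g`_j).
have /divides_polyC/(_ (i + j)%N) := fg; rewrite coefM.
have li : (i < (i + j).+1)%N by lia.
rewrite (bigD1 (Ordinal li)) //= addKn => /divides_addl; apply.
apply: divides_sum => l /eqP/val_eqP /= ne; case: (ltngtP l i) => [lt|gt|e].
- by apply: divides_mulr; apply: mi.
- by apply: divides_mull; apply: mj; move: gt; have := ltn_ord l; lia.
- by rewrite e eqxx in ne.
Qed.

Hypothesis ufdR : ufd R.

Definition primitive f := forall p, prime_elt p -> ~ divides p%:P f.

(** Each prime constant taken out of [f] removes an associate prime factor from the leading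
    coefficient, so the number of these factors bounds the process. *)
Lemma primitive_part f : f != 0 -> exists (t : seq R) g,
  [/\ forall p, p \in t -> prime_elt p, primitive g & f = (\prod_(p <- t) p)%:P * g].
Proof.
move=> fn0; have [u [s [u1 sp le]]] := @ufdR (lead_coef f) ltac:(by rewrite lead_coef_eq0).
have [n sn] := ubnP (size s).
elim: n s f sn fn0 u u1 sp le => // n IH s f sn fn0 u u1 sp le.
case: (excluded_middle_informative (primitive f)) => [pf|npf].
  by exists [::], f; rewrite big_nil mul1r.
have [p pp [g fg]] : exists2 p, prime_elt p & divides p%:P f.
  by apply: Classical_Prop.NNPP => h; apply: npf => p pp dp; apply: h; exists p.
have gn0 : g != 0 by apply: contraNneq fn0 => g0; rewrite fg g0 mul0r.
have [pn0 p1 ppr] := pp.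
have lfg : lead_coef f = lead_coef g * p by rewrite fg lead_coefM lead_coefC.
have : divides p (u * \prod_(q <- s) q) by exists (lead_coef g); rewrite -le.
case/ppr => [pu|]; first by case: p1; apply: divides_trans u1.
move=> /(prime_divides_prod pp)[q qs pq].
have [c qc] := pq; have [d pd] := prime_assoc pp (sp _ qs) pq.
have qn0 : q != 0 by have [] := sp _ qs.
have dc : d * c = 1 by apply: (mulIf qn0); rewrite mul1r [RHS]qc pd; ring.
have [||||t [h [tp ph gh]]] := IH (rem q s) g _ gn0 (u * c).
- by rewrite size_rem //; move: sn qs; case: (s).
- by case: u1 => v uv; exists (v * d); rewrite uv -[v * u]mulr1 -dc; ring.
- by move=> r /mem_rem/sp.
- apply: (mulIf pn0); rewrite -lfg le (big_rem _ qs) /= {1}qc; ring.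
exists (p :: t), h; split => //; last by rewrite big_cons fg gh rmorphM /=; ring.
by move=> r; rewrite inE => /orP[/eqP->|/tp].
Qed.

(** Each prime factor of [c] divides [f * h] but not the primitive [f], so it can be cancelled
    against [h]. *)
Lemma primitive_cancel (c : R) f g h : c != 0 -> primitive f ->
  c%:P * g = f * h -> divides f g.
Proof.
move=> cn0 pf; have [u [s [[v uv] sp ->]]] := ufdR cn0.
elim: s sp h => [|p s IH] sp h e.
  exists (v%:P * h); rewrite mulrC mulrCA -e big_nil mulr1 mulrA -rmorphM /= -uv mul1r.
  by [].
have pp := prime_polyC (sp p (mem_head _ _)); have [pn0 _ ppr] := pp.
have : divides p%:P (f * h).
  by rewrite -e big_cons mulrCA rmorphM /= -mulrA; apply: divides_mulr; apply: divides_refl.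
case/ppr => [/pf[]|[h' hh]]; first by apply: sp; rewrite mem_head.
apply: (IH _ h'); first by move=> q qs; apply: sp; rewrite inE qs orbT.
by apply: (mulIf pn0); rewrite -[f * h' * _]mulrA -hh -e big_cons !rmorphM /=; ring.
Qed.

Lemma pseudo_divide (u g : {poly R}) : u != 0 -> exists (c : R) w,
  c != 0 /\ (size (c%:P * g - w * u)%R < size u)%N.
Proof.
move=> un0; exists (lead_coef u ^+ scalp g u), (g %/ u); split.
  by apply: expf_neq0; rewrite lead_coef_eq0.
by rewrite mul_polyC Pdiv.WeakIdomain.divp_eq addrC addKr ltn_modp.
Qed.

(** A non-zero [u] of least size in the ideal of [f] and [a] divides both up to constants, by
    pseudo-division, so its primitive part divides [f]. If the cofactor is constant, [f] divides
    [a]; if the primitive part is constant, a constant multiple of [b] is a multiple of [f]. *)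
Lemma irreducible_prime f : primitive f -> (1 < size f)%N ->
  (forall g h, f = g * h -> size g = 1%N \/ size h = 1%N) -> prime_elt f.
Proof.
move=> pf sf irr; have fn0 : f != 0 by rewrite -size_poly_gt0; lia.
split=> // [[c c1]|a b [e ab]].
  have : c * f != 0 by rewrite -c1 oner_neq0.
  rewrite mulf_eq0 negb_or => /andP[cn0 _].
  by have := size_mul cn0 fn0; rewrite -c1 size_poly1; move: cn0 sf; rewrite -size_poly_gt0; lia.
have [->|an0] := eqVneq a 0; first by left; exists 0; rewrite mul0r.
pose J n := exists x y, x * f + y * a != 0 /\ size (x * f + y * a) = n.
have [n hn] : exists n, asb (J n).
  by exists (size f); apply/asbP; exists 1, 0; rewrite mul1r mul0r addr0.
have := ex_minnP (ex_intro (fun n => asb (J n)) n hn) => -[m /asbP [x [y [un0 su]]] mm].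
set u := x * f + y * a in un0 su.
have red g x' y' : g = x' * f + y' * a -> exists c w, c != 0 /\ c%:P * g = w * u.
  move=> ge; have [c [w [cn0 lt]]] := pseudo_divide g un0; exists c, w; split => //.
  apply/eqP; rewrite -subr_eq0; apply/negPn/negP => rn0.
  have : (m <= size (c%:P * g - w * u)%R)%N.
    apply: mm; apply/asbP; exists (c%:P * x' - w * x), (c%:P * y' - w * y).
    have <- : c%:P * g - w * u =
      (c%:P * x' - w * x) * f + (c%:P * y' - w * y) * a by rewrite ge /u; ring.
    by [].
  by rewrite leqNgt -su lt.
have [c1 [w1 [c1n0 e1]]] := red f 1 0 ltac:(by rewrite mul1r mul0r addr0).
have [c2 [w2 [c2n0 e2]]] := red a 0 1 ltac:(by rewrite mul1r mul0r add0r).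
have [t [u' [tp pu' uu]]] := primitive_part un0.
set d := \prod_(p <- t) p in uu.
have [w' fw] : divides u' f.
  by apply: (primitive_cancel (h := w1 * d%:P) c1n0 pu'); rewrite e1 uu; ring.
have [sw|su'] := irr _ _ fw.
  have [r rn0 wr] : exists2 r, r != 0 & w' = r%:P.
    move/eqP: sw => /size_poly1P[r rn0 ->]; by exists r.
  left; apply: (primitive_cancel (c := r * c2) (h := w2 * d%:P)) => //; first by rewrite mulf_neq0.
  by rewrite rmorphM /= -mulrA e2 uu fw wr; ring.
have [r rn0 ur] : exists2 r, r != 0 & u' = r%:P.
  move/eqP: su' => /size_poly1P[r rn0 ->]; by exists r.
right; apply: (primitive_cancel (c := d * r) (h := x * b + y * e)) => //.
  rewrite -(polyC_eq0) rmorphM /= -ur -uu //.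
rewrite rmorphM /= -ur -uu /u; transitivity (x * f * b + y * (a * b)); first by ring.
rewrite ab; ring.
Qed.

(** Once the constant primes are split off, a primitive polynomial is factored by induction on its
    size: a primitive constant is a unit, and one without proper factors of positive degree is
    prime. *)
Lemma ufd_poly : ufd {poly R}.
Proof.
move=> f fn0; have [t [g [tp pg fg]]] := primitive_part fn0.
have gn0 : g != 0 by apply: contraNneq fn0 => g0; rewrite fg g0 mulr0.
suff [u [s [u1 sp e]]] : exists u (s : seq {poly R}),
    [/\ divides u 1, forall p, p \in s -> prime_elt p & g = u * \prod_(p <- s) p].
  exists u, (map polyC t ++ s); split => //.
    by move=> p; rewrite mem_cat => /orP[/mapP[q /tp qp ->]|/sp //]; apply: prime_polyC.
  by rewrite big_cat big_map /= fg rmorph_prod e /=; ring.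
have [n sn] := ubnP (size g).
elim: n g sn gn0 pg {fg} => // n IH g sn gn0 pg.
have [sg|sg] := leqP (size g) 1.
  have [r rn0 gr] : exists2 r, r != 0 & g = r%:P.
    by move: sg; rewrite leq_eqVlt ltnS leqn0 size_poly_eq0 (negbTE gn0) orbF =>
      /size_poly1P[r rn0 ->]; exists r.
  have [u [s [[v uv] sp rs]]] := ufdR rn0; exists u%:P, [::]; rewrite big_nil mulr1; split => //.
    by exists v%:P; rewrite -rmorphM -uv.
  case: s sp rs => [|p s] sp rs; first by rewrite gr rs big_nil mulr1.
  case: (pg p (sp _ (mem_head _ _))); rewrite gr rs big_cons mulrCA rmorphM.
  by apply: divides_mulr; apply: divides_refl.
case: (excluded_middle_informative
    (forall h k, g = h * k -> size h = 1%N \/ size k = 1%N)) => [irr|red].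
  exists 1, [:: g]; rewrite big_seq1 mul1r; split => //; first exact: divides_refl.
  by move=> p; rewrite inE => /eqP ->; apply: irreducible_prime.
have [h [k [e [h1 k1]]]] : exists h k, g = h * k /\ size h <> 1%N /\ size k <> 1%N.
  apply: Classical_Prop.NNPP => H; apply: red => h k e; apply: Classical_Prop.NNPP => H'.
  by apply: H; exists h, k; split => //; apply: Classical_Prop.not_or_and.
have := gn0; rewrite e mulf_eq0 negb_or => /andP[hn0 kn0].
have sm := size_mul hn0 kn0; rewrite -e in sm.
have hh : (1 < size h)%N by move: hn0 h1; rewrite -size_poly_gt0; lia.
have kk : (1 < size k)%N by move: kn0 k1; rewrite -size_poly_gt0; lia.
have natl x y z N : (1 < x -> 1 < y -> z = (x + y).-1 -> z < N.+1 -> x < N /\ y < N)%N by lia.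
have [sh sk] := natl _ _ _ _ hh kk sm sn.
have [|u1 [s1 [[v1 uv1] sp1 e1]]] := IH h sh hn0.
  by move=> p pp dp; apply: (pg p pp); rewrite e; apply: divides_mulr.
have [|u2 [s2 [[v2 uv2] sp2 e2]]] := IH k sk kn0.
  by move=> p pp dp; apply: (pg p pp); rewrite e; apply: divides_mull.
exists (u1 * u2), (s1 ++ s2); split.
- by exists (v1 * v2); rewrite -[1]mulr1 {1}uv1 uv2; ring.
- by move=> p; rewrite mem_cat => /orP[/sp1|/sp2].
- by rewrite big_cat /= e1 e2; ring.
Qed.

End Gauss.

Section Transfer.
Variables (R S : idomainType) (f : {rmorphism R -> S}) (g : {rmorphism S -> R}).
Hypotheses (fK : cancel f g) (gK : cancel g f).

Lemma divides_iso a b : divides (f a) (f b) <-> divides a b.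
Proof.
split=> -[c e]; last by exists (f c); rewrite e rmorphM.
by exists (g c); rewrite -[b]fK e rmorphM fK.
Qed.

Lemma prime_iso p : prime_elt p -> prime_elt (f p).
Proof.
move=> [pn0 p1 pp]; split.
- by apply: contraNneq pn0 => e; rewrite -[p]fK e rmorph0.
- by rewrite -(rmorph1 f) => /divides_iso.
- move=> a b; rewrite -[a]gK -[b]gK -rmorphM => /divides_iso/pp.
  by case=> h; [left|right]; apply/divides_iso.
Qed.

Lemma ufd_iso : ufd R -> ufd S.
Proof.
move=> ufdR a an0; have [|u [s [u1 sp e]]] := ufdR (g a).
  by apply: contraNneq an0 => e; rewrite -[a]gK e rmorph0.
exists (f u), (map f s); split.
- by rewrite -(rmorph1 f); apply/divides_iso.
- by move=> p /mapP[q /sp qp ->]; apply: prime_iso.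
- by rewrite big_map -[a]gK e rmorphM rmorph_prod.
Qed.
End Transfer.

Lemma ufd_mpoly (K : fieldType) n : ufd {mpoly K[n]}.
Proof.
elim: n => [|n IH].
  move=> p pn0; exists p, [::]; rewrite big_nil mulr1; split => //.
  have e := nvar0_mpolyC p.
  have cn0 : p@_0%MM != 0 by rewrite -(mpolyC_eq0 0) -e.
  by exists (p@_0%MM)^-1%:MP; rewrite e -mpolyCM mcoeffC eqxx mulr1 mulVf.
have := @ufd_iso {poly {mpoly K[n]}} {mpoly K[n.+1]} (unsplit_var (t0 K n) (M0 K n)) (theta (v0 K
  n) (L0 K n)).
apply.
- exact: (unsplit_varK (frame0 K n)).
- exact: (thetaK (frame0 K n)).
- exact: ufd_poly IH.
Qed.

(** A zero resultant yields a non-constant common divisor, up to constants. If [p] divides it, then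
    [p] divides a constant multiple of [q], hence [q]; if [p] divides its cofactor in [p], comparing
    sizes makes the common divisor constant. *)
Lemma resultant_prime_neq0 (R : idomainType) (p q : {poly R}) :
  prime_elt p -> (1 < size p)%N -> ~ divides p q -> resultant p q != 0.
Proof.
move=> pp sp npq; have [pn0 p1 ppr] := pp.
rewrite resultant_eq0 -leqNgt leqNgt; apply/negP => sg.
have [[c w] /= cn0 cp] := Pdiv.WeakIdomain.dvdpP _ _ (dvdp_gcdl p q).
have [[c' w'] /= c'n0 cq] := Pdiv.WeakIdomain.dvdpP _ _ (dvdp_gcdr p q).
have gn0 : gcdp p q != 0 by rewrite gcdp_eq0 negb_and pn0.
have pc (r : R) : r != 0 -> ~ divides p r%:P.
  move=> rn0 [z e2]; have zn0 : z != 0.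
    by apply: contraNneq rn0 => z0; rewrite -polyC_eq0 e2 z0 mul0r.
  have := size_mul zn0 pn0; rewrite -e2 size_polyC rn0.
  by move: zn0; rewrite -size_poly_gt0; move: sp; lia.
have : divides p (w * gcdp p q) by rewrite -cp -mul_polyC; apply: divides_mull; apply: divides_refl.
case/ppr => [[w1 we]|[z ze]].
  have : c%:P = w1 * gcdp p q.
    by apply: (mulIf pn0); rewrite mul_polyC cp we; ring.
  have w1n0 : w1 != 0.
    apply: contraNneq cn0 => w0; have : c%:P * p = 0 by rewrite mul_polyC cp we w0 !mul0r.
    by move/eqP; rewrite mulf_eq0 (negbTE pn0) orbF polyC_eq0.
  move=> /(congr1 (fun r : {poly R} => size r)); rewrite size_mul // size_polyC cn0.
  by move: w1n0 sg; rewrite -size_poly_gt0; lia.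
have : divides p (c'%:P * q) by rewrite mul_polyC cq ze mulrA; apply: divides_mull;
  apply: divides_refl.
by case/ppr => // /(pc _ c'n0).
Qed.

(** The resultant is the eliminant; when [q] is constant in the main variable, [q] itself serves. *)
Lemma prime_elimination (R : idomainType) (p q : {poly R}) :
  prime_elt p -> (1 < size p)%N -> ~ divides p q ->
  exists (h : R) x y, h != 0 /\ h%:P = x * p + y * q.
Proof.
move=> pp sp npq; have [sq|sq] := leqP (size q) 1.
  exists q`_0, 0, 1; rewrite mul0r mul1r add0r -size1_polyC //; split => //.
  apply: contra_notN npq => /eqP q0; exists 0; by rewrite mul0r [q]size1_polyC // q0.
have [[x y] /= _ e] := resultant_in_ideal sp sq.
by exists (resultant p q), x, y; split => //; apply: resultant_prime_neq0.
Qed.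

(** * Closed sets *)

Section Noetherian.

Definition is_ideal (R : nzRingType) (I : R -> Prop) :=
  [/\ I 0, forall a b, I a -> I b -> I (a + b) & forall a b, I b -> I (a * b)].

(** The maximum condition for ideals given as predicates; it translates directly into the minimum
    condition for closed sets. *)
Definition noetherian (R : nzRingType) := forall Phi : (R -> Prop) -> Prop,
  (exists I, Phi I) -> (forall I, Phi I -> is_ideal I) ->
  exists I, Phi I /\ forall J, Phi J -> (forall a, I a -> J a) -> forall a, J a -> I a.

Variable R : comNzRingType.
Implicit Types I J : {poly R} -> Prop.

Definition lead_ideal k I (a : R) := exists p, [/\ I p, (size p <= k.+1)%N & p`_k = a].

Lemma lead_idealP k I : is_ideal I -> is_ideal (lead_ideal k I).
Proof.
case=> I0 ID IM; split; first by exists 0; rewrite size_poly0 coef0.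
  move=> a b [p [Ip sp <-]] [q [Iq sq <-]]; exists (p + q); rewrite coefD; split; first exact: ID.
    by apply: leq_trans (size_polyD _ _) _; rewrite geq_max sp sq.
  by [].
move=> a b [p [Ip sp <-]]; exists (a%:P * p); rewrite coefCM; split => //; first exact: IM.
by rewrite mul_polyC; apply: leq_trans (size_scale_leq _ _) sp.
Qed.

Lemma lead_ideal_mono k l I a : is_ideal I -> (k <= l)%N -> lead_ideal k I a -> lead_ideal l I a.
Proof.
case=> _ _ IM kl [p [Ip sp pa]]; exists ('X^(l - k) * p); split; first exact: IM.
  have [->|pn0] := eqVneq p 0; first by rewrite mulr0 size_poly0.
  rewrite mulrC size_mulXn //; apply: leq_trans (leq_add (leqnn _) sp) _; lia.
by rewrite mulrC coefMXn subKn // ltnNge leq_subr /= pa.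
Qed.

(** A member of [Phi] is sought whose leading ideals cannot grow in any degree. A larger member has
    the same leading coefficients, hence equals it by induction on size. *)
Lemma noetherian_poly : noetherian R -> noetherian {poly R}.
Proof.
move=> nR Phi [I1 Phi1] id.
pose stable k I := forall J, Phi J -> (forall a, I a -> J a) ->
  forall a, lead_ideal k J a -> lead_ideal k I a.
(* Take a leading ideal that is maximal over all members and all degrees: leading ideals grow with
   the degree, so from there on they are stuck. *)
have [I0 [k0 [P0 st0]]] : exists I k0, Phi I /\ forall k, (k0 <= k)%N -> stable k I.
  have [||L [[I [k [PI hL]]] mx]] := nR (fun L => exists I k, Phi I /\ forall a,
    L a <-> lead_ideal k I a).
  - by exists (lead_ideal 0 I1), I1, 0%N.
  - move=> L [I [k [PI hL]]]; have [h0 hD hM] := lead_idealP k (id I PI).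
    by split=> [|a b|a b]; rewrite !hL; [|apply: hD|apply: hM].
  exists I, k; split => // l kl J PJ IJ a ha.
  apply: (lead_ideal_mono (id I PI) kl); apply/hL; apply: (mx (lead_ideal l J)) ha.
    by exists J, l.
  move=> b /hL [p [/IJ Jp sp pb]]; apply: (lead_ideal_mono (id J PJ) kl).
  by exists p.
have st_up k I J : Phi J -> (forall a, I a -> J a) -> stable k I -> stable k J.
  move=> PJ IJ st J' PJ' JJ' a /(st _ PJ' (fun b h => JJ' b (IJ b h))) [p [/IJ Jp sp pa]].
  by exists p.
(* The finitely many degrees below [k0] are treated one by one, enlarging the ideal each time; by
   [st_up] the stability already reached survives. *)
have [I [PI st]] : exists I, Phi I /\ forall k, stable k I.
  have step j : exists I, Phi I /\ forall k, (k0 <= k)%N || (k < j)%N -> stable k I.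
    elim: j => [|j [I [PI stI]]]; first by exists I0; split=> // k; rewrite orbF => /st0.
    have [||L [[I' [PI' [II' hL]]] mx]] := nR (fun L => exists I', Phi I' /\
        (forall a, I a -> I' a) /\ forall a, L a <-> lead_ideal j I' a).
    - by exists (lead_ideal j I), I.
    - move=> L [I' [PI' [_ hL]]]; have [h0 hD hM] := lead_idealP j (id I' PI').
      by split=> [|a b|a b]; rewrite !hL; [|apply: hD|apply: hM].
    exists I'; split => // k; rewrite ltnS [(k <= j)%N]leq_eqVlt orbCA => /orP[/eqP ->|h].
      move=> J PJ I'J a ha; apply/hL; apply: (mx (lead_ideal j J)) ha.
        by exists J; split => //; split => // b /II'/I'J.
      by move=> b /hL [p [/I'J Jp sp pb]]; exists p.
    by apply: (st_up k I); [|exact: II'|exact: stI].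
  have [I [PI h]] := step k0; exists I; split => // k; apply: h.
  by case: leqP.
exists I; split => // J PJ IJ p; have [n sn] := ubnP (size p).
have [I00 ID IM] := id I PI; have [_ JD JM] := id J PJ.
elim: n p sn => // n IH p sn Jp.
have [->//|pn0] := eqVneq p 0.
have := st (size p).-1 J PJ IJ p`_(size p).-1.
case.
  by exists p; split => //; rewrite prednK // size_poly_gt0.
move=> q [Iq sq qp]; rewrite -[p](subrK q); apply: ID => //.
apply: IH; last by apply: JD => //; rewrite -mulN1r; apply: JM; apply: IJ.
have sp : (0 < size p)%N by rewrite size_poly_gt0.
apply: (@leq_ltn_trans (size p).-1); last by rewrite -ltnS prednK.
apply/leq_sizeP => j jp.
rewrite coefB; case: (ltngtP j (size p).-1) => [lt|gt|->]; last by rewrite qp subrr.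
  by move: jp; rewrite leqNgt lt.
rewrite !nth_default ?subrr //; first by apply: leq_trans sq _.
by rewrite -(prednK sp).
Qed.

End Noetherian.

Lemma noetherian_surj (R S : nzRingType) (f : {rmorphism R -> S}) (g : S -> R) :
  cancel g f -> noetherian R -> noetherian S.
Proof.
move=> gK nR Phi [I1 P1] id.
have [||L [[I [PI hL]] mx]] := nR (fun L => exists I, Phi I /\ forall a, L a <-> I (f a)).
- by exists (fun a => I1 (f a)), I1.
- move=> L [I [PI hL]]; have [I0 ID IM] := id I PI.
  split=> [|a b|a b]; rewrite !hL ?rmorph0 ?rmorphD ?rmorphM //; [exact: ID|exact: IM].
exists I; split => // J PJ IJ a Ja; rewrite -[a]gK; apply/hL.
apply: (mx (fun a => J (f a))); [by exists J | by move=> b /hL/IJ | by rewrite gK].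
Qed.

Lemma noetherian_mpoly (K : fieldType) n : noetherian {mpoly K[n]}.
Proof.
elim: n => [|n IH].
  move=> Phi [I1 P1] id.
  case: (excluded_middle_informative (exists I, Phi I /\ exists2 a, a != 0 & I a)) => [|h].
    case=> I [PI [a an0 Ia]]; exists I; split => // J _ _ b _.
    have e := nvar0_mpolyC a; have [_ _ IM] := id I PI.
    have cn0 : a@_0%MM != 0 by rewrite -(mpolyC_eq0 0) -e.
    have -> : b = (b * (a@_0%MM)^-1%:MP) * a.
      by rewrite {2}e -mulrA -mpolyCM mulVf // mpolyC1 mulr1.
    exact: IM.
  exists I1; split => // J PJ _ a Ja; have [I0 _ _] := id I1 P1.
  have [->//|an0] := eqVneq a 0.
  by case: h; exists J; split => //; exists a.
apply: (@noetherian_surj {poly {mpoly K[n]}} {mpoly K[n.+1]} (unsplit_var (t0 K n) (M0 K n))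
  (theta (v0 K n) (L0 K n))).
  exact: (thetaK (frame0 K n)).
exact: noetherian_poly IH.
Qed.

Section Closed.
Variables (K : fieldType) (n : nat).
Implicit Types A B C : vset K n.

Definition van A (f : {mpoly K[n]}) := forall x, A x -> f.@[coords x] = 0.

Lemma vanD A f g : van A f -> van A g -> van A (f + g).
Proof. by move=> hf hg x Ax; rewrite mevalD hf ?hg ?addr0. Qed.

Lemma vanMl A f g : van A g -> van A (f * g).
Proof. by move=> hg x Ax; rewrite mevalM hg ?mulr0. Qed.

Lemma vanMr A f g : van A f -> van A (f * g).
Proof. by move=> hg x Ax; rewrite mevalM hg ?mul0r. Qed.

Lemma van_divides A f g : van A f -> divides f g -> van A g.
Proof. by move=> hf [c ->]; apply: vanMl. Qed.

Lemma van0 A : van A 0.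
Proof. by move=> x _; rewrite meval0. Qed.

Lemma van_subs A B f : subs A B -> van B f -> van A f.
Proof. by move=> AB hf x /AB/hf. Qed.

Lemma closedK_mem A x : closedK A -> (forall f, van A f -> f.@[coords x] = 0) -> A x.
Proof. by move=> [S hS] h; apply/hS => P SP; apply: h => y /hS; apply. Qed.

Lemma closed_intro A : (forall x, (forall f, van A f -> f.@[coords x] = 0) -> A x) -> closedK A.
Proof. by move=> h; exists (van A) => x; split=> [Ax P|]; [apply|apply: h]. Qed.

Lemma closed_subs A B : closedK A -> (forall f, van A f -> van B f) -> subs B A.
Proof. by move=> cA h x Bx; apply: closedK_mem => // f /h; apply. Qed.

Lemma set_eq_closed A B : set_eq A B -> closedK A -> closedK B.
Proof. by move=> AB [S hS]; exists S => x; rewrite -AB. Qed.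

Lemma closedI A B : closedK A -> closedK B -> closedK (setIv A B).
Proof.
move=> cA cB; apply: closed_intro => x h; split; apply: closedK_mem => // f hf.
  by apply: h => y [/hf].
by apply: h => y [_ /hf].
Qed.

Lemma closedU A B : closedK A -> closedK B -> closedK (setUv A B).
Proof.
move=> cA cB; apply: closed_intro => x h; apply: Classical_Prop.NNPP => nx.
have [nA nB] := Classical_Prop.not_or_and _ _ nx.
have [f vf fx] : exists2 f, van A f & f.@[coords x] <> 0.
  apply: Classical_Prop.NNPP => H; apply: nA; apply: closedK_mem => // f hf.
  by apply: Classical_Prop.NNPP => H2; apply: H; exists f.
have [g vg gx] : exists2 f, van B f & f.@[coords x] <> 0.
  apply: Classical_Prop.NNPP => H; apply: nB; apply: closedK_mem => // g hg.
  by apply: Classical_Prop.NNPP => H2; apply: H; exists g.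
have /eqP : (f * g).@[coords x] = 0.
  by apply: h => y [Ay|By]; rewrite mevalM ?(vf _ Ay) ?(vg _ By) ?mul0r ?mulr0.
by rewrite mevalM mulf_eq0 => /orP[] /eqP.
Qed.

Lemma closed_empty : closedK (fun _ : 'rV[K]_n => False).
Proof.
apply: closed_intro => x /(_ 1) h; have /eqP := h ltac:(by []).
by rewrite meval1 oner_eq0.
Qed.

Lemma closed_zero f : closedK (fun x : 'rV[K]_n => f.@[coords x] = 0).
Proof. by apply: closed_intro => x h; apply: h. Qed.

Lemma closed_bigU m (Y : 'I_m -> vset K n) (P : 'I_m -> Prop) :
  (forall i, closedK (Y i)) -> closedK (fun x => exists2 i, P i & Y i x).
Proof.
elim: m Y P => [|m IH] Y P cY.
  by apply: set_eq_closed closed_empty => x; split=> // -[[]].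
have cU : closedK (fun x => exists2 i, P (lift ord0 i) & Y (lift ord0 i) x) by apply: IH.
case: (excluded_middle_informative (P ord0)) => p0.
  apply: set_eq_closed (closedU (cY ord0) cU) => x; split=> [[y|[i pi y]]|[i pi y]].
  - by exists ord0.
  - by exists (lift ord0 i).
  - by case: (unliftP ord0 i) pi y => [j ->|->] pi y; [right; exists j | left].
apply: set_eq_closed cU => x; split=> [[i pi y]|[i pi y]]; first by exists (lift ord0 i).
by case: (unliftP ord0 i) pi y => [j ->|->] pi y; [exists j | case: p0].
Qed.

Lemma irreducible_union A B C : irreducibleK A -> closedK A -> closedK B -> closedK C ->
  subs A (setUv B C) -> subs A B \/ subs A C.
Proof.
move=> [_ irr] cA cB cC ABC.
have [|h|h] := irr _ _ (closedI cA cB) (closedI cA cC); last 2 first.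
- by left=> x /h[].
- by right=> x /h[].
by move=> x; split=> [Ax|[[]|[]] //]; case: (ABC x Ax) => h; [left|right].
Qed.

Lemma irreducible_bigU A m (Y : 'I_m -> vset K n) (P : 'I_m -> Prop) :
  irreducibleK A -> closedK A -> (forall i, closedK (Y i)) ->
  subs A (fun x => exists2 i, P i & Y i x) -> exists2 i, P i & subs A (Y i).
Proof.
move=> irr cA; elim: m Y P => [|m IH] Y P cY AY.
  by have [[x Ax] _] := irr; have [[]] := AY x Ax.
have cU : closedK (fun x => exists2 i, P (lift ord0 i) & Y (lift ord0 i) x) by apply: closed_bigU.
have cU0 : closedK (fun x => P ord0 /\ Y ord0 x).
  case: (excluded_middle_informative (P ord0)) => p0; last first.
    by apply: set_eq_closed closed_empty => x; split => // -[].
  by apply: set_eq_closed (cY ord0) => x; split=> // -[].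
have [|h|h] := irreducible_union irr cA cU0 cU.
- move=> x /AY[i pi y].
  by case: (unliftP ord0 i) pi y => [j ->|->] pi y; [right; exists j | left].
- by have [[x Ax] _] := irr; have [p0 _] := h x Ax; exists ord0 => // y /h[].
- by have [i pi yi] := IH _ (fun i => P (lift ord0 i)) (fun i => cY _) h; exists (lift ord0 i).
Qed.

Lemma van_prime A f g : irreducibleK A -> closedK A -> van A (f * g) -> van A f \/ van A g.
Proof.
move=> irr cA vfg.
have [|h|h] := irreducible_union irr cA (closed_zero f) (closed_zero g); [|by left|by right].
by move=> x Ax; have /eqP := vfg x Ax; rewrite mevalM mulf_eq0 => /orP[]/eqP; [left|right].
Qed.

Lemma van_neq1 A : (exists x, A x) -> ~ van A 1.
Proof. by move=> [x Ax] /(_ x Ax) /eqP; rewrite meval1 oner_eq0. Qed.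

(** Closed sets are determined by their vanishing ideals, so a maximal ideal among these belongs to
    a minimal set. *)
Lemma closed_minimal (Phi : vset K n -> Prop) : (exists A, Phi A) ->
  (forall A, Phi A -> closedK A) ->
  exists A, Phi A /\ forall B, Phi B -> subs B A -> subs A B.
Proof.
move=> [A1 P1] cl.
have [||I [[A [PA hI]] mx]] := @noetherian_mpoly K n
    (fun I => exists A, Phi A /\ forall f, I f <-> van A f).
- by exists (van A1), A1.
- move=> I [A [PA hI]]; split=> [|f g|f g]; rewrite !hI; first exact: van0.
    exact: vanD.
  exact: vanMl.
exists A; split => // B PB BA; apply: closed_subs; first exact: cl.
move=> f vf; apply/hI; apply: (mx (van B)) vf; first by exists B.
by move=> g /hI; apply: van_subs.
Qed.

Lemma closed_induction (Phi : vset K n -> Prop) :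
  (forall A, closedK A ->
     (forall B, closedK B -> subs B A -> ~ subs A B -> Phi B) -> Phi A) ->
  forall A, closedK A -> Phi A.
Proof.
move=> H A cA; apply: Classical_Prop.NNPP => nA.
have [||B [[cB nB] mx]] := closed_minimal (Phi := fun A => closedK A /\ ~ Phi A).
- by exists A.
- by move=> B [].
apply: nB; apply: H => // C cC CB nBC; apply: Classical_Prop.NNPP => nC; apply: nBC.
by apply: mx.
Qed.

Definition decomposed A m (Y : 'I_m -> vset K n) :=
  (forall i, closedK (Y i) /\ irreducibleK (Y i)) /\ set_eq A (fun x => exists i, Y i x).

Lemma decomposition A : closedK A -> exists m (Y : 'I_m -> vset K n), decomposed A Y.
Proof.
move=> cA; elim/closed_induction: cA => {}A cA IH.
case: (excluded_middle_informative (exists x, A x)) => [neA|neA]; last first.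
  exists 0%N, (fun _ => A); split=> [[]//|x]; split=> [Ax|[[]//]].
  by case: neA; exists x.
case: (excluded_middle_informative (irreducibleK A)) => [irr|nirr].
  by exists 1%N, (fun _ => A); split => // x; split=> [|[]//]; exists ord0.
have [B [C [cB cC ABC [nB nC]]]] : exists B C,
    [/\ closedK B, closedK C, set_eq A (setUv B C) & ~ set_eq A B /\ ~ set_eq A C].
  apply: Classical_Prop.NNPP => h; apply: nirr; split => // B C cB cC ABC.
  apply: Classical_Prop.NNPP => h'; apply: h; exists B, C; split => //.
  exact: Classical_Prop.not_or_and.
have [m1 [Y1 [h1 e1]]] : exists m (Y : 'I_m -> vset K n), decomposed B Y.
  apply: IH => // [x Bx|AB]; first by apply/ABC; left.
  by apply: nB => x; split=> [/AB//|Bx]; apply/ABC; left.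
have [m2 [Y2 [h2 e2]]] : exists m (Y : 'I_m -> vset K n), decomposed C Y.
  apply: IH => // [x Cx|AC]; first by apply/ABC; right.
  by apply: nC => x; split=> [/AC//|Cx]; apply/ABC; right.
exists (m1 + m2)%N, (fun i => match split i with inl j => Y1 j | inr j => Y2 j end).
split=> [i|x]; first by case: split.
rewrite ABC /setUv e1 e2; split=> [[[j yj]|[j yj]]|[i]].
- by exists (lshift m2 j); rewrite (unsplitK (inl j)).
- by exists (rshift m1 j); rewrite (unsplitK (inr j)).
- by case: split => j yj; [left|right]; exists j.
Qed.

Lemma irredundant_decomposition A : closedK A -> exists m (Y : 'I_m -> vset K n),
  decomposed A Y /\ forall i j, subs (Y i) (Y j) -> i = j.
Proof.
move=> cA; have [m0 [Y0 d0]] := decomposition cA.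
pose P m := asb (exists Y : 'I_m -> vset K n, decomposed A Y).
have [m /asbP[Y dY] mn] := ex_minnP (ex_intro P m0 ltac:(by apply/asbP; exists Y0)).
exists m, Y; split => // i j Yij; apply/eqP/negPn/negP => ij.
case: m Y dY mn i j Yij ij => [|m] Y [hY eY] mn i j Yij ij; first by case: i Yij ij.
suff /mn : P m by rewrite ltnn.
apply/asbP; exists (fun l => Y (lift i l)); split => // x.
rewrite eY; split=> [[l yl]|[l yl]]; last by exists (lift i l).
case: (unliftP i l) yl => [l' ->|->] yl; first by exists l'.
case: (unliftP i j) ij Yij => [j' ->|->] ij Yij; last by rewrite eqxx in ij.
by exists j'; apply: Yij.
Qed.

End Closed.

(** * Finite projections *)

Lemma mpoly_ring_ind (R : comNzRingType) n (P : {mpoly R[n]} -> Prop) :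
  (forall c, P c%:MP) -> (forall i, P 'X_i) ->
  (forall f g, P f -> P g -> P (f + g)) -> (forall f g, P f -> P g -> P (f * g)) ->
  forall f, P f.
Proof.
move=> hC hX hD hM f; rewrite (mpolyE f).
apply big_ind => [|a b|m _]; [by rewrite -mpolyC0 | exact: hD |].
rewrite -mul_mpolyC; apply: (hM _ _) => //; rewrite mpolyXE_id.
apply big_ind => [|a b|i _]; [by rewrite -mpolyC1 | exact: hM |].
by elim: (m i) => [|k IH]; rewrite ?expr0 -?mpolyC1 // exprS; apply: hM.
Qed.

Section FiniteMaps.
Variable K : closedFieldType.

Definition img n k (A : vset K n) (M : 'M[K]_(n, k)) : vset K k :=
  fun y => exists x, A x /\ y = x *m M.

(* K[A] is a finitely generated module over the polynomials in x *m M. *)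
Definition finmod n k (A : vset K n) (M : 'M[K]_(n, k)) :=
  exists m (w : 'I_m -> {mpoly K[n]}), forall f, exists c : 'I_m -> {mpoly K[k]},
    forall x, A x -> f.@[coords x] = \sum_i (c i).@[coords (x *m M)] * (w i).@[coords x].

Lemma finmod_subs n k (A B : vset K n) (M : 'M[K]_(n, k)) :
  subs A B -> finmod B M -> finmod A M.
Proof.
by move=> AB [m [w h]]; exists m, w => f; have [c hc] := h f; exists c => x /AB/hc.
Qed.

Lemma finmod_id n (A : vset K n) : finmod A 1%:M.
Proof.
exists 1%N, (fun _ => 1) => f; exists (fun _ => f) => x _.
by rewrite big_ord1 meval1 mulr1 mulmx1.
Qed.

Lemma finmod_comp n k l (A : vset K n) (M : 'M[K]_(n, k)) (N : 'M[K]_(k, l)) :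
  finmod A M -> finmod (img A M) N -> finmod A (M *m N).
Proof.
move=> [m [w h]] [m' [w' h']].
exists #|{: 'I_m * 'I_m'}|, (fun u => let: (i, j) := enum_val u in w i * pull M (w' j)) => f.
have [c hc] := h f; have [c' hc'] := fin_all_exists (fun i => h' (c i)).
exists (fun u => let: (i, j) := enum_val u in c' i j) => x Ax.
transitivity (\sum_i \sum_j
    (c' i j).@[coords (x *m (M *m N))] * (w i * pull M (w' j)).@[coords x]).
  rewrite hc //; apply: eq_bigr => i _; rewrite hc' ?mulr_suml; last by exists x.
  by apply: eq_bigr => j _; rewrite mulmxA mevalM pull_ev; ring.
rewrite pair_bigA /= (reindex _ (onW_bij _ (enum_val_bij _))) /=.
by apply: eq_bigr => u _; case: (enum_val u).
Qed.

(** One step of Noether normalisation: in the direction [v] the equation [f] is monic up to a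
    scalar, and division by it expresses every polynomial on [A] through finitely many powers of the
    linear form [tau]. *)
Lemma finmod_step k (A : vset K k.+1) f v L tau M :
  frame v L tau M -> van A f -> (pihomog mdeg (msize f).-1 f).@[coords v] != 0 -> finmod A M.
Proof.
move=> fr vf; set e := (msize f).-1; set c := meval _ _ => cn0.
have dle : mdeg_le f 0 e := @mdeg_le_msize _ _ f.
set p := theta v L f; have pe : p`_e = c%:MP := theta_top v L dle.
have sp : (size p <= e.+1)%N := wdeg_le_size (wdeg_le_theta (v := v) (L := L) dle).
have sp' : size p = e.+1.
  apply/eqP; rewrite eqn_leq sp ltnNge; apply/negP => h.
  move/eqP: pe; rewrite nth_default // eq_sym mpolyC_eq0; exact/negP.
pose p' := (c^-1%:MP)%:P * p.
have p'm : p' \is monic.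
  by rewrite monicE /p' lead_coefM lead_coefC /lead_coef sp' /= pe -mpolyCM mulVf.
exists (size p'), (fun i => (\sum_j tau j 0 *: 'X_j) ^+ i) => h.
set r := Pdiv.Ring.rmodp (theta v L h) p'.
exists (fun i => r`_i) => x Ax.
have xh g : g.@[coords x] = ev2 (theta v L g) (x *m M) ((x *m tau) 0 0).
  by rewrite theta_ev -(frame_dec fr).
have tx : (\sum_j tau j 0 *: 'X_j).@[coords x] = (x *m tau) 0 0.
  by rewrite raddf_sum mxE /=; apply: eq_bigr => j _; rewrite mevalZ mevalXU mulrC.
have sr : (size r <= size p')%N by rewrite ltnW // Pdiv.Ring.ltn_rmodp monic_neq0.
have p'0 : (map_poly (meval (coords (x *m M))) p').[(x *m tau) 0 0] = 0.
  rewrite /p' rmorphM /= hornerM; have := xh f; rewrite (vf _ Ax) /ev2 -/p => e0.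
  by rewrite -[X in _ * X]e0 mulr0.
rewrite xh (Pdiv.RingMonic.rdivp_eq p'm (theta v L h)) -/r /ev2 rmorphD rmorphM /= !hornerE p'0.
rewrite mulr0 add0r (@horner_coef_wide _ (size p')); last exact: leq_trans (size_poly _ _) sr.
by apply: eq_bigr => i _; rewrite coef_map rmorphXn /= tx.
Qed.

(** Since 1 is a combination of the generators, they have no common zero on [A]; this makes the
    eigenvectors in the determinant arguments non-zero. *)
Lemma finmod_gen_neq0 n k (A : vset K n) (M : 'M[K]_(n, k)) m (w : 'I_m -> {mpoly K[n]}) :
  (forall f, exists c : 'I_m -> {mpoly K[k]},
    forall x, A x -> f.@[coords x] = \sum_i (c i).@[coords (x *m M)] * (w i).@[coords x]) ->
  forall x, A x -> \row_i (w i).@[coords x] != 0.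
Proof.
move=> h x Ax; have [c /(_ x Ax)] := h 1; rewrite meval1 => e.
apply: contra_eq_neq e => /rowP w0; rewrite big1 ?oner_neq0 // => i _.
by have := w0 i; rewrite !mxE => ->; rewrite mulr0.
Qed.

(** Multiplication by [f] on the generators is given by a matrix over the base. At a point of [A]
    the generator values form an eigenvector with eigenvalue f(x), so the characteristic polynomial
    is an integral equation. *)
Lemma finmod_integral n k (A : vset K n) (M : 'M[K]_(n, k)) f : finmod A M ->
  exists2 p : {poly {mpoly K[k]}}, p \is monic &
    forall x, A x -> ev2 p (x *m M) f.@[coords x] = 0.
Proof.
move=> [m [w h]]; have [N hN] := fin_all_exists (fun i => h (f * w i)).
pose T := \matrix_(j < m, i < m) N i j.
exists (char_poly T); first exact: char_poly_monic.
move=> x Ax; rewrite /ev2 map_char_poly; apply/eqP.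
rewrite -[_ == 0]/(root _ _) -eigenvalue_root_char; apply/eigenvalueP.
exists (\row_i (w i).@[coords x]); last exact: finmod_gen_neq0 h x Ax.
apply/rowP => i; rewrite !mxE -mevalM hN //; apply: eq_bigr => j _.
by rewrite !mxE mulrC.
Qed.

(** Each coordinate is integral over the base and takes finitely many values on the fibre. The list
    may be larger than the fibre; only finiteness matters. *)
Lemma finmod_fibre n k (A : vset K n) (M : 'M[K]_(n, k)) y : finmod A M ->
  exists s : seq 'rV[K]_n, forall x, A x -> x *m M = y -> x \in s.
Proof.
move=> fA.
have [rs hrs] : exists rs : seq K, forall x i, A x -> x *m M = y -> x 0 i \in rs.
  have hi i : exists rs : seq K, forall x, A x -> x *m M = y -> x 0 i \in rs.
    have [p pm hp] := finmod_integral 'X_i fA.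
    have [rs e] := closed_field_poly_normal (map_poly (meval (coords y)) p).
    exists rs => x Ax xy; have := hp x Ax; rewrite mevalXU xy /ev2 e => /eqP.
    rewrite (monicP (monic_map _ pm)) scale1r -[_ == 0]/(root _ _) root_prod_XsubC.
    by [].
  have [rs h] := fin_all_exists hi.
  exists (flatten [seq rs i | i <- enum 'I_n]) => x i Ax xy.
  by apply/flattenP; exists (rs i); [apply: map_f; rewrite mem_enum | apply: h].
exists [seq \row_i rs`_(g i) | g : {ffun 'I_n -> 'I_(size rs)}] => x Ax xy.
have ix (i : 'I_n) : (index (x ord0 i) rs < size rs)%N by rewrite index_mem hrs.
apply/mapP; exists [ffun i => Ordinal (ix i)]; first by rewrite mem_enum.
by apply/rowP => i; rewrite mxE ffunE /= nth_index // hrs.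
Qed.

Definition point_ideal n (y : 'rV[K]_n) (h : {mpoly K[n]}) :=
  exists g : 'I_n -> {mpoly K[n]}, h = \sum_j ('X_j - (y 0 j)%:MP) * g j.

Lemma point_idealP n (y : 'rV[K]_n) h : point_ideal y (h - (h.@[coords y])%:MP).
Proof.
have iD f g : point_ideal y f -> point_ideal y g -> point_ideal y (f + g).
  move=> [a ->] [b ->]; exists (fun j => a j + b j); rewrite -big_split; apply: eq_bigr => j _.
  by rewrite mulrDr.
have iM f g : point_ideal y g -> point_ideal y (f * g).
  by move=> [a ->]; exists (fun j => f * a j); rewrite mulr_sumr; apply: eq_bigr => j _; ring.
elim/mpoly_ring_ind: h => [c|i|f g hf hg|f g hf hg].
- by exists (fun _ => 0); rewrite mevalC subrr big1 // => j _; rewrite mulr0.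
- exists (fun j => (j == i)%:R); rewrite mevalXU (bigD1 i) //= eqxx mulr1 big1 ?addr0 // => j ji.
  by rewrite (negbTE ji) mulr0.
- have -> : f + g - ((f + g).@[coords y])%:MP =
    (f - (f.@[coords y])%:MP) + (g - (g.@[coords y])%:MP) by rewrite mevalD mpolyCD; ring.
  exact: iD.
- have -> : f * g - ((f * g).@[coords y])%:MP =
    f * (g - (g.@[coords y])%:MP) + (g.@[coords y])%:MP * (f - (f.@[coords y])%:MP).
    by rewrite mevalM mpolyCM; ring.
  by apply: iD; apply: iM.
Qed.

(** * Lying over: images under finite projections are closed *)

Section LyingOver.
Variables (n k : nat) (A : vset K n) (M : 'M[K]_(n, k)) (y : 'rV[K]_k).
Hypothesis (fA : finmod A M).
Hypothesis (hy : forall h, van (img A M) h -> h.@[coords y] = 0).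

(** The ideal of the fibre over [y], generated by the vanishing ideal of [A] and the coordinates of
    [x *m M - y]. *)
Definition fibre_ideal (f : {mpoly K[n]}) := exists g : 'I_k -> {mpoly K[n]},
  forall x, A x -> f.@[coords x] = \sum_j ((x *m M) 0 j - y 0 j) * (g j).@[coords x].

Lemma fibre_ideal_ideal : is_ideal fibre_ideal.
Proof.
split.
- by exists (fun _ => 0) => x _; rewrite meval0 big1 // => j _; rewrite ?meval0 mulr0.
- move=> a b [g ga] [h hb]; exists (fun j => g j + h j) => x Ax.
  rewrite mevalD ga // hb // -big_split; apply: eq_bigr => j _.
  by rewrite mevalD mulrDr.
- move=> a b [g gb]; exists (fun j => a * g j) => x Ax.
  by rewrite mevalM gb // mulr_sumr; apply: eq_bigr => j _; rewrite mevalM; ring.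
Qed.

(* Nakayama's lemma: if the fibre over y were empty, det(1 - B) would vanish on
   the image although B vanishes at y. *)
Lemma fibre_ideal_proper : ~ fibre_ideal 1.
Proof.
move=> [g hg]; have [m [w hw]] := fA.
have [c hc] := fin_all_exists (fun u : 'I_k * 'I_m => hw (g u.1 * w u.2)).
pose B : 'M[{mpoly K[k]}]_m :=
  \matrix_(l, i) \sum_j ('X_j - (y 0 j)%:MP) * c (j, i) l.
have detB z : (\det (1%:M - B)).@[coords z] = \det (1%:M - map_mx (meval (coords z)) B).
  by rewrite -det_map_mx map_mxB map_mx1.
have By : map_mx (meval (coords y)) B = 0.
  apply/matrixP => l i; rewrite !mxE raddf_sum /= big1 // => j _.
  by rewrite mevalM mevalB mevalXU mevalC subrr mul0r.
have /hy : van (img A M) (\det (1%:M - B)).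
  move=> z [x [Ax zx]]; rewrite detB; apply/eqP/det0P.
  exists (\row_i (w i).@[coords x]); first exact: finmod_gen_neq0 hw x Ax.
  rewrite mulmxBr mulmx1; apply/eqP; rewrite subr_eq0; apply/eqP/rowP => i; rewrite !mxE.
  rewrite -[LHS]mul1r -(meval1 (coords x)) hg // mulr_suml.
  rewrite (eq_bigr (fun j => \sum_l ((x *m M) 0 j - y 0 j) *
     ((c (j, i) l).@[coords z] * (w l).@[coords x]))); last first.
    by move=> j _; rewrite -mulrA -mevalM; have /= -> := hc (j, i) x Ax; rewrite mulr_sumr zx.
  rewrite exchange_big; apply: eq_bigr => l _ /=; rewrite !mxE raddf_sum mulr_sumr.
  apply: eq_bigr => j _; rewrite /= mevalM mevalB mevalXU mevalC zx /coords; ring.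
by rewrite detB By subr0 det1 => /eqP; rewrite oner_eq0.
Qed.

(** If every factor generated the unit ideal together with [J], the factors could be cancelled from
    the product one by one and [J] would contain 1. *)
Lemma ideal_split (J : {mpoly K[n]} -> Prop) (s : seq {mpoly K[n]}) :
  is_ideal J -> ~ J 1 -> J (\prod_(a <- s) a) ->
  exists2 a, a \in s & ~ (exists j c, J j /\ 1 = j + c * a).
Proof.
move=> [J0 JD JM] J1; elim: s => [|a s IH]; first by rewrite big_nil.
rewrite big_cons => Jas.
case: (excluded_middle_informative (exists j c, J j /\ 1 = j + c * a)) => [[j [c [Jj e]]]|h].
  have [|b bs nb] := IH; last by exists b; rewrite // inE bs orbT.
  set P := \prod_(b <- s) b in Jas *.
  have -> : P = P * j + c * (a * P) by rewrite -[LHS]mul1r e; ring.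
  by apply: (JD _ _); [apply: (JM _ _) | apply: (JM _ _)].
by exists a; rewrite ?mem_head.
Qed.

(** At [y] the integral equation of [f] splits into linear factors over [K], and the product of the
    [f - r] over its roots lies in the fibre ideal; one of these can be added to [J] leaving it
    proper. *)
Lemma eigen_ideal (J : {mpoly K[n]} -> Prop) f :
  is_ideal J -> ~ J 1 -> (forall g, fibre_ideal g -> J g) ->
  exists (a : K) J', [/\ is_ideal J', ~ J' 1, forall g, J g -> J' g & J' (f - a%:MP)].
Proof.
move=> id J1 FJ; have [J0 JD JM] := id; have [p pm hp] := finmod_integral f fA.
set P := map_poly (meval (coords y)) p.
have [rs e] := closed_field_poly_normal P.
have P1 : lead_coef P = 1 by apply/eqP; rewrite -monicE monic_map.
have JP : J (\prod_(a <- [seq f - r%:MP | r <- rs]) a).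
  apply: (FJ _); rewrite big_map.
  have -> : \prod_(r <- rs) (f - r%:MP) = (map_poly (@mpolyC n K) P).[f].
    rewrite e P1 scale1r rmorph_prod horner_prod; apply: eq_bigr => r _ /=.
    by rewrite rmorphB /= map_polyX map_polyC /= !hornerE.
  have [_ FD FM] := fibre_ideal_ideal.
  pose Q := map_poly (pull M) p.
  have -> : (map_poly (@mpolyC n K) P).[f] = - (Q - map_poly (@mpolyC n K) P).[f] + Q.[f].
    by rewrite hornerD hornerN; ring.
  apply: (FD _ _); last first.
    exists (fun _ => 0) => x Ax; rewrite big1 => [|j _]; last by rewrite ?meval0 mulr0.
    rewrite -(hp x Ax) /Q /ev2 -horner_map /=; congr (_.[_]).
    by rewrite -map_poly_comp; apply: eq_map_poly => h /=; rewrite pull_ev.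
  rewrite -mulN1r; apply: (FM _ _); rewrite horner_coef.
  have [F0 _ _] := fibre_ideal_ideal.
  apply big_ind => [//|a b|i _]; first exact: FD.
  rewrite mulrC; apply: (FM _ _).
  rewrite coefB /Q /P !coef_map /=.
  have [g hg] := point_idealP y p`_i; exists (fun j => pull M (g j)) => x Ax.
  have := congr1 (fun q => (pull M q).@[coords x]) hg.
  rewrite /= rmorphB /= pullC => ->; rewrite pull_ev raddf_sum; apply: eq_bigr => j _ /=.
  by rewrite mevalM mevalB mevalXU mevalC pull_ev.
have [_ /mapP[r _ ->] nr] := ideal_split id J1 JP.
exists r, (fun g => exists j c, J j /\ g = j + c * (f - r%:MP)); split => //.
- split; first by exists 0, 0; rewrite mul0r addr0.
    move=> a b [j [c [Jj ->]]] [j' [c' [Jj' ->]]]; exists (j + j'), (c + c'); split;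
      first exact: JD.
    ring.
  move=> a b [j [c [Jj ->]]]; exists (a * j), (a * c); split; first exact: JM.
  ring.
- by move=> g Jg; exists g, 0; rewrite mul0r addr0.
- by exists 0, 1; rewrite mul1r add0r.
Qed.

(** Adjoining some ['X_i - a] for each coordinate in turn, with the ideal kept proper, ends at a
    point; this does the work of the Nullstellensatz. *)
Lemma lying_over : closedK A -> exists x, A x /\ x *m M = y.
Proof.
move=> cA.
have [x [J [id J1 FJ hx]]] : exists (x : 'rV[K]_n) J, [/\ is_ideal J, ~ J 1,
    forall g, fibre_ideal g -> J g & forall i, J ('X_i - (x 0 i)%:MP)].
  suff [x [J [id J1 FJ hx]]] : exists (x : 'I_n -> K) J, [/\ is_ideal J, ~ J 1,
      forall g, fibre_ideal g -> J g & forall i, i \in enum 'I_n -> J ('X_i - (x i)%:MP)].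
    by exists (\row_i x i), J; split => // i; rewrite mxE; apply: hx; rewrite mem_enum.
  elim: (enum 'I_n) (enum_uniq 'I_n) => [_|i s IH /= /andP[si us]].
    by exists (fun _ => 0), fibre_ideal; split => //;
      [apply: fibre_ideal_ideal | apply: fibre_ideal_proper].
  have [x [J [id J1 FJ hx]]] := IH us.
  have [a [J' [id' J1' JJ' Ja]]] := eigen_ideal 'X_i id J1 FJ.
  exists (fun j => if j == i then a else x j), J'; split => // [g /FJ/JJ' //|j].
  rewrite inE; case: eqP => [-> _ //|_ /= js]; exact: JJ' (hx j js).
have [J0 JD JM] := id.
have Jz g : J g -> g.@[coords x] = 0.
  move=> Jg; apply/eqP/negPn/negP => gx; apply: J1.
  have : J ((g.@[coords x])%:MP).
    have -> : (g.@[coords x])%:MP = g + (-1) * (g - (g.@[coords x])%:MP) by ring.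
    apply: (JD _ _) => //; apply: (JM _ _); have [h ->] := point_idealP x g.
    apply big_ind => [//|a b|i _]; first exact: JD.
    by rewrite mulrC; apply: (JM _ _).
  by move=> /(JM ((g.@[coords x])^-1)%:MP); rewrite -mpolyCM mulVf.
exists x; split.
  apply: (closedK_mem cA) => f vf; apply: Jz; apply: (FJ _); exists (fun _ => 0) => z Az.
  by rewrite vf // big1 // => j _; rewrite ?meval0 mulr0.
apply/rowP => j.
have /Jz : J (pull M 'X_j - (y 0 j)%:MP).
  apply: (FJ _); exists (fun i => (i == j)%:R) => z Az.
  rewrite mevalB mevalC pull_ev mevalXU (bigD1 j) //= eqxx meval1 mulr1 big1 ?addr0 // => i ij.
  by rewrite (negbTE ij) meval0 mulr0.
by rewrite mevalB mevalC pull_ev mevalXU => /eqP; rewrite subr_eq0 => /eqP.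
Qed.

End LyingOver.

Lemma closed_img n k (A : vset K n) (M : 'M[K]_(n, k)) :
  closedK A -> finmod A M -> closedK (img A M).
Proof.
move=> cA fA; apply: closed_intro => y hy; have [x [Ax xy]] := lying_over fA hy cA.
by exists x.
Qed.

Lemma closed_preimg n k (B : vset K k) (M : 'M[K]_(n, k)) :
  closedK B -> closedK (fun x => B (x *m M)).
Proof.
move=> cB; apply: closed_intro => x h; apply: (closedK_mem cB) => f vf.
by rewrite -pull_ev; apply: h => z Bz; rewrite pull_ev vf.
Qed.

Lemma irreducible_img n k (A : vset K n) (M : 'M[K]_(n, k)) :
  closedK A -> irreducibleK A -> irreducibleK (img A M).
Proof.
move=> cA irr; split; first by have [[x Ax] _] := irr; exists (x *m M), x.
move=> B C cB cC e.
have [|h|h] := irreducible_union irr cA (closed_preimg M cB) (closed_preimg M cC).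
- by move=> x Ax; apply/e; exists x.
- by left=> y; split=> [[x [Ax ->]]|By]; [apply: h | apply/e; left].
- by right=> y; split=> [[x [Ax ->]]|By]; [apply: h | apply/e; right].
Qed.

(** Let [f] vanish on [A]. The constant term of an integral equation of [f] over [B] vanishes on the
    image of [A], hence on that of [B]. So [f] times a monic polynomial in [f] of smaller degree
    vanishes on [B]; by irreducibility one of the two does, and the degree drops until it is [f]. *)
Lemma incomparable n k (A B : vset K n) (M : 'M[K]_(n, k)) :
  closedK A -> closedK B -> irreducibleK B -> finmod B M -> subs A B ->
  subs (img B M) (img A M) -> subs B A.
Proof.
move=> cA cB irr fB AB imBA; apply: closed_subs => // f vf.
apply: Classical_Prop.NNPP => nvf.
have [p pm hp] := finmod_integral f fB.
have [N sN] := ubnP (size p); elim: N p sN pm hp => // N IH p sN pm hp.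
have pn0 := monic_neq0 pm.
pose p1 := \poly_(i < (size p).-1) p`_i.+1.
have pE : p = p1 * 'X + (p`_0)%:P.
  apply/polyP => i; rewrite coefD coefMX coefC coef_poly; case: i => [|i] /=;
    first by rewrite add0r.
  rewrite addr0; case: ltnP => // h; rewrite nth_default //.
  by rewrite -(prednK (_ : 0 < size p)%N) ?size_poly_gt0.
have e2 x : B x -> ev2 p1 (x *m M) f.@[coords x] * f.@[coords x] + (p`_0).@[coords (x *m M)] = 0.
  by move=> Bx; rewrite -[RHS](hp x Bx) [in RHS]pE /ev2 rmorphD rmorphM /= map_polyX map_polyC /=
    !hornerE.
have c0 x : B x -> (p`_0).@[coords (x *m M)] = 0.
  move=> Bx; have [z [Az zx]] := imBA _ (ex_intro _ x (conj Bx erefl)).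
  by have := e2 z (AB z Az); rewrite vf // mulr0 add0r -zx.
have [sp|sp] := leqP (size p) 1.
  have [[x Bx] _] := irr; have := c0 x Bx.
  have /eqP := monicP pm; have -> : lead_coef p = p`_0.
    by rewrite lead_coefE; move: sp; case: (size p) => [|[]].
  by move=> /eqP ->; rewrite meval1 => /eqP; rewrite oner_eq0.
have lp1 : size p1 = (size p).-1.
  apply: size_poly_eq; rewrite prednK; last by rewrite -subn1 subn_gt0.
  by rewrite -lead_coefE (monicP pm) oner_neq0.
have [|h|//] := van_prime irr cB (f := (map_poly (pull M) p1).[f]) (g := f).
  move=> x Bx; rewrite mevalM -horner_map /= -map_poly_comp.
  have := e2 x Bx; rewrite c0 // addr0 => <-; congr (_.[_] * _); apply: eq_map_poly => h /=.
  by rewrite pull_ev.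
apply: (IH p1).
- by rewrite lp1 -ltnS prednK // ltnW.
- have sp0 : (0 < (size p).-1)%N by rewrite -subn1 subn_gt0.
  by rewrite monicE lead_coefE lp1 coef_poly ltn_predL sp0 prednK // -lead_coefE (monicP pm).
- move=> x Bx; rewrite -(h x Bx) -horner_map /= -map_poly_comp /ev2.
  by congr (_.[_]); apply: eq_map_poly => g /=; rewrite pull_ev.
Qed.

End FiniteMaps.

(** * Dimension *)

(** A section makes the linear map onto, so its fibres have codimension exactly [k] and qualify as
    the linear sections that define degrees. *)
Definition split_proj (K : fieldType) n k (M : 'M[K]_(n, k)) := exists L : 'M_(k, n), L *m M = 1%:M.

Lemma split_proj_comp (K : fieldType) n k l (M : 'M[K]_(n, k)) (N : 'M[K]_(k, l)) :
  split_proj M -> split_proj N -> split_proj (M *m N).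
Proof.
by move=> [L LM] [L' LN]; exists (L' *m L); rewrite mulmxA -(mulmxA L') LM mulmx1.
Qed.

Section Dimension.
Variable K : closedFieldType.

Lemma meval_dhomog0 n (f : {mpoly K[n]}) e : (0 < e)%N ->
  (pihomog mdeg e f).@[coords 0] = 0.
Proof.
move=> e0; rewrite mevalE big_seq big1 // => m /(dhomog_mf (pihomogP _ _ _)) me.
have [i mi] : exists i : 'I_n, m i != 0%N.
  apply/existsP/contraT; rewrite negb_exists => /forallP h.
  move: e0; rewrite -me /= mdegE big1 // => i _; apply/eqP; have := h i; by rewrite negbK.
by rewrite (bigD1 i) //= /coords mxE expr0n (negbTE mi) mul0r mulr0.
Qed.

Lemma van_const n (A : vset K n) f : (exists x, A x) -> van A f -> f != 0 -> (1 < msize f)%N.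
Proof.
move=> [x Ax] /(_ x Ax) fx; apply: contraNT; rewrite -leqNgt => /msize1_polyC e.
by move: fx; rewrite e mevalC => ->; rewrite mpolyC0.
Qed.

Lemma finmod_direction k (A : vset K k.+1) f v : (exists x, A x) -> van A f -> f != 0 ->
  (pihomog mdeg (msize f).-1 f).@[coords v] != 0 -> v != 0.
Proof.
move=> neA vf fn0; apply: contraNneq => ->; apply/eqP; apply: meval_dhomog0.
by rewrite -subn1 subn_gt0; apply: van_const vf fn0.
Qed.

Lemma finmod_reduce n k (A : vset K n) (M : 'M[K]_(n, k.+1)) f : (exists x, A x) ->
  finmod A M -> van (img A M) f -> f != 0 ->
  exists N : 'M[K]_(k.+1, k), split_proj N /\ finmod A (M *m N).
Proof.
move=> [x Ax] fA vf fn0; have neA : exists y, img A M y by exists (x *m M), x.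
have [v tv] := mpoly_nonroot (pihomog_top_neq0 fn0).
have [L [tau [N fr]]] := frame_exists (finmod_direction neA vf fn0 tv).
exists N; split; first by exists L; case: fr.
exact: finmod_comp fA (finmod_step fr vf tv).
Qed.

Lemma van_rV0 (A : vset K 0) f : (exists x, A x) -> van A f -> f = 0.
Proof.
move=> [x Ax] /(_ x Ax) fx; have e := nvar0_mpolyC f.
by move: fx; rewrite e mevalC => ->; rewrite mpolyC0.
Qed.

Lemma irr_chain_mono n (Z : nat -> vset K n) k i j :
  irr_chain Z k -> (i <= j)%N -> (j <= k)%N -> subs (Z i) (Z j).
Proof.
move=> [_ h]; elim: j => [|j IH]; first by rewrite leqn0 => /eqP -> _ x.
rewrite leq_eqVlt => /orP[/eqP -> _ x //|ij] jk x /(IH ij (ltnW jk)).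
by apply: (h j jk).1.
Qed.

Lemma irr_chain_img n l (Z : nat -> vset K n) k (M : 'M[K]_(n, l)) :
  irr_chain Z k -> finmod (Z k) M -> irr_chain (fun i => img (Z i) M) k.
Proof.
move=> ch fZ; have [h1 h2] := ch.
have fi i : (i <= k)%N -> finmod (Z i) M.
  by move=> ik; apply: finmod_subs fZ; apply: irr_chain_mono ch ik _.
split=> i ik; first by have [c r] := h1 i ik; split; [apply: closed_img;
  auto|apply: irreducible_img].
have [s ns] := h2 i ik; split; first by move=> _ [x [/s Zx ->]]; exists x.
move=> h; apply: ns; have [ci _] := h1 i (ltnW ik); have [cs rs] := h1 i.+1 ik.
exact: incomparable ci cs rs (fi _ ik) s h.
Qed.

Lemma closed_separate n (A B : vset K n) : closedK A -> ~ subs B A ->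
  exists2 f, van A f & f != 0.
Proof.
move=> cA nBA; apply: Classical_Prop.NNPP => h; apply: nBA => x _; apply: (closedK_mem cA) => f vf.
have [->|fn0] := eqVneq f 0; first by rewrite meval0.
by case: h; exists f.
Qed.

(** The member below the top is a proper closed set, so it lies in a hypersurface and projects
    finitely to a space of one dimension less; by [incomparable] the shortened chain stays
    strict. *)
Lemma irr_chain_bound s (Z : nat -> vset K s) k : irr_chain Z k -> (k <= s)%N.
Proof.
elim: s Z k => [|s IH] Z [|k] // ch; have [h1 h2] := ch.
  have [[x0 Zx] _] := (h1 k (leqnSn k)).2; have [s ns] := h2 k (ltnSn k).
  have [f vf fn0] := closed_separate (h1 k (leqnSn k)).1 ns.
  by rewrite (van_rV0 (ex_intro _ x0 Zx) vf) eqxx in fn0.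
have [ck [ne _]] := h1 k (leqnSn k); have [_ ns] := h2 k (ltnSn k).
have [f vf fn0] := closed_separate ck ns.
have [|N [_ fN]] := finmod_reduce ne (finmod_id (Z k)) _ fn0.
  by move=> _ [x [Zx ->]]; rewrite mulmx1 vf.
rewrite mul1mx in fN; rewrite ltnS; apply: (IH (fun i => img (Z i) N)).
apply: irr_chain_img => //; split=> i ik; first by apply: h1; apply: leqW.
by apply: h2; apply: ltnW.
Qed.

Lemma dim_finmod n k (A : vset K n) (M : 'M[K]_(n, k)) s :
  is_dim A s -> finmod A M -> (s <= k)%N.
Proof.
move=> [[Z [ch ZA]] _] fA; apply: irr_chain_bound (irr_chain_img ch _).
exact: finmod_subs ZA fA.
Qed.

Definition full_space n : vset K n := fun _ => True.

Lemma irreducible_full n : irreducibleK (@full_space n).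
Proof.
split; first by exists 0.
move=> B C cB cC e; apply: Classical_Prop.NNPP => /Classical_Prop.not_or_and[nB nC].
have [f vf fn0] : exists2 f, van B f & f != 0.
  by apply: (closed_separate (B := @full_space n) cB) => h; apply: nB => x; split => // _; apply: h.
have [g vg gn0] : exists2 f, van C f & f != 0.
  by apply: (closed_separate (B := @full_space n) cC) => h; apply: nC => x; split => // _; apply: h.
have /mpoly_nonroot[x] : f * g != 0 by rewrite mulf_neq0.
have [/vf fx|/vg gx] : B x \/ C x by apply/e.
  by rewrite mevalM fx mul0r eqxx.
by rewrite mevalM gx mulr0 eqxx.
Qed.

Lemma finmod_restrict n k l (A : vset K n) (M : 'M[K]_(n, k)) (N : 'M_(k, l)) (L : 'M_(l, k)) :
  finmod A M -> (forall x, A x -> x *m M = x *m M *m N *m L) -> finmod A (M *m N).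
Proof.
move=> [m [w h]] e; exists m, w => f; have [c hc] := h f.
exists (fun i => pull L (c i)) => x Ax; rewrite hc //; apply: eq_bigr => i _.
by rewrite pull_ev mulmxA -e.
Qed.

(** The chain is built downwards by cutting with a coordinate hyperplane of the base. The cut maps
    onto the hyperplane, and a minimal closed subset with this property is irreducible because
    affine space is. *)
Lemma chain_exists s n (V : vset K n) (M : 'M[K]_(n, s)) :
  closedK V -> irreducibleK V -> finmod V M -> (forall y, img V M y) ->
  exists Z, irr_chain Z s /\ Z s = V.
Proof.
elim: s n V M => [|s IH] n V M cV rV fV surj.
  by exists (fun _ => V).
pose V0 := fun x => V x /\ (pull M 'X_ord0).@[coords x] = 0.
have cV0 : closedK V0 := closedI cV (closed_zero _).
have V0y x : V0 x -> (x *m M) 0 0 = 0 by move=> [_]; rewrite pull_ev mevalXU.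
have fr := frame0 K s; pose M' := M *m M0 K s.
have fV0 : finmod V0 M'.
  apply: (finmod_restrict (L := L0 K s)).
    by apply: finmod_subs fV => x [].
  move=> x V0x; rewrite {1}(frame_dec fr (x *m M)).
  have -> : (x *m M *m t0 K s) 0 0 = 0; last by rewrite scale0r add0r.
  have := V0y x V0x; rewrite {1}(frame_dec fr (x *m M)) frame0E.
  by rewrite -[@row_mx _ _ _ _ _ _]/(row_cons _ _) row_cons0.
have s0 y : img V0 M' y.
  have [x [Vx xy]] := surj (y *m L0 K s); exists x; split.
    split=> //; rewrite pull_ev mevalXU -xy -[y *m _]add0r -(scale0r (v0 K s)) frame0E.
    by rewrite -[@row_mx _ _ _ _ _ _]/(row_cons _ _) /coords row_cons0.
  by rewrite mulmxA -xy -mulmxA; have [_ _ _ _ ->] := fr; rewrite mulmx1.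
have [||B [[cB BV0 sB] mB]] := closed_minimal
    (Phi := fun B => [/\ closedK B, subs B V0 & forall y, img B M' y]).
- by exists V0; split.
- by move=> B [].
have fB : finmod B M' := finmod_subs BV0 fV0.
have rB : irreducibleK B.
  split; first by have [x [Bx _]] := sB 0; exists x.
  move=> C D cC cD e.
  have CB : subs C B by move=> x Cx; apply/e; left.
  have DB : subs D B by move=> x Dx; apply/e; right.
  have [h|h] := (irreducible_full s).2 _ _ (closed_img cC (finmod_subs CB fB))
      (closed_img cD (finmod_subs DB fB)) ltac:(move=> y; split => // _;
        have [x [/e [Cx|Dx] ->]] := sB y; [left|right]; by exists x).
    left=> x; split=> [Bx|/CB //]; apply: (mB C) => //; split=> // [z /CB/BV0 //|y].
    by apply/h.
  right=> x; split=> [Bx|/DB //]; apply: (mB D) => //; split=> // [z /DB/BV0 //|y].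
  by apply/h.
have [Z [[h1 h2] ZB]] := IH n B M' cB rB fB sB.
exists (fun i => if (i <= s)%N then Z i else V); split; last by rewrite ltnn.
split=> i; first by move=> _; case: leqP => [/h1|].
rewrite ltnS => is_; rewrite is_; case: ltnP => [/h2 //|si].
have -> : i = s by apply/eqP; rewrite eqn_leq is_.
rewrite ZB; split=> [x /BV0[] //|VB].
(* A point of [V] above (1, 0, ..., 0) is off the hyperplane, so [B] is strictly smaller than
   [V]. *)
have [x [Vx xy]] := surj (row_cons 1 0).
have := V0y x (BV0 _ (VB x Vx)); rewrite -xy row_cons0 => /eqP; by rewrite oner_eq0.
Qed.

Lemma dominant_surjective n k (A : vset K n) (M : 'M[K]_(n, k)) : closedK A -> finmod A M ->
  (forall f, van (img A M) f -> f = 0) -> forall y, img A M y.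
Proof.
move=> cA fA h y; apply: (closedK_mem (closed_img cA fA)) => f /h ->; exact: meval0.
Qed.

Lemma dim_dominant n k (V : vset K n) (M : 'M[K]_(n, k)) : closedK V -> irreducibleK V ->
  finmod V M -> (forall f, van (img V M) f -> f = 0) -> is_dim V k.
Proof.
move=> cV rV fV dom; split.
  have [Z [ch ZV]] := chain_exists cV rV fV (dominant_surjective cV fV dom).
  by exists Z; rewrite ZV; split=> // x.
move=> Z j ch ZV; apply: irr_chain_bound (irr_chain_img ch _).
exact: finmod_subs ZV fV.
Qed.

Lemma is_dim_inj n (A : vset K n) r s : is_dim A r -> is_dim A s -> r = s.
Proof.
move=> [[Z [ch ZA]] b] [[Z' [ch' Z'A]] b']; apply/eqP; rewrite eqn_leq.
by rewrite (b' Z) // (b Z').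
Qed.

Lemma dim_proper_img n k (V : vset K n) (M : 'M[K]_(n, k)) s : closedK V -> irreducibleK V ->
  is_dim V s -> finmod V M -> (s < k)%N -> exists2 f, van (img V M) f & f != 0.
Proof.
move=> cV rV dV fV sk; apply: Classical_Prop.NNPP => h.
have /(is_dim_inj dV) e : is_dim V k.
  apply: (dim_dominant cV rV fV) => f vf; apply/eqP/negPn/negP => fn0.
  by apply: h; exists f.
by rewrite e ltnn in sk.
Qed.

Lemma dim_eq_dominant n (V : vset K n) s (M : 'M[K]_(n, s)) f : closedK V -> irreducibleK V ->
  is_dim V s -> finmod V M -> van (img V M) f -> f = 0.
Proof.
move=> cV rV dV fV vf; apply/eqP/negPn/negP => fn0; have [ne _] := rV.
case: s M dV fV f vf fn0 => [|s] M dV fV f vf fn0.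
  have neI : exists y, img V M y by have [x Vx] := ne; exists (x *m M), x.
  by rewrite (van_rV0 neI vf) eqxx in fn0.
have [N [_ fN]] := finmod_reduce ne fV vf fn0.
by have := dim_finmod dV fN; rewrite ltnn.
Qed.

(** The dimension is the least size of a base admitting a finite projection: a non-zero equation of
    the image would allow a further reduction. *)
Lemma dim_exists n (V : vset K n) : closedK V -> irreducibleK V -> exists s, is_dim V s.
Proof.
move=> cV rV; have [ne _] := rV.
have [s /asbP[M fM] mn] := ex_minnP (ex_intro
  (fun s => asb (exists M : 'M[K]_(n, s), finmod V M)) n
  ltac:(by apply/asbP; exists 1%:M; apply: finmod_id)).
exists s; apply: (dim_dominant cV rV fM) => f vf; apply/eqP/negPn/negP => fn0.
case: s M fM mn f vf fn0 => [|s] M fM mn f vf fn0.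
  have neI : exists y, img V M y by have [x Vx] := ne; exists (x *m M), x.
  by rewrite (van_rV0 neI vf) eqxx in fn0.
have [N [_ fN]] := finmod_reduce ne fM vf fn0.
have /mn : asb (exists M : 'M[K]_(n, s), finmod V M) by apply/asbP; exists (M *m N).
by rewrite ltnn.
Qed.

End Dimension.

(** * Hypersurfaces *)

Section Generic.
Variables (K : fieldType) (n : nat).

Definition generic (G : 'rV[K]_n -> Prop) :=
  exists2 h : {mpoly K[n]}, h != 0 & forall c, h.@[coords c] != 0 -> G c.

Lemma generic_and (G H : 'rV[K]_n -> Prop) : generic G -> generic H -> generic (fun c =>
  G c /\ H c).
Proof.
move=> [g gn0 hg] [h hn0 hh]; exists (g * h); first by rewrite mulf_neq0.
by move=> c; rewrite mevalM mulf_eq0 negb_or => /andP[/hg ? /hh].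
Qed.

Lemma generic_all (T : eqType) (s : seq T) (G : T -> 'rV[K]_n -> Prop) :
  (forall x, x \in s -> generic (G x)) -> generic (fun c => forall x, x \in s -> G x c).
Proof.
elim: s => [|x s IH] h; first by exists 1; rewrite ?oner_neq0.
have [|g gn0 hg] := generic_and (h x (mem_head _ _)) (IH _).
  by move=> y ys; apply: h; rewrite inE ys orbT.
by exists g => // c /hg[h1 h2] y; rewrite inE => /orP[/eqP ->|/h2].
Qed.

End Generic.

Section Ev2.
Variable K : fieldType.

Lemma ev2D k (p q : {poly {mpoly K[k]}}) y t : ev2 (p + q) y t = ev2 p y t + ev2 q y t.
Proof. by rewrite /ev2 rmorphD hornerD. Qed.

Lemma ev2M k (p q : {poly {mpoly K[k]}}) y t : ev2 (p * q) y t = ev2 p y t * ev2 q y t.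
Proof. by rewrite /ev2 rmorphM hornerM. Qed.

Lemma ev2C k (h : {mpoly K[k]}) y t : ev2 h%:P y t = h.@[coords y].
Proof. by rewrite /ev2 map_polyC hornerC. Qed.

Lemma theta_deriv k (v : 'rV[K]_k.+1) L f :
  (theta v L f)^`() = theta v L (\sum_i v 0 i *: mderiv i f).
Proof.
elim/mpoly_ring_ind: f => [c|i|f g hf hg|f g hf hg].
- rewrite thetaC derivC big1 ?rmorph0 // => i _.
  by rewrite mderivC scaler0.
- rewrite thetaX derivD derivC add0r derivM derivC mul0r add0r derivX mulr1.
  rewrite (bigD1 i) //= big1 ?addr0 => [|j ji].
    have -> : mderiv i 'X_i = 1 :> {mpoly K[k.+1]}.
      rewrite mderivX mnm1E eqxx scale1r -mpolyX0; congr 'X_[_].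
      by apply/mnmP => j; rewrite mnmBE subnn mnm0E.
    by rewrite -mul_mpolyC mulr1 thetaC.
  by rewrite mderivX mnm1E eq_sym (negbTE ji) scale0r scaler0.
- rewrite (rmorphD (theta v L)) derivD [X in X + _]hf [X in _ + X]hg.
  rewrite -(rmorphD (theta v L)) -big_split; congr (theta v L _).
  by apply: eq_bigr => i _; rewrite mderivD scalerDr.
- rewrite (rmorphM (theta v L)) derivM [X in X * _ + _]hf [X in _ + _ * X]hg.
  rewrite -[X in X + _ = _](rmorphM (theta v L)).
  rewrite -[X in _ + X = _](rmorphM (theta v L)).
  rewrite -[LHS](rmorphD (theta v L)).
  congr (theta v L _).
  rewrite mulr_suml mulr_sumr -big_split; apply: eq_bigr => i _ /=.
  by rewrite mderivM scalerDr scalerAl scalerAr.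
Qed.

End Ev2.

Section Hypersurfaces.
Variable K : closedFieldType.

Lemma prime_msize n (P : {mpoly K[n]}) : prime_elt P -> (1 < msize P)%N.
Proof.
move=> [Pn0 P1 _]; rewrite ltnNge; apply/negP => /msize1_polyC e; apply: P1.
exists (P@_0%MM)^-1%:MP; rewrite {2}e -mpolyCM mulVf //.
by rewrite -(mpolyC_eq0 n) -e.
Qed.

Lemma prime_theta k (v : 'rV[K]_k.+1) L tau M P :
  frame v L tau M -> prime_elt P -> prime_elt (theta v L P).
Proof.
move=> fr; apply: (@prime_iso {mpoly K[k.+1]} {poly {mpoly K[k]}}
  (theta v L) (unsplit_var tau M)); [exact: thetaK|exact: unsplit_varK].
Qed.

Lemma divides_theta k (v : 'rV[K]_k.+1) L tau M P Q :
  frame v L tau M -> divides (theta v L P) (theta v L Q) -> divides P Q.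
Proof.
move=> fr; exact: (@divides_iso {mpoly K[k.+1]} {poly {mpoly K[k]}}
  (theta v L) (unsplit_var tau M) (thetaK fr) P Q).1.
Qed.

Lemma theta_lead k (v : 'rV[K]_k.+1) L P :
  (pihomog mdeg (msize P).-1 P).@[coords v] != 0 ->
  size (theta v L P) = (msize P).-1.+1 /\
  lead_coef (theta v L P) = ((pihomog mdeg (msize P).-1 P).@[coords v])%:MP.
Proof.
move=> tv; have dle : mdeg_le P 0 (msize P).-1 := @mdeg_le_msize _ _ P.
have pe := theta_top v L dle.
have sp : (size (theta v L P) <= (msize P).-1.+1)%N := wdeg_le_size (wdeg_le_theta (v := v) (L :=
  L) dle).
suff e : size (theta v L P) = (msize P).-1.+1 by rewrite lead_coefE e.
apply/eqP; rewrite eqn_leq sp ltnNge; apply/negP => h.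
by move/eqP: pe; rewrite nth_default // eq_sym mpolyC_eq0; exact/negP.
Qed.

(* The image of V is an irreducible closed set of codimension one, hence its
   vanishing ideal is principal. *)
Lemma img_hypersurface n s (V : vset K n) (Psi : 'M[K]_(n, s.+1)) :
  closedK V -> irreducibleK V -> is_dim V s -> finmod V Psi ->
  exists P, prime_elt P /\ forall f, van (img V Psi) f <-> divides P f.
Proof.
move=> cV rV dV fV; have cW := closed_img cV fV; have rW := irreducible_img Psi cV rV.
have [neW _] := rW.
have [f0 vf0 f0n0] := dim_proper_img cV rV dV fV (ltnSn s).
have [|||P pP vP] := prime_in_ideal (@ufd_mpoly K s.+1) f0n0 vf0.
- exact: van_neq1.
- by move=> a b; apply: vanMl.
- by move=> a b; apply: van_prime.
exists P; split => // f; split=> [vf|]; last exact: van_divides.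
apply: Classical_Prop.NNPP => nPf; have [Pn0 _ _] := pP.
have [v tv] := mpoly_nonroot (pihomog_top_neq0 Pn0).
have [L [tau [M fr]]] := frame_exists (finmod_direction neW vP Pn0 tv).
have [sp _] := theta_lead L tv.
(* If [P] did not divide [f], eliminating the variable along [v] would leave a non-zero polynomial
   on K^s vanishing on a finite image of [V], although that image is dense for dimension reasons. *)
have [||h [x [y [hn0 e]]]] := prime_elimination (prime_theta fr pP) _ (q := theta v L f).
- by rewrite sp ltnS -subn1 subn_gt0; apply: prime_msize.
- by move/(divides_theta fr).
have fM := finmod_comp fV (finmod_step fr vP tv).
apply/negP: hn0; apply/negPn/eqP; apply: dim_eq_dominant cV rV dV fM _.
move=> _ [z [Vz ->]].
rewrite mulmxA; set z' := z *m Psi; have iz : img V Psi z' by exists z.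
have eP g : ev2 (theta v L g) (z' *m M) ((z' *m tau) 0 0) = g.@[coords z'].
  by rewrite theta_ev -(frame_dec fr).
rewrite -(ev2C h _ ((z' *m tau) 0 0)) e ev2D.
rewrite [X in X + _]ev2M [X in _ + X]ev2M [X in _ * X + _]eP [X in _ + _ * X]eP.
by rewrite vP ?vf ?mulr0 ?addr0.
Qed.

(** If all partial derivatives vanished, all exponents would be multiples of p; as coefficients have
    p-th roots in [K], [P] would be a p-th power, which no prime is. *)
Lemma prime_mderiv n (P : {mpoly K[n]}) p : p \in [pchar K] -> prime_elt P ->
  exists i, mderiv i P != 0.
Proof.
move=> pK pP; apply: Classical_Prop.NNPP => H.
have d0 i : mderiv i P = 0.
  by apply/eqP/negPn/negP => h; apply: H; exists i.
have pp : prime p := pcharf_prime pK; have p1 := prime_gt1 pp; have p0 := prime_gt0 pp.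
have dv m i : m \in msupp P -> (p %| m i)%N.
  rewrite mcoeff_msupp => mP; case: (posnP (m i)) => [->//|mi].
  have e : m = (m - U_(i) + U_(i))%MM.
    by rewrite submK // lep1mP -lt0n.
  have := congr1 (mcoeff (m - U_(i))%MM) (d0 i); rewrite mcoeff_deriv -e mcoeff0.
  rewrite mnmBE mnm1E eqxx subn1 prednK // -mulr_natl => /eqP.
  by rewrite mulf_eq0 (negbTE mP) orbF -(dvdn_pcharf pK).
have root c : exists r : K, r ^+ p = c.
  have /closed_rootP[r] : size ('X^p - c%:P) != 1%N.
    by rewrite size_XnsubC // eqSS -lt0n.
  by rewrite rootE !hornerE => /eqP e; exists r; apply/eqP; rewrite -subr_eq0 e.
have [r hr] := choose_fun root.
pose Q := \sum_(m <- msupp P) r P@_m *: 'X_[[multinom m i %/ p | i < n]].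
have pM : p \in [pchar {mpoly K[n]}] := rmorph_pchar (@mpolyC n K) pK.
have PQ : P = Q ^+ p.
  rewrite -(pFrobenius_autE pM) rmorph_sum /= {1}(mpolyE P) !big_seq; apply: eq_bigr => m mP.
  rewrite pFrobenius_autE exprZn hr mpolyXn; congr (_ *: 'X_[_]).
  by apply/mnmP => i; rewrite mulmnE mnmE divnK // dv.
have [Pn0 P1 Pp] := pP.
have : divides P Q.
  have dq j : divides P (Q ^+ j) -> divides P Q.
    by elim: j => [|j IH]; [rewrite expr0 | rewrite exprS => /Pp[]].
  by apply: (dq p); rewrite -PQ; apply: divides_refl.
case=> c Qc; apply: P1; exists (c ^+ p * P ^+ p.-2).
have Pe : P ^+ p = P ^+ p.-2 * P * P by rewrite -!exprSr; congr (_ ^+ _); lia.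
by apply: (mulIf Pn0); rewrite mul1r [LHS]PQ Qc exprMn Pe; ring.
Qed.

Definition nonassoc (n : nat) (ps : seq {mpoly K[n]}) :=
  [/\ uniq ps, forall P, P \in ps -> prime_elt P &
      forall P Q, P \in ps -> Q \in ps -> P != Q -> ~ divides P Q].

Lemma generic_coprime k (v : 'rV[K]_k.+1) L tau M P q :
  frame v L tau M -> prime_elt P -> (pihomog mdeg (msize P).-1 P).@[coords v] != 0 ->
  ~ divides (theta v L P) q ->
  generic (fun c => forall t, ev2 (theta v L P) c t = 0 -> ev2 q c t != 0).
Proof.
move=> fr pP tv nd; have [sp _] := theta_lead L tv.
have [|h [x [y [hn0 e]]]] := prime_elimination (prime_theta fr pP) _ nd.
  by rewrite sp ltnS -subn1 subn_gt0; apply: prime_msize.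
exists h => // c hc t p0; apply: contra_neq hc => q0.
by rewrite -(ev2C h c t) e ev2D !ev2M p0 q0 !mulr0 addr0.
Qed.

(** In a general direction each [P] keeps its full degree and has a non-zero directional derivative.
    Through a general base point the line then meets each hypersurface in simple points only, and no
    point lies on two hypersurfaces. *)
Lemma transversal_line k (ps : seq {mpoly K[k.+1]}) p : p \in [pchar K] -> nonassoc ps ->
  (0 < size ps)%N ->
  exists v L tau M (c : 'rV[K]_k) (rts : seq K), [/\ frame v L tau M, uniq rts,
    size rts = (\sum_(P <- ps) (msize P).-1)%N &
    forall t, t \in rts <-> exists2 P, P \in ps & P.@[coords (t *: v + c *m L)] = 0].
Proof.
move=> pK [us pps na] s0.
pose dir (v : 'rV[K]_k.+1) P := (pihomog mdeg (msize P).-1 P).@[coords v] != 0 /\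
  \sum_i v 0 i *: mderiv i P != 0.
have [h /mpoly_nonroot[v hv] /(_ v hv) {h hv} hd] :
    generic (fun v => forall P, P \in ps -> dir v P).
  apply: generic_all => P /pps pP; have [Pn0 _ _] := pP; apply: generic_and.
    by exists (pihomog mdeg (msize P).-1 P); first exact: pihomog_top_neq0.
  have [i /mpoly_nonroot[x ix]] := prime_mderiv pK pP.
  (* [l] is the gradient of [P] at a point where it does not vanish, as a linear form in [v]: if it
     is non-zero at [v], so is the derivative along [v] as a polynomial. *)
  pose l := \sum_j (mderiv j P).@[coords x] *: 'X_j : {mpoly K[k.+1]}.
  exists l.
    apply: contraNneq ix => l0; have := congr1 (mcoeff U_(i)%MM) l0.
    rewrite mcoeff0 (raddf_sum (mcoeff U_(i)%MM)) (bigD1 i) //= mcoeffZ mcoeffXU eqxx mulr1.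
    rewrite big1 ?addr0 => [->//|j ji]; by rewrite mcoeffZ mcoeffXU (negbTE ji) mulr0.
  move=> v; apply: contraNneq => e.
  have := congr1 (meval (coords x)) e; rewrite meval0 => e2.
  rewrite /l (raddf_sum (meval (coords v))) -[X in _ == X]e2 (raddf_sum (meval (coords x))) /=.
  by apply/eqP; apply: eq_bigr => j _; rewrite !mevalZ mevalXU mulrC.
have vn0 : v != 0.
  case: ps s0 pps hd {us na} => // P ps _ pps hd.
  have [tv _] := hd P (mem_head _ _); have pP := pps P (mem_head _ _).
  apply: contraNneq tv => ->; rewrite meval_dhomog0 //.
  by rewrite -subn1 subn_gt0; apply: prime_msize.
have [L [tau [M fr]]] := frame_exists vn0.
have [h /mpoly_nonroot[c hc] /(_ c hc) {h hc} hc] : generic (fun c =>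
   (forall P, P \in ps -> forall t, ev2 (theta v L P) c t = 0 -> ev2 (theta v L P)^`() c t != 0) /\
   (forall P, P \in ps -> forall Q, Q \in [seq Q <- ps | Q != P] ->
      forall t, ev2 (theta v L P) c t = 0 -> ev2 (theta v L Q) c t != 0)).
  apply: generic_and; apply: generic_all => P Pps; have [tv dv] := hd P Pps; have pP := pps P Pps.
    (* [theta v L P] cannot divide its derivative, which is non-zero and of smaller size. *)
    apply: (generic_coprime fr pP tv) => -[w e].
    have [sp _] := theta_lead L tv.
    have dn0 : (theta v L P)^`() != 0 by rewrite theta_deriv (theta_eq0 _ fr).
    have pn0 : theta v L P != 0 by rewrite -size_poly_gt0 sp.
    have wn0 : w != 0 by apply: contraNneq dn0 => w0; rewrite e w0 mul0r.
    have := lt_size_deriv pn0; rewrite e size_mul // => lt.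
    have natl x y : (0 < x -> 0 < y -> (x + y).-1 < y -> False)%N by lia.
    by apply: natl lt; rewrite size_poly_gt0.
  apply: generic_all => Q; rewrite mem_filter => /andP[QP Qps].
  apply: (generic_coprime fr pP tv) => /(divides_theta fr).
  by apply: na => //; rewrite eq_sym.
case: hc => sep dis.
have rt P : P \in ps -> exists rs : seq K, [/\ uniq rs, size rs = (msize P).-1 &
    forall t, t \in rs <-> P.@[coords (t *: v + c *m L)] = 0].
  move=> Pps; have [tv _] := hd P Pps; have [sp lp] := theta_lead L tv.
  pose q := map_poly (meval (coords c)) (theta v L P).
  have lq : meval (coords c) (lead_coef (theta v L P)) != 0 by rewrite lp mevalC.
  have sq : size q = (msize P).-1.+1 by rewrite size_map_poly_id0 // sp.
  have [rs e] := closed_field_poly_normal q.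
  have ln0 : lead_coef q != 0 by rewrite lead_coef_eq0 -size_poly_gt0 sq.
  have rq t : (t \in rs) = root q t by rewrite e rootZ // root_prod_XsubC.
  exists rs; split.
  - have : separable.separable_poly q.
      rewrite separable.separable_poly.unlock; apply: Pdiv.ClosedField.root_coprimep => t;
        rewrite rootE => /eqP qt.
      by rewrite /q deriv_map; apply: sep Pps t qt.
    by rewrite e (separable.eqp_separable (eqp_scale _ ln0)) separable.separable_prod_XsubC.
  - have := sq; rewrite e size_scale // size_prod_XsubC; by case.
  - by move=> t; rewrite rq rootE -theta_ev; split=> /eqP.
exists v, L, tau, M, c.
suff [rts [h1 h2 h3]] : exists rts : seq K, [/\ uniq rts,
  size rts = (\sum_(P <- ps) (msize P).-1)%N &
    forall t, t \in rts <-> exists2 P, P \in ps & P.@[coords (t *: v + c *m L)] = 0].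
  by exists rts; split.
move: us rt dis {hd sep pps na s0}; elim: ps => [|P ps IH].
  by exists [::]; rewrite big_nil; split => // t; split=> // -[].
rewrite cons_uniq => /andP[Pps us] rt dis.
have [rs [urs srs hrs]] := rt P (mem_head _ _).
have [||rts [h1 h2 h3]] := IH us.
- by move=> Q Qps; apply: rt; rewrite inE Qps orbT.
- move=> Q Qps Q'; rewrite mem_filter => /andP[QQ' Q'ps]; apply: dis.
    by rewrite inE Qps orbT.
  by rewrite mem_filter QQ' inE Q'ps orbT.
exists (rs ++ rts); split.
- rewrite cat_uniq urs h1 /= andbT; apply/hasPn => t /h3[Q Qps Qt].
  apply/negP => /hrs Pt; have hQ : Q \in [seq Q <- P :: ps | Q != P].
    by rewrite mem_filter inE Qps orbT andbT; apply: contraNneq Pps => <-.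
  have /negP := dis P (mem_head _ _) Q hQ t (etrans (theta_ev v L P c t) Pt).
  by apply; apply/eqP; rewrite theta_ev.
- by rewrite size_cat srs h2 big_cons.
- move=> t; rewrite mem_cat; split=> [/orP[/hrs Pt|/h3[Q Qps Qt]]|[Q]].
  + by exists P; rewrite ?mem_head.
  + by exists Q; rewrite // inE Qps orbT.
  + rewrite inE => /orP[/eqP -> /hrs ->//|Qps Qt]; apply/orP; right; apply/h3.
    by exists Q.
Qed.

End Hypersurfaces.

(** * Degree *)

Section Degree.
Variable K : closedFieldType.

(** A fibre of [M] is an affine subspace of codimension [s] with direction [kermx M]. The list [s1]
    only certifies that the section is finite, without which [is_degree] bounds nothing. *)
Lemma section_count n (A : vset K n) s d (M : 'M[K]_(n, s)) y (s0 s1 : seq 'rV[K]_n) :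
  is_dim A s -> is_degree A d -> split_proj M -> uniq s0 ->
  (forall x, x \in s0 -> A x /\ x *m M = y) ->
  (forall x, A x -> x *m M = y -> x \in s1) -> (size s0 <= d)%N.
Proof.
move=> dA [s' [dA' [_ mx]]] [L LM] us0 h0 h1.
have es := is_dim_inj dA' dA; move: es mx => -> mx {dA'}.
have rM : \rank M = s.
  apply/eqP; rewrite eqn_leq rank_leq_col.
  by have h : (\rank (L *m M) <= \rank M)%N := mxrankM_maxr L M; rewrite LM mxrank1 in h.
have [B [fB eB]] : exists B : 'M[K]_(n - s, n), row_free B /\ (B :=: kermx M)%MS.
  have <- : \rank (kermx M) = (n - s)%N by rewrite mxrank_ker rM.
  by exists (row_base (kermx M)); split; [apply: row_base_free | apply: eq_row_base].
have inL x : aff_sub (y *m L) B x <-> x *m M = y.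
  split=> [[u ->]|xM].
    rewrite mulmxDl -(mulmxA y) LM mulmx1.
    have /sub_kermxP -> : (u *m B <= kermx M)%MS by rewrite -eB submxMl.
    by rewrite addr0.
  have : (x - y *m L <= B)%MS.
    by rewrite eB; apply/sub_kermxP; rewrite mulmxBl -(mulmxA y) LM mulmx1 xM subrr.
  by case/submxP => u hu; exists u; rewrite -hu addrC subrK.
pose s2 := undup [seq x <- s1 | asb (A x /\ x *m M = y)].
have in2 x : A x /\ x *m M = y <-> x \in s2.
  rewrite mem_undup mem_filter; split=> [h|/andP[/asbP //]].
  by apply/andP; split; [apply/asbP | case: h => ? ?; apply: h1].
apply: (@leq_trans (size s2)).
  by apply: uniq_leq_size => // x /h0/in2.
apply: (mx (y *m L) B) => //; exists s2; split => //; first exact: undup_uniq.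
by move=> x; rewrite /setIv inL; apply: in2.
Qed.

Lemma degree_gt0 n (V : vset K n) s d : closedK V -> irreducibleK V -> is_dim V s ->
  is_degree V d -> forall M : 'M[K]_(n, s), split_proj M -> finmod V M -> (0 < d)%N.
Proof.
move=> cV rV dV gV M sM fV.
have [x [Vx xM]] : img V M 0.
  by apply: dominant_surjective => // f; apply: dim_eq_dominant dV fV.
have [s1 h1] := finmod_fibre 0 fV.
apply: (section_count (s0 := [:: x]) dV gV sM) h1 => //.
by move=> z; rewrite inE => /eqP ->.
Qed.

Lemma choose_seq (T U : eqType) (R : T -> U -> Prop) (s : seq T) :
  (forall t, t \in s -> exists u, R t u) ->
  exists us, size us = size s /\ forall i t0 u0, (i < size s)%N -> R (nth t0 s i) (nth u0 us i).
Proof.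
elim: s => [|t s IH] h; first by exists [::].
have [u hu] := h t (mem_head _ _).
have [|us [es hs]] := IH; first by move=> t' ts; apply: h; rewrite inE ts orbT.
exists (u :: us); rewrite /= es; split => // -[|i] t0 u0 //=; exact: hs.
Qed.

(** The fibre of [Psi *m M] over [c] is the preimage of a transversal line, hence a finite section
    with at least one point of [A] above each intersection of the line with the hypersurfaces. *)
Lemma degree_hypersurface n (A : vset K n) s d (Psi : 'M[K]_(n, s.+1))
    (ps : seq {mpoly K[s.+1]}) p : p \in [pchar K] ->
  is_dim A s -> is_degree A d -> split_proj Psi -> finmod A Psi -> nonassoc ps ->
  (forall P z, P \in ps -> P.@[coords z] = 0 -> img A Psi z) ->
  (forall z, img A Psi z -> exists2 P, P \in ps & P.@[coords z] = 0) ->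
  (\sum_(P <- ps) (msize P).-1 <= d)%N.
Proof.
move=> pK dA gA sP fA nps sub1 sub2.
have [s0|s0] := posnP (size ps).
  by rewrite (size0nil s0) big_nil.
have [v [L [tau [M [c [rts [fr urts <- hrts]]]]]]] := transversal_line pK nps s0.
have [|xs [sxs hxs]] := @choose_seq K 'rV[K]_n
    (fun t x => A x /\ x *m Psi = t *: v + c *m L) rts.
  move=> t /hrts[P Pps Pt]; have [x [Ax e]] := sub1 P _ Pps Pt.
  by exists x.
rewrite -sxs; have sPM : split_proj (Psi *m M).
  by apply: split_proj_comp => //; exists L; case: fr.
have hx x : x \in xs -> A x /\ exists2 t, t \in rts & x *m Psi = t *: v + c *m L.
  move=> /(nthP 0)[i ix <-]; rewrite sxs in ix; have [h1 h2] := hxs i 0 0 ix.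
  by split => //; exists (rts`_i) => //; apply: mem_nth.
have [fib hfib] : exists s1 : seq 'rV[K]_n,
    forall x, A x -> x *m (Psi *m M) = c -> x \in s1.
  have [S hS] := choose_fun (fun t => finmod_fibre (t *: v + c *m L) fA).
  exists (flatten (map S rts)) => x Ax xc; pose t := (x *m Psi *m tau) 0 0.
  have xt : x *m Psi = t *: v + c *m L by rewrite {1}(frame_dec fr (x *m Psi)) -xc !mulmxA.
  apply/flattenP; exists (S t); last exact: hS.
  apply: map_f; apply/hrts; rewrite -xt; apply: sub2; by exists x.
apply: (section_count dA gA sPM _ _ hfib).
  apply/(uniqP 0) => i j; rewrite !inE sxs => si sj e.
  have [_ hi] := hxs i 0 0 si; have [_ hj] := hxs j 0 0 sj.
  apply/eqP; rewrite -(nth_uniq 0 si sj urts); apply/eqP.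
  by rewrite -(frametau fr rts`_i c) -(frametau fr rts`_j c) -hi -hj e.
move=> x /hx[Ax [t _ e]]; split => //; by rewrite mulmxA e (frameM fr).
Qed.

Definition pure n (A : vset K n) m (Y : 'I_m -> vset K n) s :=
  decomposed A Y /\ forall i, is_dim (Y i) s.

(** Different components may have the same image, so an equation is added only if no associate of it
    is present. *)
Lemma img_hypersurfaces n m (Y : 'I_m -> vset K n) s (Psi : 'M[K]_(n, s.+1)) :
  (forall i, closedK (Y i) /\ irreducibleK (Y i)) -> (forall i, is_dim (Y i) s) ->
  (forall i, finmod (Y i) Psi) ->
  exists ps, [/\ nonassoc ps,
    forall P, P \in ps -> exists i, forall z, P.@[coords z] = 0 -> img (Y i) Psi z &
    forall i, exists2 P, P \in ps & forall z, img (Y i) Psi z -> P.@[coords z] = 0].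
Proof.
elim: m Y => [|m IH] Y cr dY fY; first by exists [::]; split=> //; case.
have [|||ps [[us pps na] h1 h2]] := IH (fun i => Y (lift ord0 i)) => //.
have [c0 r0] := cr ord0.
have [P [pP vP]] := img_hypersurface c0 r0 (dY _) (fY ord0).
have ZP z : P.@[coords z] = 0 -> img (Y ord0) Psi z.
  move=> Pz; apply: (closedK_mem (closed_img c0 (fY ord0))) => f /vP[c ->].
  by rewrite mevalM Pz mulr0.
have vPP : van (img (Y ord0) Psi) P by apply/vP; apply: divides_refl.
case: (excluded_middle_informative (exists2 Q, Q \in ps & divides P Q)) => [[Q Qps PQ]|nQ].
  exists ps; split => //.
    by move=> R /h1[i hi]; exists (lift ord0 i).
  move=> i; case: (unliftP ord0 i) => [j ->|->]; first exact: h2.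
  exists Q => // z /vPP Pz; have [c ->] := PQ; by rewrite mevalM Pz mulr0.
exists (P :: ps); split.
- split.
  + rewrite /= us andbT; apply/negP => Pps; apply: nQ; exists P => //; exact: divides_refl.
  + by move=> Q; rewrite inE => /orP[/eqP ->|/pps].
  + move=> Q R; rewrite !inE => /orP[/eqP ->|Qps] /orP[/eqP ->|Rps]; first by rewrite eqxx.
    - by move=> _ PR; apply: nQ; exists R.
    - move=> _ QP; apply: nQ; exists Q => //; apply: prime_assoc QP => //; exact: pps.
    - exact: na.
- move=> Q; rewrite inE => /orP[/eqP ->|/h1[i hi]]; first by exists ord0.
  by exists (lift ord0 i).
- move=> i; case: (unliftP ord0 i) => [j ->|->]; last by exists P; rewrite ?mem_head.
  by have [Q Qps hQ] := h2 j; exists Q; rewrite // inE Qps orbT.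
Qed.

Lemma finmod_components n k (A : vset K n) m (Y : 'I_m -> vset K n) (M : 'M[K]_(n, k)) :
  decomposed A Y -> finmod A M -> forall i, finmod (Y i) M.
Proof. by move=> [_ e] fA i; apply: finmod_subs fA => x Yx; apply/e; exists i. Qed.

Lemma project_down n k (A : vset K n) (M : 'M[K]_(n, k)) j : (exists x, A x) ->
  finmod A M -> (j <= k)%N ->
  (forall l (N : 'M[K]_(n, l)), (j < l)%N -> finmod A N -> exists2 f, van (img A N) f & f != 0) ->
  exists N : 'M[K]_(k, j), split_proj N /\ finmod A (M *m N).
Proof.
move=> neA; elim: k M => [|k IH] M fM jk H.
  have -> : j = 0%N by apply/eqP; rewrite -leqn0.
  by exists 1%:M; rewrite mulmx1; split => //; exists 1%:M; rewrite mulmx1.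
move: jk; rewrite leq_eqVlt => /orP[/eqP ->|jk].
  by exists 1%:M; rewrite mulmx1; split => //; exists 1%:M; rewrite mulmx1.
have [f vf fn0] := H _ M jk fM.
have [N [sN fN]] := finmod_reduce neA fM vf fn0.
have [N' [sN' fN']] := IH (M *m N) fN jk H.
by exists (N *m N'); rewrite mulmxA; split => //; apply: split_proj_comp.
Qed.

Lemma pure_proper_img n k (A : vset K n) m (Y : 'I_m -> vset K n) s (M : 'M[K]_(n, k)) :
  pure A Y s -> finmod A M -> (s < k)%N -> exists2 f, van (img A M) f & f != 0.
Proof.
move=> [dec dY] fA sk; have fY := finmod_components dec fA; have [cr e] := dec.
have [f hf] : exists f : 'I_m -> {mpoly K[k]}, forall i, van (img (Y i) M) (f i) /\ f i != 0.
  apply: (choose_fun (R := fun i f => van (img (Y i) M) f /\ f != 0)) => i; have [c r] := cr i.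
  by have [f vf fn0] := dim_proper_img c r (dY i) (fY i) sk; exists f.
exists (\prod_i f i).
  move=> _ [x [/e[i Yx] ->]]; rewrite rmorph_prod (bigD1 i) //= (hf i).1 ?mul0r //.
  by exists x.
by apply/prodf_neq0 => i _; apply: (hf i).2.
Qed.

Lemma msize_prod_le n (ps : seq {mpoly K[n]}) :
  (msize (\prod_(P <- ps) P) <= (\sum_(P <- ps) (msize P).-1).+1)%N.
Proof.
apply: msize_mdeg_le.
have h : mdeg_le (\prod_(P <- ps) P) (\sum_(P <- ps) 0) (\sum_(P <- ps) (msize P).-1).
  by apply: mdeg_le_prod => P _; apply: mdeg_le_msize.
by apply: mdeg_leW h _; rewrite leq_add2l.
Qed.

(** After a further projection to K^(s+1) the image is a union of hypersurfaces whose degrees sum to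
    at most [d]; the product of their equations is pulled back. *)
Lemma low_degree_equation n k (A : vset K n) m (Y : 'I_m -> vset K n) s d (M : 'M[K]_(n, k)) p :
  p \in [pchar K] -> (exists x, A x) -> pure A Y s -> is_dim A s -> is_degree A d ->
  split_proj M -> finmod A M -> (s < k)%N ->
  exists f, [/\ f != 0, van (img A M) f & (msize f <= d.+1)%N].
Proof.
move=> pK neA pA dA gA sM fA sk; have [dec dY] := pA; have [cr e] := dec.
have [N [[L LN] fN]] := project_down neA fA sk
  (fun l N (h : (s.+1 < l)%N) fN => pure_proper_img pA fN (ltnW h)).
have sMN : split_proj (M *m N) by apply: split_proj_comp => //; exists L.
have [ps [nps h1 h2]] := img_hypersurfaces cr dY (finmod_components dec fN).
have [us pps _] := nps.
have dps : (\sum_(P <- ps) (msize P).-1 <= d)%N.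
  apply: (degree_hypersurface pK dA gA sMN fN nps).
    move=> P z /h1[i hi] /hi[x [Yx ->]]; exists x; split => //; apply/e; by exists i.
  move=> _ [x [/e[i Yx] ->]]; have [P Pps hP] := h2 i; exists P => //; apply: hP.
  by exists x.
have Pn0 : \prod_(P <- ps) P != 0.
  by rewrite prodf_seq_neq0; apply/allP => P /pps[].
exists (pull N (\prod_(P <- ps) P)); split.
- have [x hx] := mpoly_nonroot Pn0; apply: contraNneq hx => e0.
  by rewrite -[x]mulmx1 -LN mulmxA -pull_ev e0 meval0.
- move=> _ [x [/e[i Yx] ->]]; have [P Pps hP] := h2 i.
  rewrite pull_ev rmorph_prod (big_rem P) //= hP ?mul0r //.
  by exists x; rewrite mulmxA.
- apply: msize_mdeg_le; apply: mdeg_le_pull; apply: mdeg_leW (@mdeg_le_msize _ _ _) _.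
  rewrite !addn0 -ltnS prednK; last by rewrite lt0n msize_poly_eq0.
  by apply: leq_trans (msize_prod_le ps) _.
Qed.

End Degree.

(** * Finite projections with rational directions *)

Section Tower.
Variables (F : finFieldType) (K : closedFieldType) (iota : {rmorphism F -> K}).

Lemma rational_direction k (f : {mpoly K[k]}) : f != 0 -> (msize f <= #|F|)%N ->
  exists v : 'rV[F]_k, f.@[coords (map_mx iota v)] != 0.
Proof.
move=> fn0 sf; have [x hx] := mpoly_nonroot_finite (fmorph_inj iota) fn0 sf.
exists (\row_i x i); apply: contraNneq hx => <-; apply/eqP; congr (meval (coords _) _).
by apply/rowP => i; rewrite !mxE.
Qed.

Lemma msize_pihomog n (f : {mpoly K[n]}) e : (msize (pihomog mdeg e f) <= msize f)%N.
Proof.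
rewrite pihomogE; apply: leq_trans (msize_sum _ _ _) _.
apply/bigmax_leqP_seq => m ms _; apply: leq_trans (msizeZ_le _ _) _.
by rewrite msizeX; apply: msize_mdeg_lt.
Qed.

Lemma pchar_iota : exists p, p \in [pchar K].
Proof. by have [p _ pF] := finPcharP F; exists p; exact: (rmorph_pchar iota pF). Qed.

(* The sections of the A_i by low-degree equations multiply to a polynomial of degree at most
   the sum of the d_i, below #|F|, so its top form is non-zero in some rational direction. *)
Lemma rational_tower n t (A : 'I_t -> vset K n) (s d : 'I_t -> nat) k :
  (0 < t)%N ->
  (forall i, [/\ exists x, A i x, exists m (Y : 'I_m -> vset K n), pure (A i) Y (s i),
     is_dim (A i) (s i) & is_degree (A i) (d i)]) ->
  (\sum_i d i < #|F|)%N -> (forall i, (s i <= k)%N) -> (k <= n)%N ->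
  exists M : 'M[F]_(n, k), split_proj M /\ forall i, finmod (A i) (map_mx iota M).
Proof.
move=> t0 hA dF sk kn; have [p pK] := pchar_iota.
pose j := (n - k)%N; have : k = (n - j)%N by rewrite subKn.
have jn : (j <= n)%N by apply: leq_subr.
move: j jn => j jn e; move: k kn sk e; elim: j jn => [|j IH] jn k kn sk e.
  rewrite subn0 in e; rewrite e; exists 1%:M; split; first by exists 1%:M; rewrite mulmx1.
  by move=> i; rewrite map_mx1; apply: finmod_id.
have ek : (n - j)%N = k.+1 by rewrite e subnSK.
have [|||M [[L' LM] fM]] := IH (ltnW jn) k.+1.
- by rewrite -ek leq_subr.
- by move=> i; apply: leqW.
- by [].
have sM : split_proj (map_mx iota M).
  by exists (map_mx iota L'); rewrite -map_mxM LM map_mx1.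
have [f hf] := fin_all_exists (fun i : 'I_t =>
  let: And4 ne (ex_intro m (ex_intro Y pu)) di de := hA i in
  low_degree_equation pK ne pu di de sM (fM i) (sk i : (s i < k.+1)%N)).
pose g := \prod_i f i.
have gn0 : g != 0 by apply/prodf_neq0 => i _; have [] := hf i.
have vg i : van (img (A i) (map_mx iota M)) g.
  have [_ vf _] := hf i; rewrite /g (bigD1 i) //=; exact: vanMr.
have sg : (msize g <= #|F|)%N.
  apply: leq_trans dF; apply: msize_mdeg_le; rewrite /g.
  have h : mdeg_le (\prod_i f i) (\sum_(i < t) 0) (\sum_i (msize (f i)).-1).
    by apply: mdeg_le_prod => i _; apply: mdeg_le_msize.
  apply: mdeg_leW h _; rewrite leq_add //; apply: leq_sum => i _.
  by have [_ _] := hf i; rewrite -subn1 leq_subLR add1n.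
have [v tv] := rational_direction (pihomog_top_neq0 gn0) (leq_trans (msize_pihomog _ _) sg).
have nei i : exists z, img (A i) (map_mx iota M) z.
  by have [[x Ax] _ _ _] := hA i; exists (x *m map_mx iota M), x.
have vn0 : v != 0.
  pose i0 := Ordinal t0; have := finmod_direction (nei i0) (vg i0) gn0 tv.
  by apply: contraNneq => ->; rewrite map_mx0.
have [L [tau [N fr]]] := frame_exists vn0.
exists (M *m N); split.
  by apply: split_proj_comp; [exists L' | exists L; case: fr].
move=> i; rewrite map_mxM; apply: finmod_comp => //.
exact: finmod_step (map_frame iota fr) (vg i) tv.
Qed.

End Tower.

(** * Common zeros and resultants *)

Section Resultants.
Variable K : closedFieldType.

Lemma det_rows_dvd N (T : 'M[{poly K}]_N) (b : 'I_N -> bool) :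
  (forall i j, b i -> 'X %| T i j) -> 'X^(\sum_i b i) %| \det T.
Proof.
move=> h; rewrite /determinant.
have dS (I : Type) (r : seq I) (G : I -> {poly K}) D : (forall i,
  D %| G i) -> D %| \sum_(i <- r) G i.
  by move=> hG; elim/big_rec: _ => [|i x _ hx]; rewrite ?dvdp0 ?dvdp_add.
apply: (dS) => s; apply: dvdp_mull.
elim/big_rec2: _ => [|i x m _ hx]; first by rewrite expr0 dvd1p.
rewrite exprD dvdp_mul //; case: (boolP (b i)) => [bi|_]; last by rewrite expr0 dvd1p.
by rewrite expr1 h.
Qed.

(** After a change of row basis the rows beyond the rank vanish at [c]; on a line through [c] they
    are divisible by the parameter, and each contributes one factor ['X] to the determinant. *)
Lemma order_det s N (S : 'M[{mpoly K[s]}]_N) (c : 'rV[K]_s) k :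
  (\rank (map_mx (meval (coords c)) S) + k <= N)%N -> order_ge (\det S) c k.
Proof.
set R := map_mx _ S => rk z.
pose T := map_mx (line c z) S.
have -> : line c z (\det S) = \det T by rewrite -det_map_mx.
have T0 : map_mx (horner_eval 0) T = R.
  apply/matrixP => i j; rewrite !mxE /horner_eval line_ev scale0r addr0; by [].
pose C := map_mx (@polyC K) (invmx (col_ebase R)).
have hC : \det T = (\det (col_ebase R))%:P * \det (C *m T).
  have e1 : (\det (col_ebase R))%:P * \det C = 1.
    by rewrite -[_%:P]det_map_mx -det_mulmx -map_mxM mulmxV ?col_ebase_unit // map_mx1 det1.
  by rewrite det_mulmx mulrA e1 mul1r.
rewrite hC; apply: dvdp_mull; pose b (i : 'I_N) := (\rank R <= i)%N.
have hb : (k <= \sum_i b i)%N.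
  apply: leq_trans (_ : (N - \rank R <= _)%N); first by rewrite leq_subRL ?rank_leq_row.
  rewrite /b; move: (\rank R) => r; elim: (N) => [|j IH]; first by rewrite big_ord0.
  have natl u x y : (x - y <= u -> x.+1 - y <= u + (y <= x))%N by lia.
  by rewrite big_ord_recr; apply: natl.
apply: dvdp_trans (dvdp_exp2l _ hb) _; apply: det_rows_dvd => i j bi.
rewrite -['X]subr0 -polyC0 dvdp_XsubCl rootE -[_.[0]]/(horner_eval 0 _).
have -> : horner_eval 0 ((C *m T) i j) = (map_mx (horner_eval 0) (C *m T)) i j by rewrite [RHS]mxE.
rewrite map_mxM T0 /C -map_mx_comp.
have -> : map_mx (horner_eval 0 \o polyC) (invmx (col_ebase R)) = invmx (col_ebase R).
  by apply/matrixP => a d; rewrite mxE /= /horner_eval hornerC.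
rewrite -{2}(mulmx_ebase R) -mulmxA mulKmx ?col_ebase_unit // mxE big1 // => l _.
by rewrite mxE ltnNge -/(b i) bi andbF mul0r.
Qed.

(** The coefficients of the Lagrange interpolation polynomials form a one-sided inverse. *)
Lemma vandermonde_rank N (ts : seq K) : uniq ts -> (size ts <= N)%N ->
  \rank (\matrix_(i < N, j < size ts) ts`_j ^+ i) = size ts.
Proof.
move=> uts sN; apply/eqP; rewrite -mxrank_tr -[_ == _]/(row_free _).
apply/row_freeP; pose h (l : 'I_(size ts)) := \prod_(m < size ts | m != l) ('X - (ts`_m)%:P).
have hl (j l : 'I_(size ts)) : (h l).[ts`_j] != 0 <-> j = l.
  rewrite horner_prod; split=> [|->].
    move/prodf_neq0 => hj; apply/eqP/negPn/negP => /hj.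
    by rewrite !hornerE subrr eqxx.
  apply/prodf_neq0 => m ml; rewrite !hornerE subr_eq0 nth_uniq //.
  by rewrite eq_sym.
have sh l : (size (h l) <= N)%N.
  apply: leq_trans sN; rewrite /h size_prod => [|m _]; last by rewrite polyXsubC_eq0.
  under eq_bigr => m _ do rewrite size_XsubC.
  rewrite sum_nat_const; have := cardC1 l; rewrite card_ord.
  have -> : #|[pred m | m != l]| = #|predC1 l| by apply: eq_card.
  by move=> ->; have := ltn_ord l; lia.
exists (\matrix_(i < N, l < size ts) ((h l).[ts`_l]^-1 *: h l)`_i).
apply/matrixP => j l; rewrite !mxE.
transitivity (((h l).[ts`_l]^-1 *: h l).[ts`_j]).
  rewrite (@horner_coef_wide _ N); last exact: leq_trans (size_scale_leq _ _) (sh l).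
  by apply: eq_bigr => i _; rewrite !mxE mulrC.
rewrite hornerZ; case: eqP => [->|jl]; first by rewrite mulVf //; apply/hl.
have -> : (h l).[ts`_j] = 0; last by rewrite mulr0.
by apply/eqP/negPn/negP => /hl.
Qed.

(* The vectors (t^i)_i, t in ts, are independent and the Sylvester matrix at c kills them, so
   #ts of its rows become divisible by 'X on every line through c after a change of basis. *)
Lemma order_resultant s (p q : {poly {mpoly K[s]}}) (c : 'rV[K]_s) (ts : seq K) :
  uniq ts -> (lead_coef p).@[coords c] != 0 -> (lead_coef q).@[coords c] != 0 ->
  (forall t, t \in ts -> ev2 p c t = 0 /\ ev2 q c t = 0) ->
  order_ge (resultant p q) c (size ts).
Proof.
move=> uts lp lq h; apply: order_det.
set S := Sylvester_mx p q; set N := ((size q).-1 + (size p).-1)%N.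
have sts : (size ts <= N)%N.
  have pn0 : map_poly (meval (coords c)) p != 0.
    by rewrite -lead_coef_eq0 lead_coef_map_eq.
  have : (size ts < size (map_poly (meval (coords c)) p))%N.
    by apply: max_poly_roots pn0 _ uts; apply/allP => t /h[/eqP].
  move=> /leq_trans/(_ (size_poly _ _)); rewrite -/N /N.
  by case: (size p) => // k; rewrite ltnS => /leq_trans; apply; rewrite leq_addl.
pose V := \matrix_(i < N, j < size ts) ts`_j ^+ i.
rewrite -{1}(vandermonde_rank uts sts); apply: mulmx0_rank_max.
apply/matrixP => i j; rewrite [RHS]mxE.
have ev (r : {poly {mpoly K[s]}}) (k : nat) : (size r + k <= N)%N -> ev2 r c ts`_j = 0 ->
    \sum_(l < N) (r`_(l - k) *+ (k <= l)%N).@[coords c] * ts`_j ^+ l = 0.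
  move=> sr e0; transitivity (('X^k * map_poly (meval (coords c)) r).[ts`_j]).
    rewrite (@horner_coef_wide _ N); last first.
      apply: leq_trans (size_polyMleq _ _) _; rewrite size_polyXn /=.
      by apply: leq_trans sr; rewrite addnC leq_add2r; apply: size_poly.
    apply: eq_bigr => l _; congr (_ * _); rewrite coefXnM coef_map /= ltnNge.
    by case: leqP; rewrite ?meval0.
  by rewrite hornerM [X in _ * X]e0 mulr0.
have [t1 t2] := h ts`_j (mem_nth 0 (ltn_ord j)).
rewrite mxE.
have np (x y z : nat) : (y < z -> x + y <= z + x.-1)%N by lia.
case: (splitP i) => i' ei.
  rewrite -[RHS](ev p i' (np _ _ _ (ltn_ord i')) t1); apply: eq_bigr => l _.
  congr (_ * _); last by rewrite mxE.
  rewrite mxE /S Sylvester_mxE; case: splitP => i'' ei';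
    first by have -> : i'' = i' by apply: val_inj; rewrite /= -ei -ei'.
  by have := ltn_ord i'; rewrite -ei ei' ltnNge leq_addr.
have np' : (size q + i' <= N)%N by rewrite /N addnC [X in (_ <= X)%N]addnC addnC; apply: np.
rewrite -[RHS](ev q i' np' t2); apply: eq_bigr => l _.
congr (_ * _); last by rewrite mxE.
rewrite mxE /S Sylvester_mxE; case: splitP => i'' ei'.
  by have := ltn_ord i''; rewrite -ei' ei ltnNge leq_addr.
by have -> : i'' = i' by apply: val_inj; apply/eqP; rewrite -(eqn_add2l (size q).-1) -ei -ei'.
Qed.

(** For every entry of the Sylvester matrix, degree plus column index is at most a weight of the
    row, and the column indices in a term of the determinant have the same sum for all
    permutations. *)
Lemma wdeg_le_resultant s (p q : {poly {mpoly K[s]}}) a b :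
  wdeg_le p a -> wdeg_le q b -> ((size p).-1 <= a)%N -> ((size q).-1 <= b)%N ->
  mdeg_le (resultant p q) 0 (a * b).
Proof.
move=> wp wq; set m1 := (size p).-1; set m2 := (size q).-1 => m1a m2b.
rewrite /resultant /determinant; apply: mdeg_le_sum => sg _.
pose w (i : 'I_(m2 + m1)) := match split i with inl k => (a + k)%N | inr k => (b + k)%N end.
have natl x y z : (z <= y -> x + y <= x + z + (y - z))%N by lia.
have h : mdeg_le (\prod_i Sylvester_mx p q i (sg i)) (\sum_i sg i) (\sum_i w i).
  apply: mdeg_le_prod => i _; rewrite Sylvester_mxE /w; case: split => k.
    case: leqP => kl; last exact: mdeg_le0.
    by apply: (mdeg_leW (wp _)); apply: natl.
  case: leqP => kl; last exact: mdeg_le0.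
  by apply: (mdeg_leW (wq _)); apply: natl.
have {}h : mdeg_le (\prod_i Sylvester_mx p q i (sg i)) 0 (a * b).
  apply: (mdeg_leW h); rewrite addn0.
  have -> : (\sum_(i < m2 + m1) sg i = \sum_(i < m2 + m1) i)%N.
    by rewrite [RHS](reindex_inj (@perm_inj _ sg)).
  rewrite !big_split_ord /= /w.
  have e1 : (\sum_(i < m2) match split (lshift m1 i) with inl k => a + k | inr k => b + k end =
      m2 * a + \sum_(i < m2) i)%N.
    rewrite -[X in (_ = X * _ + _)%N]card_ord -sum_nat_const -big_split /=; apply: eq_bigr => i _.
    by rewrite (unsplitK (inl i)).
  have e2 : (\sum_(i < m1) match split (rshift m2 i) with inl k => a + k | inr k => b + k end =
      m1 * b + \sum_(i < m1) i)%N.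
    rewrite -[X in (_ = X * _ + _)%N]card_ord -sum_nat_const -big_split /=; apply: eq_bigr => i _.
    by rewrite (unsplitK (inr i)).
  have e3 : (\sum_(i < m1) (m2 + i) = m1 * m2 + \sum_(i < m1) i)%N.
    by rewrite big_split /= sum_nat_const card_ord.
  rewrite e1 e2 e3.
  (* The difference of the two sides is the product of [a - m1] and [b - m2]: the bound [a * b] also
     holds when the degrees in the eliminated variable are below the total degrees. *)
  have : (m2 * a + m1 * b <= a * b + m1 * m2)%N.
    have [x ->] : exists x, a = (m1 + x)%N by exists (a - m1)%N; rewrite subnKC.
    have [y ->] : exists y, b = (m2 + y)%N by exists (b - m2)%N; rewrite subnKC.
    nia.
  have natl2 A B C D x y : (A + B <= C + D -> A + x + (B + y) <= C + (x + (D + y)))%N by lia.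
  exact: natl2.
case: (perm.odd_perm sg); rewrite ?expr0 ?mul1r // expr1 mulN1r.
exact: mdeg_leN.
Qed.

End Resultants.

Lemma finmod_refine (K : closedFieldType) n k l (A : vset K n) (Psi : 'M[K]_(n, k)) (N : 'M_(k,
  l)) :
  finmod A (Psi *m N) -> finmod A Psi.
Proof.
move=> [m [w h]]; exists m, w => f; have [c hc] := h f; exists (fun i => pull N (c i)) => x Ax.
by rewrite hc //; apply: eq_bigr => i _; rewrite pull_ev mulmxA.
Qed.

Lemma generic_linear_form (K : fieldType) n (u : 'rV[K]_n) : u != 0 ->
  generic (fun l : 'rV[K]_n => (u *m l^T) 0 0 != 0).
Proof.
move=> un0; pose h : {mpoly K[n]} := \sum_i u 0 i *: 'X_i; exists h.
  apply: contraNneq un0 => h0; apply/eqP/rowP => i; rewrite mxE.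
  have := congr1 (mcoeff U_(i)%MM) h0.
  rewrite mcoeff0 (raddf_sum (mcoeff U_(i)%MM)) (bigD1 i) //= mcoeffZ mcoeffXU eqxx mulr1.
  by rewrite big1 ?addr0 // => j ji; rewrite mcoeffZ mcoeffXU (negbTE ji) mulr0.
move=> l; rewrite /h (raddf_sum (meval (coords l))) /= mxE => hl.
apply: contraNneq hl => e; apply/eqP; rewrite -[RHS]e; apply: eq_bigr => i _.
by rewrite mevalZ mevalXU mxE.
Qed.

(** * Common rational points of two components over one base *)

Section IntersectionCount.
Variables (F : finFieldType) (K : closedFieldType) (iota : {rmorphism F -> K}).
Local Notation "A ^i" := (map_mx iota A) (at level 2, format "A ^i").

(** No degrees of [V1] and [V2] are assumed: for conjugate components only the degree of the whole
    variety is given, so [Psi] and the equations are exported for comparison with it. *)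
Lemma intersection_count n s (V1 V2 : vset K n) (M : 'M[F]_(n, s)) :
  closedK V1 -> irreducibleK V1 -> is_dim V1 s ->
  closedK V2 -> irreducibleK V2 -> is_dim V2 s ->
  split_proj M -> finmod V1 (M^i) -> finmod V2 (M^i) -> ~ subs V1 V2 ->
  exists (Psi : 'M[K]_(n, s.+1)) (P1 P2 : {mpoly K[s.+1]}),
  [/\ split_proj Psi, Psi *m M0 K s = M^i,
      [/\ prime_elt P1, prime_elt P2 & ~ divides P1 P2],
      (forall f, van (img V1 Psi) f <-> divides P1 f) /\
      (forall f, van (img V2 Psi) f <-> divides P2 f) &
      forall S : {set 'rV[F]_n}, (forall a, a \in S -> V1 (a^i) /\ V2 (a^i)) ->
        (#|F| * #|S| <= (msize P1).-1 * (msize P2).-1 * #|F| ^ s)%N].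
Proof.
move=> c1 r1 d1 c2 r2 d2 [L LM] f1 f2 n12.
have [p [V1p V2p]] : exists p, V1 p /\ ~ V2 p.
  apply: Classical_Prop.NNPP => h; apply: n12 => x V1x; apply: Classical_Prop.NNPP => nx.
  by apply: h; exists x.
have [fib hfib] := finmod_fibre (p *m M^i) f2.
(* The form [l] must not vanish on the non-zero rational vectors, so that it separates rational
   points, nor on the differences of [p] with the points of [V2] above the same base point, so that
   the image of [p] stays off that of [V2]. *)
pose us := [seq a^i | a <- enum 'rV[F]_n & a != 0] ++
           [seq p - z | z <- fib & p - z != 0].
have us0 u : u \in us -> u != 0.
  rewrite mem_cat => /orP[] /mapP[z]; rewrite mem_filter => /andP[zn0 _] -> //.
  by rewrite map_mx_eq0.
have [h /mpoly_nonroot[l hl] /(_ l hl) {h hl} hl] :=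
  generic_all (fun u hu => generic_linear_form (us0 u hu)).
pose lT : 'cV[K]_n := l^T.
have ha (a : 'rV[F]_n) : a != 0 -> (a^i *m lT) 0 0 != 0.
  by move=> an0; apply: hl; rewrite mem_cat map_f // mem_filter an0 mem_enum.
have hp z : V2 z -> z *m M^i = p *m M^i -> ((p - z) *m lT) 0 0 != 0.
  move=> V2z e; apply: hl; rewrite mem_cat; apply/orP; right; apply: map_f.
  rewrite mem_filter subr_eq0 (hfib _ V2z e) andbT.
  by apply: contra_notN V2p => /eqP ->.
pose Psi : 'M[K]_(n, s.+1) := @row_mx K n 1 s lT (M^i).
have PM : Psi *m M0 K s = M^i.
  by rewrite /Psi /M0 (@mul_row_col K n 1 s s) mulmx0 mulmx1 add0r.
have Pt : Psi *m t0 K s = lT.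
  by rewrite /Psi /t0 (@mul_row_col K n 1 s 1) mulmx0 mulmx1 addr0.
have Pz (z : 'rV_n) : z *m Psi = row_cons ((z *m lT) 0 0) (z *m M^i).
  by rewrite /Psi [LHS](@mul_mx_row K 1 n 1 s) /row_cons -mx11_scalar.
have fr := frame0 K s.
(* A vector in the kernel of [M] on which the form is non-zero is needed. Since [V2] maps onto the
   base, it has a point above the image of [p], and the difference with [p] is such a vector. *)
have sP : split_proj Psi.
  have [z [V2z zp]] : img V2 (M^i) (p *m M^i).
    by apply: dominant_surjective => // f; apply: dim_eq_dominant d2 f2.
  have := hp z V2z (esym zp); set w := p - z => wl.
  have wM : w *m M^i = 0 by rewrite mulmxBl zp subrr.
  pose e := ((w *m lT) 0 0)^-1.
  have el : e *: w *m lT = 1%:M.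
    by rewrite -scalemxAl [w *m lT]mx11_scalar scale_scalar_mx /e mulVf.
  exists (@col_mx K 1 s n (e *: w) (L^i - (L^i *m lT) *m (e *: w))).
  rewrite /Psi [LHS](@mul_col_row K 1 s n 1 s) el -scalemxAl wM scaler0.
  rewrite !mulmxBl -!mulmxA el mulmx1 subrr -?scalemxAl wM scaler0 !mulmx0 subr0.
  by rewrite -map_mxM LM map_mx1 -(@scalar_mx_block K 1 s).
have fP1 : finmod V1 Psi by apply: (finmod_refine (N := M0 K s)); rewrite PM.
have fP2 : finmod V2 Psi by apply: (finmod_refine (N := M0 K s)); rewrite PM.
have [P1 [pP1 v1]] := img_hypersurface c1 r1 d1 fP1.
have [P2 [pP2 v2]] := img_hypersurface c2 r2 d2 fP2.
have nd : ~ divides P1 P2.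
  move=> P12; have P21 : divides P2 P1 by apply: prime_assoc.
  have : img V2 Psi (p *m Psi).
    apply: (closedK_mem (closed_img c2 fP2)) => f /v2 h2.
    have := (v1 f).2 (divides_trans P12 h2); apply; by exists p.
  move=> [z [V2z e]]; have := hp z V2z; rewrite -PM !mulmxA e => /(_ erefl).
  by rewrite mulmxBl -Pt !mulmxA e subrr mxE eqxx.
(* The form is integral over the base, so the equation divides a monic polynomial in the split
   variable. Its leading coefficient is therefore a unit and vanishes at no [c], as
   [order_resultant] requires. *)
have lead (V : vset K n) P : finmod V (M^i) -> (forall f, van (img V Psi) f <-> divides P f) ->
    divides (lead_coef (theta (v0 K s) (L0 K s) P)) 1.
  move=> fV vP; have [G Gm hG] := finmod_integral (\sum_i lT i 0 *: 'X_i) fV.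
  have : divides P (unsplit_var (t0 K s) (M0 K s) G).
    apply/vP => _ [x [Vx ->]]; rewrite unsplit_var_ev -!mulmxA PM Pt -(hG x Vx).
    congr (ev2 _ _ _); rewrite mxE (raddf_sum (meval (coords x))) /=.
    by apply: eq_bigr => i _; rewrite mevalZ mevalXU mulrC.
  move=> [C e]; have e2 : G = theta (v0 K s) (L0 K s) C * theta (v0 K s) (L0 K s) P.
    rewrite -[LHS](unsplit_varK fr) e; exact: rmorphM.
  exists (lead_coef (theta (v0 K s) (L0 K s) C)).
  by rewrite -lead_coefM -e2 (monicP Gm).
have lead_ev (r : {mpoly K[s]}) (c : 'rV_s) : divides r 1 -> r.@[coords c] != 0.
  case=> w /(congr1 (meval (coords c))); rewrite mevalM meval1 => e.
  by apply: contra_eq_neq e => ->; rewrite mulr0 oner_neq0.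
exists Psi, P1, P2; split => // S hS.
set p1 := theta (v0 K s) (L0 K s) P1; set p2 := theta (v0 K s) (L0 K s) P2.
have w1 : wdeg_le p1 (msize P1).-1 by apply: wdeg_le_theta; apply: mdeg_le_msize.
have w2 : wdeg_le p2 (msize P2).-1 by apply: wdeg_le_theta; apply: mdeg_le_msize.
have natl x y : (x <= y.+1 -> x.-1 <= y)%N by lia.
have sm1 : ((size p1).-1 <= (msize P1).-1)%N.
  exact: natl (wdeg_le_size w1).
have sm2 : ((size p2).-1 <= (msize P2).-1)%N.
  exact: natl (wdeg_le_size w2).
have pp1 : prime_elt p1 := prime_theta fr pP1.
have sp1 : (1 < size p1)%N.
  rewrite ltnNge; apply/negP => h; have [_ p1u _] := pp1; apply: p1u.
  have e : p1 = (lead_coef p1)%:P.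
    by rewrite [LHS]size1_polyC // lead_coefE; case: (size p1) h => [|[]].
  have [w we] : divides (lead_coef p1) 1 := lead V1 P1 f1 v1.
  by exists w%:P; rewrite e -polyCM -we.
have rn0 : resultant p1 p2 != 0.
  by apply: resultant_prime_neq0 => // /(divides_theta fr).
pose N (c : 'rV[F]_s) := #|[set a in S | a *m M == c]|.
have -> : #|S| = (\sum_c N c)%N.
  rewrite -sum1_card (partition_big (fun a : 'rV[F]_n => a *m M) xpredT) //=.
  by apply: eq_bigr => c _; rewrite /N -sum1_card; apply: eq_bigl => a; rewrite inE.
apply: (multiplicity_schwartz_zippel (iota := iota) rn0 (wdeg_le_resultant w1 w2 sm1 sm2)) => c.
pose ts := [seq (a^i *m lT) 0 0 | a <- enum [set a in S | a *m M == c]].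
have -> : N c = size ts by rewrite size_map -cardE.
apply: order_resultant.
- rewrite map_inj_uniq ?enum_uniq // => a b /eqP; rewrite -subr_eq0 => e.
  apply/eqP; rewrite -subr_eq0; apply: contraTT e => /ha.
  by rewrite map_mxB mulmxBl !mxE.
- exact: lead_ev (lead _ _ f1 v1).
- exact: lead_ev (lead _ _ f2 v2).
move=> t /mapP[a]; rewrite mem_enum inE => /andP[aS /eqP <-] ->.
have [V1a V2a] := hS a aS.
rewrite map_mxM; split; apply: etrans (frame0_ev2 _ _ _) _; rewrite -Pz.
  by apply: (v1 P1).2; [apply: divides_refl | exists (a^i)].
by apply: (v2 P2).2; [apply: divides_refl | exists (a^i)].
Qed.

End IntersectionCount.

(** * Frobenius *)

Section Homeomorphism.
Variables (K : closedFieldType) (n : nat).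

Lemma irreducible_eq (A B : vset K n) : set_eq A B -> irreducibleK A -> irreducibleK B.
Proof.
move=> e [[x Ax] irr]; split; first by exists x; apply/e.
move=> C D cC cD BCD; have [|h|h] := irr C D cC cD; first by move=> y; rewrite e BCD.
  by left=> y; rewrite -e h.
by right=> y; rewrite -e h.
Qed.

Lemma is_dim_eq (A B : vset K n) r : set_eq A B -> is_dim A r -> is_dim B r.
Proof.
move=> e [[Z [ch ZA]] mx]; split; first by exists Z; split => // x /ZA/e.
by move=> Z' k ch' ZB; apply: mx ch' _ => x /ZB/e.
Qed.

(** Covers translations and Frobenius; the latter is no isomorphism of varieties, but irreducibility
    and dimension depend only on the closed sets. [A \o g] is the preimage of [A] under [g]. *)
Definition homeo (g g' : 'rV[K]_n -> 'rV[K]_n) :=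
  [/\ cancel g g', cancel g' g, forall A, closedK A -> closedK (A \o g) &
      forall A, closedK A -> closedK (A \o g')].

Lemma homeo_sym g g' : homeo g g' -> homeo g' g.
Proof. by case. Qed.

Lemma irreducible_homeo g g' A : homeo g g' -> irreducibleK A -> irreducibleK (A \o g).
Proof.
move=> [gK g'K cg cg'] [[x Ax] irr]; split; first by exists (g' x); rewrite /= g'K.
move=> B C cB cC e; have [|h|h] := irr _ _ (cg' B cB) (cg' C cC).
- by move=> y; have := e (g' y); rewrite /= g'K.
- by left=> y; have := h (g y); rewrite /= gK.
- by right=> y; have := h (g y); rewrite /= gK.
Qed.

Lemma irr_chain_homeo g g' (Z : nat -> vset K n) k : homeo g g' ->
  irr_chain Z k -> irr_chain (fun i => Z i \o g) k.
Proof.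
move=> hg [h1 h2]; have [gK g'K cg cg'] := hg; split=> i ik.
  by have [ci ri] := h1 i ik; split; [apply: cg | apply: irreducible_homeo hg ri].
have [s ns] := h2 i ik; split; first by move=> x /s.
by move=> h; apply: ns => x Zx; rewrite -[x]g'K; apply: h; rewrite /= g'K.
Qed.

Lemma is_dim_homeo g g' A r : homeo g g' -> is_dim A r -> is_dim (A \o g) r.
Proof.
move=> hg [[Z [ch ZA]] mx]; have [gK g'K _ _] := hg; split.
  by exists (fun i => Z i \o g); split; [apply: irr_chain_homeo hg ch | move=> x /ZA].
move=> Z' k ch' Z'A; apply: (mx _ _ (irr_chain_homeo (homeo_sym hg) ch')).
by move=> x /Z'A; rewrite /= g'K.
Qed.

Definition translate (u : 'rV[K]_n) (f : {mpoly K[n]}) : {mpoly K[n]} :=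
  mmap (@mpolyC n K) (fun i => 'X_i + (u 0 i)%:MP) f.
HB.instance Definition _ u :=
  GRing.RMorphism.copy (translate u) (mmap (@mpolyC n K) (fun i => 'X_i + (u 0 i)%:MP)).

Lemma translate_ev u f x : (translate u f).@[coords x] = f.@[coords (x + u)].
Proof.
have: meval (coords x) \o translate u =1 meval (coords (x + u)); last exact.
apply: rmorph_mpoly_ext => [c|i] /=.
  by rewrite [translate u _]mmapC !mevalC.
by rewrite [translate u _]mmapX mmap1U mevalD !mevalXU mevalC /coords mxE.
Qed.

Lemma closed_translate u (A : vset K n) : closedK A -> closedK (fun x => A (x + u)).
Proof.
move=> cA; apply: closed_intro => x h; apply: (closedK_mem cA) => f vf.
by rewrite -translate_ev; apply: h => y /vf; rewrite translate_ev.
Qed.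

Lemma homeo_shift u : homeo (fun x => x - u) (fun x => x + u).
Proof.
split=> [x|x|A cA|A cA]; rewrite ?subrK ?addrK //; last exact: closed_translate.
exact: (closed_translate (- u) cA).
Qed.

Lemma finmod_shift k u (A : vset K n) (M : 'M[K]_(n, k)) :
  finmod A M -> finmod (shift A u) M.
Proof.
move=> [m [w h]]; exists m, (fun i => translate (- u) (w i)) => f.
have [c hc] := h (translate u f).
have /choose_fun[c' hc'] : forall i, exists d : {mpoly K[k]},
    forall y, d.@[coords y] = (c i).@[coords (y - u *m M)].
  move=> i; exists (mmap (@mpolyC k K) (fun j => 'X_j + ((- (u *m M)) 0 j)%:MP) (c i)) => y.
  have: meval (coords y) \o mmap (@mpolyC k K) (fun j => 'X_j + ((- (u *m M)) 0 j)%:MP)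
    =1 meval (coords (y - u *m M)); last exact.
  apply: rmorph_mpoly_ext => [a|j] /=; first by rewrite [mmap _ _ _]mmapC !mevalC.
  by rewrite [mmap _ _ _]mmapX mmap1U mevalD !mevalXU mevalC /coords [in RHS]mxE.
exists c' => x Ax; have := hc _ Ax; rewrite translate_ev subrK => ->.
by apply: eq_bigr => i _; rewrite hc' translate_ev mulmxBl.
Qed.

End Homeomorphism.

Section Frobenius.
Variables (F : finFieldType) (K : closedFieldType) (iota : {rmorphism F -> K}).

Lemma frobenius_exists : exists phi : {rmorphism K -> K}, forall x, phi x = x ^+ #|F|.
Proof.
have [p pr_p pF] := finPcharP F; have pK : p \in [pchar K] := rmorph_pchar iota pF.
have [e ->] : exists e, #|F| = (p ^ e)%N by eexists; apply: (card_pprimeChar pF).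
elim: e => [|e [phi hphi]].
  by exists (GRing.RMorphism.clone _ _ idfun _) => x; rewrite expn0 expr1.
exists (GRing.RMorphism.clone _ _ (pFrobenius_aut pK \o phi) _) => x.
by rewrite /= pFrobenius_autE hphi -exprM expnSr.
Qed.

Variable n : nat.
Variable phi : {rmorphism K -> K}.
Hypothesis phiE : forall x, phi x = x ^+ #|F|.

Lemma phi_iota a : phi (iota a) = iota a.
Proof. by rewrite phiE -rmorphXn expf_card. Qed.

Lemma phi_fixed x : phi x = x -> exists a, x = iota a.
Proof.
move=> e; have : root (map_poly iota ('X^#|F| - 'X)) x.
  by rewrite rmorphB /= map_polyXn map_polyX rootE !hornerE -phiE e subrr.
rewrite finField_genPoly rmorph_prod rootE horner_prod => /eqP/eqP/prodf_eq0[a _].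
by rewrite rmorphB /= map_polyX map_polyC !hornerE subr_eq0 => /eqP ->; exists a.
Qed.

Lemma psi_exists : exists psi : K -> K, cancel phi psi /\ cancel psi phi.
Proof.
have q0 : (0 < #|F|)%N by apply/card_gt0P; exists 0.
have [psi h] : exists psi : K -> K, forall x, phi (psi x) = x.
  apply: (choose_fun (R := fun x y => phi y = x)) => c.
  have /closed_rootP[r] : size ('X^#|F| - c%:P) != 1%N.
    by rewrite size_XnsubC // eqSS -lt0n.
  by rewrite rootE !hornerE -phiE subr_eq0 => /eqP; exists r.
exists psi; split => // x; apply: (fmorph_inj phi); exact: h.
Qed.

Lemma artin_schreier c : exists a, phi a = a + c.
Proof.
have q1 : (1 < #|F|)%N := finNzRing_gt1 F.
have s : size ('X + c%:P : {poly K}) = 2 by rewrite size_XaddC.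
have /closed_rootP[r] : size ('X^#|F| - ('X + c%:P)) != 1%N.
  by rewrite size_polyDl size_polyXn ?size_polyN ?s // eqSS -lt0n ltnW.
by rewrite rootE !hornerE -phiE subr_eq0 => /eqP; exists r.
Qed.

Variable psi : K -> K.
Hypotheses (phiK : cancel phi psi) (psiK : cancel psi phi).

Definition Phi (x : 'rV[K]_n) : 'rV[K]_n := map_mx phi x.
Definition Psi (x : 'rV[K]_n) : 'rV[K]_n := map_mx psi x.

Lemma PhiK : cancel Phi Psi.
Proof. by move=> x; apply/rowP => i; rewrite !mxE phiK. Qed.

Lemma PsiK : cancel Psi Phi.
Proof. by move=> x; apply/rowP => i; rewrite !mxE psiK. Qed.

Lemma twist_ev f x : (map_mpoly phi f).@[coords (Phi x)] = phi f.@[coords x].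
Proof.
have: meval (coords (Phi x)) \o map_mpoly phi =1 phi \o meval (coords x); last exact.
apply: rmorph_mpoly_ext => [c|i] /=; first by rewrite map_mpolyC !mevalC.
by rewrite map_mpolyX !mevalXU /coords mxE.
Qed.

(** Composed with Frobenius, [f] is again a polynomial, in the q-th powers of the variables. For the
    inverse map, the coefficients of [f] are twisted by [phi], which changes values only by an
    injective map. *)
Lemma homeo_Phi : homeo Phi Psi.
Proof.
split; [exact: PhiK | exact: PsiK | |]; move=> A cA; apply: closed_intro => x h.
  apply: (closedK_mem cA) => f vf.
  pose g := f \mPo [tuple 'X_i ^+ #|F| | i < n].
  have ge y : g.@[coords y] = f.@[coords (Phi y)].
    rewrite comp_mpoly_meval; apply: meval_eq => i.
    by rewrite tnth_mktuple rmorphXn /= mevalXU /coords mxE phiE.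
  by rewrite -ge; apply: h => y Ay; rewrite ge vf.
apply: (closedK_mem cA) => f vf; apply: (fmorph_inj phi); rewrite rmorph0 -twist_ev PsiK.
by apply: h => y Ay; rewrite -[y]PsiK twist_ev vf // rmorph0.
Qed.

Definition rational_van (B : vset K n) (Q : {mpoly F[n]}) := van B (map_mpoly iota Q).

(* Scale the leading coefficient of f to 1: then phi f - f has fewer terms, and solving
   phi b = b + a for its coefficients a corrects f to a Frobenius-fixed polynomial. *)
Lemma rational_span (B : vset K n) f : (forall x, B x -> B (Psi x)) -> van B f ->
  exists N (c : 'I_N -> K) (g : 'I_N -> {mpoly F[n]}),
    (forall i, rational_van B (g i)) /\ f = \sum_i c i *: map_mpoly iota (g i).
Proof.
move=> stB; have [k sk] := ubnP (size (msupp f)).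
elim: k f sk => // k IH f sk vf.
have [->|fn0] := eqVneq f 0.
  by exists 0%N, (fun _ => 0), (fun _ => 0); split; [case | rewrite big_ord0].
set m0 := mlead f; set c := f@_m0.
have cn0 : c != 0 by rewrite mleadc_eq0.
pose f1 := c^-1 *: f; pose f2 := map_mpoly phi f1 - f1.
have vf1 : van B f1 by move=> x Bx; rewrite mevalZ vf // mulr0.
have vf2 : van B f2.
  by move=> x Bx; rewrite mevalB vf1 // subr0 -[x]PsiK twist_ev vf1 ?rmorph0 //; apply: stB.
have cf2 m : f2@_m = phi (f1@_m) - f1@_m by rewrite mcoeffB mcoeff_map_mpoly.
have sf2 : (size (msupp f2) < k)%N.
  rewrite ltnS in sk; apply: leq_trans sk; apply: (@uniq_leq_size _ (m0 :: msupp f2)).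
    rewrite /= msupp_uniq andbT -mcoeff_eq0 cf2 mcoeffZ -/c mulVf // rmorph1 subrr.
    exact: eqxx.
  move=> m; rewrite inE => /orP[/eqP ->|]; first exact: mlead_supp.
  rewrite !mcoeff_msupp cf2 mcoeffZ; apply: contraNneq => ->.
  by rewrite mulr0 rmorph0 subrr.
have [N [a [g [vg e2]]]] := IH f2 sf2 vf2.
have [b hb] := fin_all_exists (fun i => artin_schreier (a i)).
pose h := f1 - \sum_i b i *: map_mpoly iota (g i).
have hh m : phi h@_m = h@_m.
  have e3 : map_mpoly phi h = h.
    rewrite /h rmorphB rmorph_sum /=.
    rewrite (eq_bigr (fun i => b i *: map_mpoly iota (g i) + a i *: map_mpoly iota (g i)));
      last first.
      move=> i _; rewrite map_mpolyZ hb scalerDl; congr (_ *: _ + _ *: _);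
      by apply/mpolyP => m'; rewrite !mcoeff_map_mpoly /= phi_iota.
    by rewrite big_split /= -e2 /f2; ring.
  by rewrite -{2}e3 mcoeff_map_mpoly.
have [s hs] := choose_fun (fun m => phi_fixed (hh m)).
pose h0 : {mpoly F[n]} := \sum_(m <- msupp h) s m *: 'X_[m].
have h0E : map_mpoly iota h0 = h.
  rewrite rmorph_sum [RHS]mpolyE; apply: eq_bigr => m _ /=.
  by rewrite map_mpolyZ map_mpolyX -hs.
have vh : van B h.
  move=> x Bx; rewrite mevalB vf1 // (raddf_sum (meval (coords x))) big1 ?subr0 // => i _ /=.
  by rewrite mevalZ vg // mulr0.
exists N.+1, (fun i => if unlift ord0 i is Some j then c * b j else c),
  (fun i => if unlift ord0 i is Some j then g j else h0); split.
  by move=> i; case: unliftP => [j _|_]; [apply: vg | rewrite /rational_van h0E].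
rewrite big_ord_recl unlift_none h0E.
under eq_bigr => i _ do rewrite liftK -scalerA.
rewrite -scaler_sumr -scalerDr /h subrK /f1 scalerA mulfV // scale1r.
by [].
Qed.

Lemma Fq_variety_mem (B : vset K n) x : Fq_variety iota B ->
  (forall Q, rational_van B Q -> (map_mpoly iota Q).@[coords x] = 0) -> B x.
Proof.
move=> [S hS] h; apply/hS => _ [Q [SQ ->]]; apply: h => y /hS; apply; by exists Q.
Qed.

Lemma Fq_variety_intro (B : vset K n) :
  (forall x, (forall Q, rational_van B Q -> (map_mpoly iota Q).@[coords x] = 0) -> B x) ->
  Fq_variety iota B.
Proof.
move=> h; exists (rational_van B) => x; split=> [Bx _ [Q [vQ ->]]|hx]; first exact: vQ.
by apply: h => Q vQ; apply: hx; exists Q.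
Qed.

Lemma Fq_variety_closed (B : vset K n) : Fq_variety iota B -> closedK B.
Proof. by move=> [S hS]; exists (fun P => exists Q, S Q /\ P = map_mpoly iota Q). Qed.

(** Descent: every polynomial vanishing on a set stable under inverse Frobenius is a combination of
    rational ones that vanish on it. *)
Lemma stable_Fq_variety (B : vset K n) : closedK B -> (forall x, B x -> B (Psi x)) ->
  Fq_variety iota B.
Proof.
move=> cB stB; apply: Fq_variety_intro => x h; apply: (closedK_mem cB) => f vf.
have [N [c [g [vg ->]]]] := rational_span stB vf.
rewrite (raddf_sum (meval (coords x))) big1 // => i _ /=.
by rewrite mevalZ h ?mulr0.
Qed.

Lemma Fq_varietyU (B C : vset K n) : Fq_variety iota B -> Fq_variety iota C ->
  Fq_variety iota (setUv B C).
Proof.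
move=> vB vC; apply: Fq_variety_intro => x h; apply: Classical_Prop.NNPP => nx.
have [nB nC] := Classical_Prop.not_or_and _ _ nx.
have sep (D : vset K n) : Fq_variety iota D -> ~ D x ->
    exists2 Q, rational_van D Q & (map_mpoly iota Q).@[coords x] <> 0.
  move=> vD nD; apply: Classical_Prop.NNPP => H; apply: nD; apply: Fq_variety_mem => // Q hQ.
  by apply: Classical_Prop.NNPP => H2; apply: H; exists Q.
have [Q vQ Qx] := sep B vB nB; have [R vR Rx] := sep C vC nC.
have ev y : (map_mpoly iota (Q * R)).@[coords y] =
    (map_mpoly iota Q).@[coords y] * (map_mpoly iota R).@[coords y].
  by rewrite -mevalM -[in RHS]rmorphM.
have /eqP : (map_mpoly iota (Q * R)).@[coords x] = 0.
  by apply: h => y [By|Cy]; rewrite ev; [rewrite vQ ?mul0r | rewrite vR ?mulr0].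
by rewrite ev mulf_eq0 => /orP[] /eqP.
Qed.

Definition rational_closure (B : vset K n) : vset K n :=
  fun x => forall Q, rational_van B Q -> (map_mpoly iota Q).@[coords x] = 0.

Lemma rational_closure_variety B : Fq_variety iota (rational_closure B).
Proof. by apply: Fq_variety_intro => x h Q vQ; apply: h => y; apply. Qed.

Lemma Fq_empty : Fq_variety iota (fun _ : 'rV[K]_n => False).
Proof.
apply: Fq_variety_intro => x /(_ 1) h; have /eqP := h ltac:(by []).
by rewrite rmorph1 meval1 oner_eq0.
Qed.

Lemma Fq_irreducible_bigU (A : vset K n) m (C : 'I_m -> vset K n) : Fq_irreducible iota A ->
  (forall i, Fq_variety iota (C i)) -> set_eq A (fun x => exists i, C i x) ->
  exists i, set_eq A (C i).
Proof.
move=> [_ [[x0 Ax0] irr]]; elim: m C => [|m IH] C vC e.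
  by have /e[[]] := Ax0.
have vU : Fq_variety iota (fun x => exists i, C (lift ord0 i) x).
  elim: m {IH e} C vC => [|m IH] C vC.
    apply: Fq_variety_intro => x h; exfalso; apply: (Fq_variety_mem (x := x) Fq_empty) => Q _.
    by apply: h => y [[]].
  apply: Fq_variety_intro => x h.
  have hU := Fq_varietyU (vC (lift ord0 ord0)) (IH (fun i => C (lift ord0 i)) (fun i => vC _)).
  have [|xi|[i xi]] := Fq_variety_mem (x := x) hU; last 2 first.
  - by exists ord0.
  - by exists (lift ord0 i).
  move=> Q vQ; apply: h => y [i yi]; apply: vQ.
  by case: (unliftP ord0 i) yi => [j ->|->] yi; [right; exists j | left].
have [|h|h] := irr _ _ (vC ord0) vU.
- move=> x; rewrite e; split=> [[i xi]|[xi|[i xi]]].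
  + by case: (unliftP ord0 i) xi => [j ->|->] xi; [right; exists j | left].
  + by exists ord0.
  + by exists (lift ord0 i).
- by exists ord0.
- by have [i hi] := IH (fun i => C (lift ord0 i)) (fun i => vC _) h; exists (lift ord0 i).
Qed.

Definition twist k (Z : vset K n) : vset K n := fun x => Z (iter k Phi x).

Lemma twistP k Z : [/\ closedK Z -> closedK (twist k Z),
  irreducibleK Z -> irreducibleK (twist k Z) & forall s, is_dim Z s -> is_dim (twist k Z) s].
Proof.
elim: k Z => [|k IH] Z; first by [].
have [h1 h2 h3] := IH (Z \o Phi); have [_ _ cP _] := homeo_Phi.
split=> [/cP/h1 //|/(irreducible_homeo homeo_Phi)/h2 //|s /(is_dim_homeo homeo_Phi)/h3 //].
Qed.

(** By irreducibility over [F] some component [Z] has rational closure [A]. Frobenius permutes the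
    components, and the union of the orbit of [Z] is an Fq-variety containing [Z], hence all of [A].
    So all components are twists of [Z], of the same dimension, and a rational point, being fixed,
    lies on all or none. *)
Lemma galois_decomposition (A : vset K n) : Fq_irreducible iota A ->
  exists m (Y : 'I_m -> vset K n) s, [/\ pure A Y s, is_dim A s,
    forall i j, subs (Y i) (Y j) -> i = j &
    forall a : 'rV[F]_n, A (map_mx iota a) -> forall i, Y i (map_mx iota a)].
Proof.
move=> iA; have [vA [[x0 Ax0] _]] := iA.
have [m [Y [dec irrd]]] := irredundant_decomposition (Fq_variety_closed vA).
have [cr eA] := dec.
have YA i : subs (Y i) A by move=> x Yx; apply/eA; exists i.
have [|j hj] := Fq_irreducible_bigU iA (fun i => rational_closure_variety (Y i)).
  move=> x; split=> [/eA[i Yx]|[i h]]; first by exists i => Q; apply.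
  by apply: Fq_variety_mem vA _ => Q vQ; apply: h => y /YA/vQ.
set Z := Y j; have [cZ rZ] := cr j.
have AP x : A x <-> A (Phi x).
  have mA Q y : (map_mpoly iota Q).@[coords (Phi y)] = phi (map_mpoly iota Q).@[coords y].
    rewrite -twist_ev; congr (meval _ _).
    by apply/mpolyP => m'; rewrite !mcoeff_map_mpoly /= phi_iota.
  split=> h; apply: Fq_variety_mem vA _ => Q vQ; first by rewrite mA vQ // rmorph0.
  by apply: (fmorph_inj phi); rewrite rmorph0 -mA vQ.
have AtP k x : A (iter k Phi x) <-> A x.
  by elim: k => //= k IH; rewrite -AP.
have step i : exists i', set_eq (Y i') (Y i \o Phi).
  have [ci ri] := cr i; have hP := homeo_Phi; have [_ _ cP cP'] := hP.
  (* The preimage of [Y i] under [Phi] lies in some [Y i'], whose preimage under [Psi] lies in some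
     [Y l]; irredundancy gives [i = l] and turns the inclusions into equalities. *)
  have [|i' _ hi'] := irreducible_bigU (P := fun _ => True) (irreducible_homeo hP ri)
    (cP _ ci) (fun k => (cr k).1).
    by move=> x /(YA i) h; have [k Yx] := (eA x).1 ((AP x).2 h); exists k.
  have [|l _ hl] := irreducible_bigU (P := fun _ => True)
    (irreducible_homeo (homeo_sym hP) (cr i').2) (cP' _ (cr i').1) (fun k => (cr k).1).
    by move=> x /(YA i')/(AP (Psi x)); rewrite PsiK => /eA[k Yx]; exists k.
  have il : i = l.
    by apply: irrd => x Yx; apply: hl; apply: hi'; rewrite /= PsiK.
  exists i' => x; split; last exact: hi'.
  by move=> Yx; rewrite /= il; apply: hl; rewrite /= PhiK.
have orb k : exists i, set_eq (Y i) (twist k Z).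
  elim: k => [|k [i hi]]; first by exists j.
  have [i' hi'] := step i; exists i' => x.
  by rewrite hi' /= hi /twist iterSr.
pose B : vset K n := fun x => exists2 i, (exists k, set_eq (Y i) (twist k Z)) & Y i x.
have cB : closedK B by apply: closed_bigU => i; have [] := cr i.
have vB : Fq_variety iota B.
  apply: stable_Fq_variety cB _ => x [i [k hi] Yx].
  have [i' hi'] := orb k.+1; exists i'; first by exists k.+1.
  by apply/hi'; rewrite /twist iterSr PsiK; apply/hi.
have AB : subs A B.
  move=> x /hj h; apply: Fq_variety_mem vB _ => Q vQ; apply: h => y Zy; apply: vQ.
  by exists j => //; exists 0%N.
have tw i : exists k, set_eq (Y i) (twist k Z).
  have [ci ri] := cr i; have [|l Pl il] := irreducible_bigU ri ci (fun k =>
    (cr k).1) (P := fun i => exists k, set_eq (Y i) (twist k Z)).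
    by move=> x /YA/AB.
  by rewrite (irrd i l il).
have [s ds] := dim_exists cZ rZ.
have dY i : is_dim (Y i) s.
  have [k hk] := tw i; have [_ _ h] := twistP k Z.
  by apply: is_dim_eq (h s ds) => x; rewrite hk.
exists m, Y, s; split => //.
  split; first by have [[C [chC CZ]] _] := ds; exists C; split => // x /CZ/YA.
  move=> C k chC CA; have [cC rC] := chC.1 k (leqnn k).
  have [|i _ Ci] := irreducible_bigU (P := fun _ => True) rC cC (fun k => (cr k).1).
    by move=> x /CA/eA[i Yx]; exists i.
  exact: (dY i).2 chC Ci.
have fixa (a : 'rV[F]_n) k : iter k Phi (map_mx iota a) = map_mx iota a.
  elim: k => //= k ->; apply/rowP => i; rewrite !mxE; exact: phi_iota.
move=> a /eA[i Yia] l; have [k hk] := tw i; have [k' hk'] := tw l.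
by apply/hk'; rewrite /twist fixa -(fixa a k); apply/hk.
Qed.

End Frobenius.

(** * Rational points *)

Section Counts.
Variables (F : finFieldType) (K : closedFieldType) (iota : {rmorphism F -> K}) (n : nat).
Local Notation "M ^i" := (map_mx iota M) (at level 2, format "M ^i") : ring_scope.

Lemma map_split_proj k (M : 'M[F]_(n, k)) : split_proj M -> split_proj M^i.
Proof. by move=> [L LM]; exists L^i; rewrite -map_mxM LM map_mx1. Qed.

Lemma Fq_pointsP (A : vset K n) a : reflect (A a^i) (a \in Fq_points iota A).
Proof. by rewrite inE; apply: asbP. Qed.

Lemma rational_tower1 (A : vset K n) e : Fq_irreducible iota A -> is_degree A e ->
  (e < #|F|)%N ->
  exists m (Y : 'I_m -> vset K n) s (M : 'M[F]_(n, s)), [/\ pure A Y s, is_dim A s,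
    (forall i j, subs (Y i) (Y j) -> i = j) /\ (forall a, A a^i -> forall i, Y i a^i),
    split_proj M & finmod A M^i].
Proof.
move=> iA gA eF; have [phi phiE] := frobenius_exists iota.
have [psi [phiK psiK]] := psi_exists phiE.
have [m [Y [s [pY dA irr rat]]]] := galois_decomposition phiE phiK psiK iA.
have sn : (s <= n)%N by have [[Z [ch _]] _] := dA; apply: irr_chain_bound ch.
have [||||M [sM fM]] := rational_tower iota (t := 1) (A := fun _ => A) (s := fun _ => s)
    (d := fun _ => e) (k := s) _ _ _ _ sn => //.
- by move=> _; split=> //; [have [_ []] := iA | exists m, Y].
- by rewrite big_ord1.
by exists m, Y, s, M; split=> //; apply: (fM ord0).
Qed.

(** Each of the q^s rational base points has at most [e] points of [A] above it, because the fibre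
    is a finite linear section. *)
Lemma card_Fq_points (A : vset K n) s e (M : 'M[F]_(n, s)) : is_dim A s -> is_degree A e ->
  split_proj M -> finmod A M^i -> (#|Fq_points iota A| <= e * #|F| ^ s)%N.
Proof.
move=> dA gA sM fA; rewrite -sum1_card (partition_big (fun a => a *m M) xpredT) //=.
have -> : (e * #|F| ^ s = \sum_(y : 'rV[F]_s) e)%N.
  by rewrite sum_nat_const card_mx mul1n mulnC.
apply: leq_sum => y _; rewrite sum1_card.
set S := (X in (#|X| <= _)%N); have [s1 hs1] := finmod_fibre y^i fA.
rewrite cardE -(size_map (map_mx iota)).
apply: (section_count dA gA (map_split_proj sM) _ _ hs1).
  by rewrite map_inj_uniq ?enum_uniq //; apply: map_mx_inj.
move=> _ /mapP[a + ->]; rewrite mem_enum => /andP[/Fq_pointsP Aa /eqP <-].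
by rewrite map_mxM.
Qed.

Lemma prime_img_degree (V : vset K n) s e (Psi : 'M[K]_(n, s.+1)) P :
  closedK V -> is_dim V s -> is_degree V e -> split_proj Psi -> finmod V Psi ->
  prime_elt P -> (forall f, van (img V Psi) f <-> divides P f) -> ((msize P).-1 <= e)%N.
Proof.
move=> cV dV gV sP fV pP vP; have [p pK] := pchar_iota iota.
have nP : nonassoc [:: P].
  split=> // [Q|Q R]; rewrite !inE => /eqP -> // /eqP ->; by rewrite eqxx.
have := degree_hypersurface pK dV gV sP fV nP; rewrite big_seq1; apply.
- move=> Q z; rewrite inE => /eqP -> Pz.
  apply: (closedK_mem (closed_img cV fV)) => f /vP[c ->].
  by rewrite mevalM Pz mulr0.
move=> z hz; exists P; rewrite ?inE ?eqxx //.
by apply: (vP P).2 hz; apply: divides_refl.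
Qed.

Lemma card_intersection (V1 V2 : vset K n) s e1 e2 (M : 'M[F]_(n, s)) :
  closedK V1 -> irreducibleK V1 -> is_dim V1 s -> is_degree V1 e1 ->
  closedK V2 -> irreducibleK V2 -> is_dim V2 s -> is_degree V2 e2 ->
  split_proj M -> finmod V1 M^i -> finmod V2 M^i -> ~ set_eq V1 V2 ->
  (#|F| * #|Fq_points iota V1 :&: Fq_points iota V2| <= e1 * e2 * #|F| ^ s)%N.
Proof.
move=> c1 r1 d1 g1 c2 r2 d2 g2 sM f1 f2 ne.
have n12 : ~ subs V1 V2.
  move=> h; apply: ne => x; split; first exact: h.
  have sur (V : vset K n) : closedK V -> irreducibleK V -> is_dim V s -> finmod V M^i ->
      forall y, img V M^i y.
    by move=> cV rV dV fV; apply: (dominant_surjective cV fV) => f;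
      apply: (dim_eq_dominant cV rV dV fV).
  by apply: (incomparable c1 c2 r2 f2 h) => y _; apply: sur.
have [Psi [P1 [P2 [sPsi eM [p1 p2 _] [v1 v2] hS]]]] :=
  intersection_count c1 r1 d1 c2 r2 d2 sM f1 f2 n12.
have fin (V : vset K n) : finmod V M^i -> finmod V Psi by rewrite -eM; apply: finmod_refine.
apply: leq_trans (hS _ _) _.
  by move=> a; rewrite inE => /andP[/Fq_pointsP ? /Fq_pointsP ?].
rewrite leq_mul2r leq_mul ?orbT //.
  exact: prime_img_degree c1 d1 g1 sPsi (fin _ f1) p1 v1.
exact: prime_img_degree c2 d2 g2 sPsi (fin _ f2) p2 v2.
Qed.

(* A reducible Fq-irreducible variety has at least two conjugate components, all its rational
   points lie on both, and their degrees add up. *)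
Lemma card_reducible (A : vset K n) s e : Fq_irreducible iota A -> ~ irreducibleK A ->
  is_dim A s -> is_degree A e -> (e < #|F|)%N ->
  (1 < e)%N /\ (4 * #|F| * #|Fq_points iota A| <= e ^ 2 * #|F| ^ s)%N.
Proof.
move=> iA nA dA gA eF.
have [m [Y [s' [M [[[cr eA] dY] dA' [irr rat] sM fM]]]]] := rational_tower1 iA gA eF.
have es := is_dim_inj dA' dA; move: M dY sM fM; rewrite es => M dY sM fM {s' es dA'}.
have [j0 [j1 j01]] : exists j0 j1 : 'I_m, j0 != j1.
  move: cr eA; clear irr rat dY; move: Y; case: m => [|[|m]] Y cr eA.
  - by have [_ [[x Ax] _]] := iA; have [[]] := (eA x).1 Ax.
  - case: nA; apply: irreducible_eq (cr ord0).2 => x; rewrite eA.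
    by split=> [|[i]]; [exists ord0 | rewrite ord1].
  - by exists ord0, ord_max.
have YA i : subs (Y i) A by move=> x; rewrite eA; exists i.
have fY i : finmod (Y i) M^i := finmod_subs (YA i) fM.
have n01 : ~ subs (Y j0) (Y j1) by move=> /irr/eqP; rewrite (negbTE j01).
have [Psi [P0 [P1 [sPsi eM [p0 p1 n10] [v0 v1] hS]]]] :=
  intersection_count (cr j0).1 (cr j0).2 (dY j0) (cr j1).1 (cr j1).2 (dY j1) sM (fY _) (fY _) n01.
have fin (V : vset K n) : finmod V M^i -> finmod V Psi by rewrite -eM; apply: finmod_refine.
have [ps [nps h1 h2]] := img_hypersurfaces cr dY (fun i => fin _ (fY i)).
have [p pK] := pchar_iota iota.
have dps : (\sum_(P <- ps) (msize P).-1 <= e)%N.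
  apply: (degree_hypersurface pK dA gA sPsi (fin _ fM) nps).
    move=> P z /h1[i hi] /hi[x [Yx zx]]; exists x; split; [exact: YA Yx | exact: zx].
  move=> z [x [/eA[i Yx] xz]]; have [P Pps hP] := h2 i; exists P => //.
  by apply: hP; exists x.
have [ups pps nas] := nps.
(* [P0] and [P1] are determined only up to units, so associates of them are located in [ps]. These
   are distinct because [P0] does not divide [P1], hence their degrees sum to at most [e]. *)
have comp j P : prime_elt P -> (forall f, van (img (Y j) Psi) f <-> divides P f) ->
    exists2 Q, Q \in ps & divides P Q.
  move=> pP vP; have [Q Qps hQ] := h2 j; exists Q => //; apply/vP => z; exact: hQ.
have [Q0 Q0ps d0] := comp _ _ p0 v0; have [Q1 Q1ps d1] := comp _ _ p1 v1.
have Q01 : Q0 != Q1.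
  apply/eqP => eQ; apply: n10; apply: divides_trans d0 _; rewrite eQ.
  exact: prime_assoc p1 (pps _ Q1ps) d1.
have mle (P Q : {mpoly K[s.+1]}) : prime_elt Q -> divides P Q -> (msize P <= msize Q)%N.
  move=> pQ [c eQ]; have := prime_msize pQ; rewrite eQ => sQ.
  have [cn0 Pn0] : c != 0 /\ P != 0.
    by split; apply: contraTneq sQ => ->; rewrite ?mul0r ?mulr0 msize0.
  rewrite msizeM //; move: cn0; rewrite -msize_poly_eq0 -lt0n.
  by case: (msize c) => // k _; rewrite addSn leq_addl.
have m0 := mle _ _ (pps _ Q0ps) d0; have m1 := mle _ _ (pps _ Q1ps) d1.
have s0 := prime_msize p0; have s1 := prime_msize p1.
have de : ((msize Q0).-1 + (msize Q1).-1 <= e)%N.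
  apply: leq_trans dps; rewrite (big_rem Q0) //= (big_rem Q1) /=; first by rewrite addnA leq_addr.
  by rewrite mem_rem_uniq // inE eq_sym Q01.
have hA : (#|F| * #|Fq_points iota A| <= (msize P0).-1 * (msize P1).-1 * #|F| ^ s)%N.
  by apply: hS => a /Fq_pointsP/rat h.
(* The factor 4 comes from 4xy <= (x + y)^2; two degrees of at least 1 give [1 < e]. *)
have natl (a b c d k : nat) : (1 < a -> 1 < b -> a <= c -> b <= d -> c.-1 + d.-1 <= k ->
    1 < k /\ 4 * (a.-1 * b.-1) <= k ^ 2)%N by move=> a1 b1 ac bd h;
    split; [lia | apply: leq_trans (nat_AGM2 _ _) _; rewrite leq_sqr; lia].
have [e1 e2] := natl _ _ _ _ _ s0 s1 m0 m1 de; split=> //.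
by rewrite -mulnA (leq_trans (leq_mul (leqnn 4) hA)) // mulnA leq_mul2r e2 orbT.
Qed.

Lemma is_degree_shift (A : vset K n) u e : is_degree A e -> is_degree (shift A u) e.
Proof.
have tr (B C : vset K n) v k : (forall x, C x <-> B (x - v)) -> has_card B k -> has_card C k.
  move=> h [s [us hs sk]]; exists (map (fun x => x + v) s); split; last by rewrite size_map.
    by rewrite map_inj_uniq // => x y /addIr.
  move=> x; rewrite h hs; split=> [xs|/mapP[y ys ->]]; last by rewrite addrK.
  by apply/mapP; exists (x - v); rewrite ?subrK.
have aff k a (B : 'M[K]_(k, n)) v x : aff_sub (a + v) B x <-> aff_sub a B (x - v).
  split=> [[w ->]|[w e']]; exists w; first by rewrite addrAC addrK.
  by rewrite addrAC -e' subrK.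
move=> [r [dA [[a [B [rB cB]]] mx]]]; exists r; split.
  exact: (is_dim_homeo (homeo_shift u) dA).
split; [exists (a + u), B; split=> // |].
  by apply: (tr _ _ u) cB => x; rewrite /setIv aff; apply: iff_refl.
move=> a' B' k rB' cB'; apply: (mx (a' - u) B' k rB').
by apply: (tr _ _ (- u)) cB' => x; rewrite /setIv /shift /= aff opprK addrK; apply: iff_refl.
Qed.

End Counts.

(** * Sumsets *)

Lemma card_bigcup_le (T I : finType) (P : pred I) (B : I -> {set T}) :
  (#|\bigcup_(i | P i) B i| <= \sum_(i | P i) #|B i|)%N.
Proof.
elim/big_ind2: _ => [|S a S' a' h h'|i _]; rewrite ?cards0 //.
by apply: leq_trans (leq_card_setU _ _) (leq_add h h').
Qed.

Section Sumsets.
Variable V : finZmodType.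
Implicit Types (A U B : {set V}) (w : V).

Definition set_shift w A : {set V} := [set x | x - w \in A].

Lemma card_set_shift w A : #|set_shift w A| = #|A|.
Proof.
rewrite -(card_preimset A (f := fun x => x - w)); last by move=> x y /addIr.
by congr #|pred_of_set _|; apply/setP => x; rewrite !inE.
Qed.

(* Fix a representation of each element of A + U; every other representation a + u of it, with
   chosen representation b + v, is determined by u, by w = u - v and by b, which lies in both A
   and A + w. *)
Lemma sumset_deficit A U :
  (#|A| * #|U| - #|[set (a + u)%R | a in A, u in U]| <=
   #|U| * \sum_(w in [set (v - w)%R | v in U, w in U] | w != 0%R) #|A :&: set_shift w A|)%N.
Proof.
set UU := [set v - w | v in U, w in U].
have -> : [set a + u | a in A, u in U] = (fun p : V * V => p.1 + p.2) @: setX A U.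
  apply/setP => x; apply/imset2P/imsetP => [[a u aA uU ->]|[[a u]]].
    by exists (a, u); rewrite // inE; apply/andP.
  by rewrite inE => /andP[aA uU] ->; exists a u.
set P := setX A U; pose f (p : V * V) := p.1 + p.2.
rewrite -cardsX -/P -/f.
pose rep c := odflt (0, 0) [pick p in P | f p == c].
have repP p : p \in P -> rep (f p) \in P /\ f (rep (f p)) = f p.
  move=> pP; rewrite /rep; case: pickP => [x /andP[xP /eqP] //|/(_ p)].
  by rewrite pP eqxx.
(* The pairs that are not the chosen representation of their sum; the chosen ones inject into the
   sumset, so the deficit is at most [#|N|]. *)
pose N := [set p in P | rep (f p) != p].
have PN : (#|P :\: N| <= #|f @: P|)%N.
  rewrite -(card_in_imset (f := f)); first by rewrite subset_leq_card // imsetS // subsetDl.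
  move=> p p'; rewrite !inE => /andP[+ pP] /andP[+ pP'];
    rewrite pP pP' /= !negbK => /eqP e /eqP e' ff.
  by rewrite -e -e' ff.
have NP : N \subset P by apply/subsetP => p; rewrite inE => /andP[].
apply: (@leq_trans #|N|).
  by rewrite leq_subLR -(cardsID N P) (setIidPr NP) addnC leq_add2r.
pose T := [set p : V * V | [&& p.1 \in UU, p.1 != 0 & p.2 \in A :&: set_shift p.1 A]].
have -> : (\sum_(w in UU | w != 0%R) #|A :&: set_shift w A| = #|T|)%N.
  under eq_bigr => w _ do rewrite -sum1_card.
  by rewrite pair_big_dep sum1dep_card; apply: eq_card => p; rewrite !in_set -andbA.
rewrite -cardsX.
pose h (p : V * V) := (p.2, (p.2 - (rep (f p)).2, (rep (f p)).1)).
rewrite -(card_in_imset (f := h) (D := mem N)).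
  apply: subset_leq_card; apply/subsetP => _ /imsetP[p pN ->].
  have pP := subsetP NP p pN; have [rP fr] := repP p pP.
  have nr : rep (f p) != p by move: pN; rewrite inE => /andP[].
  move: pP rP nr fr; rewrite /h; case: p {pN} => a u; case: (rep _) => b v /=.
  rewrite !inE /= => /andP[aA uU] /andP[bA vU] nr; rewrite /f /= => e.
  have eb : b = a + u - v by rewrite -e addrK.
  rewrite uU bA /= eb opprB addrA subrK addrK aA andbT.
  apply/andP; split; first by apply/imset2P; exists u v.
  apply: contraNneq nr; rewrite eb => /eqP; rewrite subr_eq0 => /eqP ->; by rewrite addrK.
move=> p p' pN p'N []; have [_ e] := repP p (subsetP NP p pN).
have [_ e'] := repP p' (subsetP NP p' p'N).
move=> e2 /eqP; rewrite e2 => /eqP/addrI/oppr_inj er2 er1.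
have ff : f p = f p' by rewrite -e -e' /f er1 er2.
by case: p p' e2 ff {pN p'N e e' er1 er2} => [a u] [b v] /= ->; rewrite /f /= => /addIr ->.
Qed.

(** A common point lies on an early piece and on the shift of an early piece, or else on a late
    piece or the shift of one; shifts preserve cardinality, whence the factor 2. *)
Lemma card_shift_meet m sigma (B : 'I_m -> {set V}) A w : A \subset \bigcup_i B i ->
  (#|A :&: set_shift w A| <=
   \sum_(i < m | (i < sigma)%N) \sum_(j < m | (j < sigma)%N) #|B i :&: set_shift w (B j)|
   + 2 * \sum_(i < m | (sigma <= i)%N) #|B i|)%N.
Proof.
move=> AB.
pose S := \bigcup_(i < m | (i < sigma)%N) \bigcup_(j < m | (j < sigma)%N) (B i :&: set_shift w (B
  j)).
pose S1 := \bigcup_(i < m | (sigma <= i)%N) B i.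
pose S2 := \bigcup_(i < m | (sigma <= i)%N) set_shift w (B i).
have sub : A :&: set_shift w A \subset S :|: (S1 :|: S2).
  apply/subsetP => x; rewrite !inE =>
    /andP[/(subsetP AB)/bigcupP[i _ xi] /(subsetP AB)/bigcupP[j _ xj]].
  case: (ltnP i sigma) => hi; last first.
    by apply/orP; right; apply/orP; left; apply/bigcupP; exists i.
  case: (ltnP j sigma) => hj; last first.
    by apply/orP; right; apply/orP; right; apply/bigcupP; exists j; rewrite ?inE.
  apply/orP; left; apply/bigcupP; exists i => //; apply/bigcupP; exists j => //.
  by rewrite !inE xi.
apply: leq_trans (subset_leq_card sub) _; apply: leq_trans (leq_card_setU _ _) _.
apply: leq_add.
  apply: leq_trans (card_bigcup_le _ _) _; apply: leq_sum => i _; exact: card_bigcup_le.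
apply: leq_trans (leq_card_setU _ _) _; rewrite mul2n -addnn; apply: leq_add.
  exact: card_bigcup_le.
apply: leq_trans (card_bigcup_le _ _) _.
by under eq_bigr => i _ do rewrite card_set_shift.
Qed.

(** Zero is a difference because [U] is non-empty; this accounts for the [- 1]. *)
Lemma sum_differences_const U c : U != set0 ->
  let UU := [set v - w | v in U, w in U] in
  (\sum_(w in UU | w != 0%R) c = (#|UU| - 1) * c)%N.
Proof.
move=> /set0Pn[u uU]; cbv zeta; set UU := [set v - w | v in U, w in U].
have U0 : 0 \in UU by apply/imset2P; exists u u; rewrite ?subrr.
rewrite sum_nat_cond_const (cardsD1 0 UU) U0 addKn; congr (_ * _)%N.
by apply: eq_card => w; rewrite !inE andbC.
Qed.

End Sumsets.

Lemma weighted_count m sigma rho (e N : 'I_m -> nat) (N2 : 'I_m -> 'I_m -> nat) q Q :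
  (sigma <= rho)%N ->
  (forall i j : 'I_m, i < sigma -> j < sigma -> q * N2 i j <= e i * e j * Q)%N ->
  (forall i : 'I_m, sigma <= i < rho -> q * N i <= e i * Q)%N ->
  (forall i : 'I_m, rho <= i -> 2 * (q * N i) <= e i ^ 2 * Q)%N ->
  (exists i0 : 'I_m, ((i0 < sigma) || (rho <= i0)) && (0 < e i0))%N ->
  (q * (\sum_(i < m | i < sigma) \sum_(j < m | j < sigma) N2 i j
        + 2 * \sum_(i < m | sigma <= i) N i) <= (\sum_(i < m) e i) ^ 2 * Q)%N.
Proof.
move=> sr h2 hE hG [i0 /andP[hi0 ei0]].
set D := (\sum_(i < m | i < sigma) e i)%N.
set E := (\sum_(i < m | sigma <= i < rho) e i)%N.
set G := (\sum_(i < m | rho <= i) e i)%N.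
have split_sum (f : 'I_m -> nat) : (\sum_(i < m | sigma <= i) f i =
    \sum_(i < m | sigma <= i < rho) f i + \sum_(i < m | rho <= i) f i)%N.
  rewrite (bigID (fun i : 'I_m => i < rho)%N) /=; congr (_ + _)%N.
  apply: eq_bigl => i; rewrite -leqNgt; case: (leqP rho i) => h; rewrite ?andbF // andbT.
  exact: leq_trans sr h.
have -> : (\sum_(i < m) e i = D + (E + G))%N.
  rewrite -split_sum (bigID (fun i : 'I_m => i < sigma)%N) /=; congr (_ + _)%N.
  by apply: eq_bigl => i; rewrite -leqNgt.
have DG : (0 < D + G)%N.
  have le (P : pred 'I_m) : P i0 -> (0 < \sum_(i < m | P i) e i)%N.
    by move=> Pi; rewrite (bigD1 i0) //= addn_gt0 ei0.
  rewrite addn_gt0; apply/orP; case/orP: hi0 => hi0.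
    by left; apply: (le (fun i : 'I_m => i < sigma)%N).
  by right; apply: (le (fun i : 'I_m => rho <= i)%N).
have l2 : (q * (\sum_(i < m | i < sigma) \sum_(j < m | j < sigma) N2 i j) <= D * D * Q)%N.
  rewrite /D big_distrl big_distrl /= big_distrr /=; apply: leq_sum => i hi.
  rewrite big_distrr big_distrr /= big_distrl /=; apply: leq_sum => j hj; exact: h2.
have lE : (q * \sum_(i < m | sigma <= i < rho) N i <= E * Q)%N.
  by rewrite /E big_distrl /= big_distrr /=; apply: leq_sum => i; apply: hE.
have lG : (2 * (q * \sum_(i < m | rho <= i) N i) <= G * G * Q)%N.
  rewrite {1}/G big_distrl big_distrl /= big_distrr big_distrr /=; apply: leq_sum => i hi.
  apply: leq_trans (hG i hi) _; rewrite leq_mul2r -mulnn leq_mul2l /G (bigD1 i) //=.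
  by rewrite leq_addr !orbT.
(* The cross term 2E(D + G) of the square absorbs 2E because D + G > 0, which is the purpose of the
   hypothesis on [i0]. *)
have l3 : (D * D + (2 * E + G * G) <= (D + (E + G)) ^ 2)%N by nia.
have l4 := leq_mul l3 (leqnn Q).
rewrite split_sum; apply: leq_trans l4; move: l2 lE lG.
set a := (\sum_(i < m | _) \sum_(j < m | _) _)%N.
set b := (\sum_(i < m | sigma <= i < rho) _)%N; set c := (\sum_(i < m | rho <= i) _)%N; lia.
Qed.

Theorem theorem3p3
  (F : finFieldType) (K : closedFieldType) (iota : {rmorphism F -> K})
  (K_alg : forall x : K, exists p : {poly F}, p != 0 /\ root (map_poly iota p) x)
  (n : nat) (X : vset K n) (HX : Fq_variety iota X)
  (r : nat) (Hr : is_dim X r)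
  (m sigma rho : nat) (Xc : 'I_m -> vset K n)
  (Hsr : (sigma <= rho)%N) (Hrm : (rho <= m)%N)
  (Hirr : forall i, Fq_irreducible iota (Xc i))
  (Hunion : set_eq X (fun x => exists i, Xc i x))
  (Hnonred : forall i j, i != j -> ~ subs (Xc i) (Xc j))
  (Hnum : forall i : 'I_m,
     ((i < sigma)%N -> irreducibleK (Xc i) /\ is_dim (Xc i) r) /\
     ((sigma <= i < rho)%N ->
        irreducibleK (Xc i) /\ exists r', is_dim (Xc i) r' /\ (r' < r)%N) /\
     ((rho <= i)%N -> ~ irreducibleK (Xc i)))
  (ds : 'I_m -> nat) (Hds : forall i, is_degree (Xc i) (ds i))
  (d : nat) (Hd : d = (\sum_(i < m) ds i)%N) (Hdq : (d < #|F|)%N)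
  (U : {set 'rV[F]_n}) (HU : U != set0) :
  let Xq := Fq_points iota X in
  let UU := [set v - w | v in U, w in U] in
  let Delta := (#|Xq| * #|U| - #|[set (a + u)%R | a in Xq, u in U]|)%N in
  (Delta <= #|U| *
     (\sum_(u in UU | u != 0%R) \sum_(i < m | (i < sigma)%N) \sum_(j < m | (j < sigma)%N)
         #|Fq_points iota (Xc i) :&: Fq_points iota (shift (Xc j) (map_mx iota u))|
      + 2 * (#|UU| - 1) * \sum_(i < m | (sigma <= i)%N) #|Fq_points iota (Xc i)|))%N
  /\
  ((forall u, u \in UU -> u != 0 -> forall i j : 'I_m, (i < sigma)%N -> (j < sigma)%N ->
        ~ set_eq (Xc i) (shift (Xc j) (map_mx iota u))) ->
   (Delta%:Q <= (#|U| * (#|UU| - 1) * d ^ 2)%N%:Q * (#|F|%:Q) ^ (r%:Z - 1))).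
Proof.
cbv zeta; set UU := [set v - w | v in U, w in U].
have Fshift i u : Fq_points iota (shift (Xc i) (map_mx iota u)) =
    set_shift u (Fq_points iota (Xc i)).
  by apply/setP => a; rewrite !inE /shift map_mxB.
have cover : Fq_points iota X \subset \bigcup_i Fq_points iota (Xc i).
  apply/subsetP => a /Fq_pointsP/Hunion[i ai].
  by apply/bigcupP; exists i => //; apply/Fq_pointsP.
have deficit := sumset_deficit (Fq_points iota X) U; rewrite -/UU in deficit.
have meet u := card_shift_meet sigma u cover.
have nUU c := sum_differences_const c HU; cbv zeta in nUU; rewrite -/UU in nUU.
split.
  apply: leq_trans deficit _; rewrite leq_mul2l; apply/orP; right.
  rewrite -mulnA mulnCA -nUU -big_split /=; apply: leq_sum => u _.
  apply: leq_trans (meet u) _; rewrite leq_add2r.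
  by apply: leq_sum => i _; apply: leq_sum => j _; rewrite Fshift.
move=> shift_free.
have XcX i : subs (Xc i) X by move=> x Xx; apply/Hunion; exists i.
have cX i : closedK (Xc i) := Fq_variety_closed (Hirr i).1.
have dsq i : (ds i < #|F|)%N.
  by apply: leq_ltn_trans Hdq; rewrite Hd (bigD1 i) //= leq_addr.
have [s dimX] : exists s : 'I_m -> nat, forall i, is_dim (Xc i) (s i).
  apply: (choose_fun (R := fun i s => is_dim (Xc i) s)) => i.
  by have [? [? [s' [? [_ ? _ _ _]]]]] := rational_tower1 (Hirr i) (Hds i) (dsq i); exists s'.
have sr i : (s i <= r)%N.
  have [[Z [ch ZX]] _] := dimX i; apply: Hr.2 ch _ => x /ZX; exact: XcX.
have rn : (r <= n)%N by have [[Z [ch _]] _] := Hr; apply: irr_chain_bound ch.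
have q0 : (0 < #|F|)%N by apply/card_gt0P; exists 0.
have comp i : exists M : 'M[F]_(n, s i), split_proj M /\ finmod (Xc i) (map_mx iota M).
  have [m' [Y [s' [M [_ d' _ sM fM]]]]] := rational_tower1 (Hirr i) (Hds i) (dsq i).
  by have e := is_dim_inj d' (dimX i); move: M sM fM; rewrite e => M; exists M.
(* The component containing the top of a longest chain in [X] has full dimension; it is either
   absolutely irreducible or of the last kind, and its degree is positive. *)
have [i0 ri0] : exists i0, (r <= s i0)%N.
  have [[Z [ch ZX]] _] := Hr; have [cZ rZ] := ch.1 r (leqnn r).
  have [|i _ hi] := irreducible_bigU (P := fun _ => True) rZ cZ cX.
    by move=> x /ZX/Hunion[i xi]; exists i.
  by exists i; apply: (dimX i).2 ch hi.
have low (i : 'I_m) : (sigma <= i < rho)%N -> (s i < r)%N.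
  by move=> /((Hnum i).2.1)[_ [r' [d' lt]]]; rewrite (is_dim_inj (dimX i) d').
have pow i : (s i <= r)%N -> (#|F| ^ s i <= #|F| ^ r)%N by apply: leq_pexp2l.
(* One projection for all components at once: two of them can be compared only over a common base.
   This is where the sum of all degrees, and not just each degree, has to be below q. *)
have [M [sM fM]] : exists M : 'M[F]_(n, r), split_proj M /\
    forall i, finmod (Xc i) (map_mx iota M).
  apply: (rational_tower iota (s := s) (d := ds)) => //; last by rewrite -Hd.
    exact: leq_ltn_trans (ltn_ord i0).
  move=> i; have [m' [Y [s' [_ [pY d' _ _ _]]]]] := rational_tower1 (Hirr i) (Hds i) (dsq i).
  by rewrite (is_dim_inj (dimX i) d'); split=> //; [have [_ []] := Hirr i | exists m', Y].
have count w : w \in UU -> w != 0 -> (#|F| *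
    (\sum_(i < m | (i < sigma)%N) \sum_(j < m | (j < sigma)%N)
       #|Fq_points iota (Xc i) :&: set_shift w (Fq_points iota (Xc j))|
     + 2 * \sum_(i < m | (sigma <= i)%N) #|Fq_points iota (Xc i)|) <= d ^ 2 * #|F| ^ r)%N.
  move=> wU w0; rewrite Hd; apply: weighted_count Hsr _ _ _ _.
  - move=> i j hi hj; rewrite -Fshift.
    have [ri di] := (Hnum i).1 hi; have [rj dj] := (Hnum j).1 hj.
    have hs := homeo_shift (map_mx iota w); have [_ _ cs _] := hs.
    apply: (card_intersection (cX i) ri di (Hds i) (cs _ (cX j)) (irreducible_homeo hs rj)
      (is_dim_homeo hs dj) (is_degree_shift _ (Hds j)) sM (fM i) (finmod_shift _ (fM j))).
    exact: shift_free.
  - move=> i hi; have [M' [sM' fM']] := comp i.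
    apply: leq_trans (leq_mul (leqnn _) (card_Fq_points (dimX i) (Hds i) sM' fM')) _.
    rewrite mulnCA leq_mul2l -expnS; apply/orP; right; exact: leq_pexp2l q0 (low i hi).
  - move=> i hi.
    have [_ h] := card_reducible (Hirr i) ((Hnum i).2.2 hi) (dimX i) (Hds i) (dsq i).
    apply: leq_trans (leq_mul (leqnn _) (pow i (sr i))); apply: leq_trans h.
    by rewrite mulnA leq_mul // leq_mul.
  - exists i0; case: (ltnP i0 sigma) => h1 /=.
      have [ri di] := (Hnum i0).1 h1; have [M' [sM' fM']] := comp i0.
      exact: (degree_gt0 (cX i0) ri (dimX i0) (Hds i0) (map_split_proj iota sM') fM').
    case: (ltnP i0 rho) => h2 /=; first by have := low i0; rewrite h1 h2 ltnNge ri0 => /(_ isT).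
    have [h _] := card_reducible (Hirr i0) ((Hnum i0).2.2 h2) (dimX i0) (Hds i0) (dsq i0).
    exact: ltnW.
set Delta := (_ - _)%N in deficit *.
have hD : (#|F| * Delta <= #|U| * (#|UU| - 1) * d ^ 2 * #|F| ^ r)%N.
  apply: leq_trans (leq_mul (leqnn _) deficit) _.
  rewrite mulnCA -[(_ * #|F| ^ r)%N]mulnA -[leqRHS]mulnA leq_mul2l -nUU big_distrr /=; apply/orP;
    right.
  apply: leq_sum => w /andP[wU w0].
  by apply: leq_trans (count w wU w0); rewrite leq_mul2l meet orbT.
have qn0 : (#|F|%:Q != 0) by rewrite Num.Theory.pnatr_eq0 -lt0n.
(* The exponent [r - 1] is an integer, equal to -1 for [r = 0]; clearing one factor q leaves the
   inequality [hD] between natural numbers. *)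
rewrite expfzDr // mulrA Num.Theory.ler_pdivlMr ?Num.Theory.ltr0n //.
by rewrite -!pmulrn -exprnP -[_ ^+ r]natrX -!natrM Num.Theory.ler_nat mulnC.
Qed.
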